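(* Let $M$ be a Riemannian manifold with $\dim M=3$, and let $\gamma\colon[0,\ell]\to M$ be a closed (smooth, unit-speed) Frenet curve with torsion $\tau$. (1) Let $S$ be an oriented surface in $M$. If $\gamma$ is a line of curvature of $S$, then the total torsion $\int_0^\ell\tau\,dt$ is an integer multiple of $2\pi$; in particular, $\int_0^\ell\tau\,dt=0$ when $S$ is convex, i.e. when the second fundamental form of $S$ is positive definite. (2) Conversely, if $\int_0^\ell\tau\,dt$ is an integer multiple of $2\pi$, then there exists an orientable surface in $M$ in which $\gamma$ is a line of curvature.
   Context: $D_t$ is the covariant derivative along $\gamma$ induced by the Levi-Civita connection of $M$. $\gamma$ is a Frenet curve if $D_t\gamma'$ is nowhere zero and, with $P=D_t\gamma'/\kappa$, $\kappa=\|D_t\gamma'\|$ (the principal normal), there is a smooth unit vector field $W(P)$ along $\gamma$, orthogonal to $\gamma'$ and $P$, that is everywhere proportional to $T=-\pi_{\mathcal{H}}D_tP$, where $\pi_{\mathcal{H}}$ is the orthogonal projection onto the line bundle $\mathcal{H}=\mathrm{span}\{\gamma',P\}^\perp$ along $\gamma$. The torsion of $\gamma$ is $\tau=\langle T,W(P)\rangle$ (defined up to a global sign). ''Oriented'' (orientable) surface means one equipped with (admitting) a globally defined smooth unit normal field $N_S$; surfaces may be immersed (with $\gamma$ a curve in the immersed surface). $\gamma$ is a line of curvature of $S$ if $\gamma'$ is everywhere a principal direction, i.e. $D_tN_S$ is everywhere proportional to $\gamma'$. The second fundamental form of $S$ is taken with respect to $N_S$: $\mathrm{II}(X,X)=\langle\nabla_XX,N_S\rangle$.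 $\gamma$ is closed if it extends to a smooth $\ell$-periodic curve (in part (1), as a closed curve in $S$). Vector fields along the closed curve $\gamma$, including $W(P)$, are understood to be $\ell$-periodic. *)

(* Defs.v *)
From mathcomp Require Import all_boot all_order all_algebra.
From mathcomp Require Import all_classical all_reals all_analysis.

Set Implicit Arguments.
Unset Strict Implicit.
Unset Printing Implicit Defensive.

Import Order.TTheory GRing.Theory Num.Theory.
Import numFieldNormedType.Exports.

Local Open Scope classical_set_scope.
Local Open Scope ring_scope.

(* C^k on an open set U, by iterated directional derivatives. All uses below
   have finite-dimensional V and W, where this is the usual notion. *)
Fixpoint Ck_on (R : realType) (V W : normedModType R) (k : nat) (U : set V)
    (f : V -> W) : Prop :=
  (forall x, U x -> {for x, continuous f}) /\
  match k with
  | 0%N => True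
  | k'.+1 => forall v : V,
      (forall x, U x -> derivable f x v) /\ Ck_on k' U (fun x => 'D_v f x)
  end.

Definition smooth_on (R : realType) (V W : normedModType R) (U : set V)
    (f : V -> W) : Prop :=
  forall k, Ck_on k U f.

(* A chart is a homeomorphism cdom -> ccod between open sets; the values of
   cmap outside cdom and of cinv outside ccod are irrelevant. *)
Record chart (R : realType) (n : nat) (X : topologicalType) := Chart {
  cdom : set X;
  ccod : set 'rV[R]_n;
  cmap : X -> 'rV[R]_n;
  cinv : 'rV[R]_n -> X;
  cdom_open : open cdom;
  ccod_open : open ccod;
  cmap_cod : forall p, cdom p -> ccod (cmap p);
  cinv_dom : forall y, ccod y -> cdom (cinv y);
  cmapK : forall p, cdom p -> cinv (cmap p) = p;
  cinvK : forall y, ccod y -> cmap (cinv y) = y;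
  cmap_cont : forall p, cdom p -> {for p, continuous cmap};
  cinv_cont : forall y, ccod y -> {for y, continuous cinv} }.

(* Smooth n-manifolds without boundary. The atlas need not be maximal. The
   preferred charts chart_at carry no mathematical content: they only serve
   to represent tangent vectors, see below. *)
Record manifold (R : realType) (n : nat) := Manifold {
  carrier :> topologicalType;
  manifold_hausdorff : hausdorff_space carrier;
  manifold_second_countable : @second_countable carrier;
  atlas : set (chart R n carrier);
  atlas_compat : forall c d, atlas c -> atlas d ->
    smooth_on (ccod c `&` cinv c @^-1` cdom d) (cmap d \o cinv c);
  chart_at : carrier -> chart R n carrier;
  chart_at_atlas : forall p, atlas (chart_at p);
  chart_at_dom : forall p, cdom (chart_at p) p }.

Arguments atlas {R n} m _.

Section TangentVectors.
Variables (R : realType) (n : nat) (M : manifold R n).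

(* A tangent vector at p is the row of its components in chart_at p, so that
   T_p M is 'rV[R]_n for every p. A vector field along a map F : V -> M is a
   function Y : V -> 'rV[R]_n, where Y x is a tangent vector at F x; since
   chart_at jumps, its regularity must be tested on the components
   in_chart c (F x) (Y x) in a fixed chart c. *)

Definition in_chart (c : chart R n M) (p : M) (v : 'rV[R]_n) : 'rV[R]_n :=
  'D_v (cmap c \o cinv (chart_at p)) (cmap (chart_at p) p).

(* The tangent vector at cinv c y whose components in the chart c are v. *)
Definition of_chart (c : chart R n M) (y v : 'rV[R]_n) : 'rV[R]_n :=
  'D_v (cmap (chart_at (cinv c y)) \o cinv c) y.

Section Along.
Variables (V : normedModType R) (F : V -> M).

Definition smooth_into (U : set V) : Prop :=
  (forall x, U x -> {for x, continuous F}) /\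
  forall c, atlas M c -> smooth_on (U `&` F @^-1` cdom c) (cmap c \o F).

Definition smooth_along (U : set V) (Y : V -> 'rV[R]_n) : Prop :=
  forall c, atlas M c ->
    smooth_on (U `&` F @^-1` cdom c) (fun x => in_chart c (F x) (Y x)).

(* dF_x(v) *)
Definition push (x v : V) : 'rV[R]_n := 'D_v (cmap (chart_at (F x)) \o F) x.

End Along.

End TangentVectors.

Record metric (R : realType) (n : nat) (M : manifold R n) := Metric {
  gmx : M -> 'M[R]_n;
  gmx_sym : forall p, (gmx p)^T = gmx p;
  gmx_pos : forall p (v : 'rV[R]_n), v <> 0 ->
    0 < (v *m gmx p *m v^T) ord0 ord0;
  gmx_smooth : forall c, atlas M c ->
    smooth_on (ccod c)
      (fun y => \matrix_(i < n, j < n)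
         (of_chart c y (delta_mx ord0 i) *m gmx (cinv c y)
            *m (of_chart c y (delta_mx ord0 j))^T) ord0 ord0) }.

Section Riemannian.
Variables (R : realType) (n : nat) (M : manifold R n) (g : metric M).

Definition inner (p : M) (u v : 'rV[R]_n) : R :=
  (u *m gmx g p *m v^T) ord0 ord0.

Definition gnorm (p : M) (v : 'rV[R]_n) : R := Num.sqrt (inner p v v).

(* The matrix (g_ij) of the metric in the chart c. *)
Definition gram (c : chart R n M) (y : 'rV[R]_n) : 'M[R]_n :=
  \matrix_(i < n, j < n)
    inner (cinv c y) (of_chart c y (delta_mx ord0 i))
                     (of_chart c y (delta_mx ord0 j)).

Definition dgram (c : chart R n M) (y : 'rV[R]_n) (k i j : 'I_n) : R :=
  'D_(delta_mx ord0 k) (gram c) y i j.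

(* The Christoffel symbol Gamma^k_ij of the Levi-Civita connection. *)
Definition christoffel (c : chart R n M) (y : 'rV[R]_n) (k i j : 'I_n) : R :=
  2^-1 * \sum_(m < n) invmx (gram c y) k m *
    (dgram c y i j m + dgram c y j i m - dgram c y m i j).

(* The Levi-Civita covariant derivative nabla_v Y at x of a vector field Y
   along F : V -> M; for V = R and v = 1 this is D_t Y. *)
Definition covd (V : normedModType R) (F : V -> M) (Y : V -> 'rV[R]_n)
    (x v : V) : 'rV[R]_n :=
  let c := chart_at (F x) in
  'D_v (fun y => in_chart c (F y) (Y y)) x +
  \row_(k < n) \sum_(i < n) \sum_(j < n)
     christoffel c (cmap c (F x)) k i j * push F x v ord0 i * Y x ord0 j.

End Riemannian.

Section Curves.
Variable R : realType.

(* A closed curve defined on [0, l] is given by its l-periodic extension. *)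
Definition closed_curve n (M : manifold R n) (l : R) (c : R -> M) : Prop :=
  smooth_into c setT /\ forall t, c (t + l) = c t.

Definition velocity n (M : manifold R n) (c : R -> M) (t : R) : 'rV[R]_n :=
  push c t 1.

Definition Dt n (M : manifold R n) (g : metric M) (c : R -> M)
    (Y : R -> 'rV[R]_n) (t : R) : 'rV[R]_n :=
  covd g c Y t 1.

Variables (M : manifold R 3) (g : metric M) (gamma : R -> M).

Definition unit_speed : Prop := forall t, gnorm g (gamma t) (velocity gamma t) = 1.

Definition acceleration : R -> 'rV[R]_3 := Dt g gamma (velocity gamma).

Definition curvature (t : R) : R := gnorm g (gamma t) (acceleration t).

Definition principal_normal (t : R) : 'rV[R]_3 :=
  (curvature t)^-1 *: acceleration t.

(* Orthogonal projection onto {gamma', P}^perp; gamma' and P are orthonormal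
   when gamma has unit speed and nowhere zero acceleration. *)
Definition projH (t : R) (v : 'rV[R]_3) : 'rV[R]_3 :=
  v - inner g (gamma t) v (velocity gamma t) *: velocity gamma t
    - inner g (gamma t) v (principal_normal t) *: principal_normal t.

Definition torsion_vector (t : R) : 'rV[R]_3 :=
  - projH t (Dt g gamma principal_normal t).

(* gamma is a closed Frenet curve with W(P) = W. *)
Definition frenet (l : R) (W : R -> 'rV[R]_3) : Prop :=
  (forall t, acceleration t <> 0) /\
  smooth_along gamma setT W /\
  (forall t, W (t + l) = W t) /\
  (forall t, gnorm g (gamma t) (W t) = 1) /\
  (forall t, inner g (gamma t) (W t) (velocity gamma t) = 0) /\
  (forall t, inner g (gamma t) (W t) (principal_normal t) = 0) /\
  (forall t, exists a : R, torsion_vector t = a *: W t).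

Definition torsion (W : R -> 'rV[R]_3) (t : R) : R :=
  inner g (gamma t) (torsion_vector t) (W t).

End Curves.

Section Surfaces.
Variables (R : realType) (M : manifold R 3) (g : metric M).
Variables (S : manifold R 2) (f : S -> M).

Definition differential (p : S) (v : 'rV[R]_2) : 'rV[R]_3 :=
  push (f \o cinv (chart_at p)) (cmap (chart_at p) p) v.

Definition immersion : Prop :=
  (forall c, atlas S c -> smooth_into (f \o cinv c) (ccod c)) /\
  forall p v, differential p v = 0 -> v = 0.

Definition unit_normal (N : S -> 'rV[R]_3) : Prop :=
  (forall c, atlas S c ->
     smooth_along (f \o cinv c) (ccod c) (N \o cinv c)) /\
  (forall p, gnorm g (f p) (N p) = 1) /\
  (forall p v, inner g (f p) (N p) (differential p v) = 0).

(* X is a tangent vector field of S, smooth on a neighbourhood of p. *)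
Definition smooth_field_near (p : S) (X : S -> 'rV[R]_2) : Prop :=
  exists2 U : set S, open_nbhs p U &
    forall c, atlas S c ->
      smooth_along (cinv c) (ccod c `&` cinv c @^-1` U) (X \o cinv c).

(* II(X, X) = <nabla_X X, N> at p, where nabla_X X is computed along the map
   f read in a chart of S around p, for the field df(X). *)
Definition second_form (N : S -> 'rV[R]_3) (X : S -> 'rV[R]_2) (p : S) : R :=
  let c := chart_at p in
  inner g (f p)
    (covd g (f \o cinv c) (fun y => differential (cinv c y) (X (cinv c y)))
       (cmap c p) (X p))
    (N p).

Definition convex (N : S -> 'rV[R]_3) : Prop :=
  forall p X, smooth_field_near p X -> X p <> 0 -> 0 < second_form N X p.

(* For the curve f \o c in the immersed surface f : S -> M. *)
Definition line_of_curvature (N : S -> 'rV[R]_3) (c : R -> S) : Prop :=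
  forall t, exists a : R, Dt g (f \o c) (N \o c) t = a *: velocity (f \o c) t.

End Surfaces.

(* Main.v *)
Require Import Defs.
From HB Require Import structures.
From mathcomp Require Import all_boot all_order all_algebra.
From mathcomp Require Import all_classical all_reals all_analysis.
From mathcomp Require Import ring lra zify.
From mathcomp Require finmap.

Set Implicit Arguments.
Unset Strict Implicit.
Unset Printing Implicit Defensive.

Import Order.TTheory GRing.Theory Num.Theory.
Import numFieldNormedType.Exports.

Local Open Scope classical_set_scope.
Local Open Scope ring_scope.

(* Let N be a unit field along gamma, orthogonal to gamma', with
   coordinates (x, y) in the frame (P, W P). Since D_t P = - kappa gamma' - tau W
   and D_t W = tau P, the field D_t N is proportional to gamma' exactly when
   x' = - tau y and y' = tau x, i.e. when (x, y) turns at angular speed tau.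

   (1) For the restriction of N_S, periodicity of (x, y) forces the total angle
   to be in 2 pi Z. If S is convex then kappa x = <D_t gamma', N> = II > 0, so
   (x, y) stays in a half-plane and the total angle is 0.

   (2) If theta' = tau and theta increases by a multiple of 2 pi over a period,
   then N = cos theta P + sin theta W and B = - sin theta P + cos theta W are
   periodic fields, and it suffices to find an immersed strip along gamma tangent
   to gamma' and B. Instead of the exponential map, a periodic smooth map
   Phi (t, s, r) with d_s Phi = mu B and d_r Phi = mu N, mu > 0, on s = r = 0 is
   built from finitely many charts c_k: starting from gamma t, the map is pushed
   successively in each chart by phi_k t *: (s B + r N), where the phi_k are
   bump functions whose supports are adapted to the charts. The strip is
   Phi (t, s, 0) on a quotient of an open set by t |-> t + l, and its normal is
   obtained from d_r Phi by a Gram matrix. *)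

(** * Calculus of smooth maps *)

(** The obstacle is the representation of tangent vectors: their components refer to a chart that
    jumps with the base point, so neither smoothness nor [covd] can be read off directly. Everything
    is transported to a fixed chart, and the change-of-chart law of the Christoffel symbols, derived
    from Koszul's formula, makes [covd] independent of the chart. Smoothness means iterated
    directional derivatives, so the chain rule needs the differentiability of C^1 functions,
    obtained from the mean value theorem. No orientation of M is given, hence no cross product: the
    binormal is the field [W], and the normal of the strip comes from a dual basis. Periodicity of N
    and B makes the strip an annulus with a global normal, not a Möbius band. An exponential map
    would require solving the geodesic equation; only first derivatives on the axis matter, so any
    map with the prescribed ones serves, and since mu need only be positive the bumps are not
    normalised. *)

Section CkBasics.
Variables (R : realType) (V W : normedModType R).
Implicit Types (U : set V) (f g : V -> W) (k : nat).

Lemma open_near (T : topologicalType) (U : set T) x :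
  open U -> U x -> \forall y \near x, U y.
Proof. by move=> oU Ux; exact: open_nbhs_nbhs. Qed.

Lemma Ck_on_cont k U f x : Ck_on k U f -> U x -> {for x, continuous f}.
Proof. by case: k => [|k] [+ _]; apply. Qed.

Lemma Ck_on_derivable k U f x v : Ck_on k.+1 U f -> U x -> derivable f x v.
Proof. by case=> _ /(_ v)[+ _]; apply. Qed.

Lemma Ck_on_derive k U f v : Ck_on k.+1 U f -> Ck_on k U ('D_v f).
Proof. by case=> _ /(_ v)[]. Qed.

Lemma Ck_on_pred k U f : Ck_on k.+1 U f -> Ck_on k U f.
Proof.
elim: k f => [|k IH] f [cf df]; split=> // v.
by have [dfv Dfv] := df v; split=> //; exact: IH.
Qed.

Lemma Ck_on_subset k U U' f : U' `<=` U -> Ck_on k U f -> Ck_on k U' f.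
Proof.
move=> U'U; elim: k f => [|k IH] f [cf df]; split=> //.
- by move=> x /U'U /cf.
- by move=> x /U'U /cf.
- by move=> v; have [dfv Dfv] := df v; split; [move=> x /U'U /dfv|exact: IH].
Qed.

(** [Ck_on] is a pointwise condition on the ambient function, with limits taken in the whole space,
    so the sets [U'] may be arbitrary and need no compatibility. *)
Lemma Ck_on_local k U f :
  (forall x, U x -> exists2 U' : set V, U' x & Ck_on k U' f) -> Ck_on k U f.
Proof.
elim: k f => [|k IH] f H.
  by split=> // x /H[U' U'x] /Ck_on_cont; apply.
split=> [x /H[U' U'x] /Ck_on_cont|v]; first by apply.
split=> [x /H[U' U'x] /Ck_on_derivable|]; first by apply.
by apply: IH => x /H[U' U'x /Ck_on_derive H']; exists U'.
Qed.

Lemma continuous_near_eq (T Z : topologicalType) (f g : T -> Z) x :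
  (\forall y \near x, f y = g y) -> {for x, continuous f} ->
  {for x, continuous g}.
Proof.
move=> fg cf; rewrite /prop_for /continuous_at -(nbhs_singleton fg).
by apply: cvg_trans cf; apply: near_eq_cvg; exact: filterS fg.
Qed.

Lemma Ck_on_ext k U f g : open U -> (forall x, U x -> f x = g x) ->
  Ck_on k U f -> Ck_on k U g.
Proof.
move=> oU; have nearfg f' g' x : (forall x, U x -> f' x = g' x) -> U x ->
    \forall y \near x, f' y = g' y.
  by move=> fg Ux; apply: filterS (open_near oU Ux).
elim: k f g => [|k IH] f g fg [cf df]; split=> //.
- by move=> x Ux; apply: continuous_near_eq (cf _ Ux); exact: nearfg.
- by move=> x Ux; apply: continuous_near_eq (cf _ Ux); exact: nearfg.
- move=> v; have [dfv Dfv] := df v; split.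
    by move=> x Ux; apply: near_eq_derivable (dfv _ Ux); exact: nearfg.
  by apply: IH Dfv => x Ux; apply: near_eq_derive; exact: nearfg.
Qed.

Lemma smooth_on_cont U f x : smooth_on U f -> U x -> {for x, continuous f}.
Proof. by move=> /(_ 0%N) /Ck_on_cont; apply. Qed.

Lemma smooth_on_derivable U f x v : smooth_on U f -> U x -> derivable f x v.
Proof. by move=> /(_ 1%N) /Ck_on_derivable; apply. Qed.

Lemma smooth_on_derive U f v : smooth_on U f -> smooth_on U ('D_v f).
Proof. by move=> sf k; exact: Ck_on_derive. Qed.

Lemma smooth_on_subset U U' f : U' `<=` U -> smooth_on U f -> smooth_on U' f.
Proof. by move=> U'U sf k; exact: Ck_on_subset (sf k). Qed.

Lemma smooth_on_ext U f g : open U -> (forall x, U x -> f x = g x) ->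
  smooth_on U f -> smooth_on U g.
Proof. by move=> oU fg sf k; exact: Ck_on_ext (sf k). Qed.

Lemma smooth_on_local U f :
  (forall x, U x -> exists2 U' : set V, U' x & smooth_on U' f) ->
  smooth_on U f.
Proof.
by move=> H k; apply: Ck_on_local => x /H[U' U'x sf]; exists U'.
Qed.

End CkBasics.

Section CkCst.
Variables (R : realType) (V W : normedModType R).

Lemma Ck_on_cst k (U : set V) (w : W) : Ck_on k U (cst w).
Proof.
elim: k w => [|k IH] w; split=> //.
- by move=> x _; exact: cst_continuous.
- by move=> x _; exact: cst_continuous.
- move=> v; split=> [x _|]; first exact: derivable_cst.
  rewrite (_ : (fun x => _) = cst 0) //.
  by apply/funext => x; rewrite derive_cst.
Qed.

Lemma smooth_on_cst (U : set V) (w : W) : smooth_on U (cst w).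
Proof. by move=> k; exact: Ck_on_cst. Qed.

Lemma Ck_onD k (U : set V) (f g : V -> W) : open U ->
  Ck_on k U f -> Ck_on k U g -> Ck_on k U (fun x => f x + g x).
Proof.
move=> oU; elim: k f g => [|k IH] f g [cf df] [cg dg]; split=> //.
- by move=> x Ux; apply: continuousD; [exact: cf|exact: cg].
- by move=> x Ux; apply: continuousD; [exact: cf|exact: cg].
- move=> v; have [df1 df2] := df v; have [dg1 dg2] := dg v; split.
    by move=> x Ux; apply: derivableD; [exact: df1|exact: dg1].
  apply: Ck_on_ext (IH _ _ df2 dg2) => // x Ux.
  by rewrite deriveD //; [exact: df1|exact: dg1].
Qed.

Lemma smooth_onD (U : set V) (f g : V -> W) : open U ->
  smooth_on U f -> smooth_on U g -> smooth_on U (fun x => f x + g x).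
Proof. by move=> oU sf sg k; exact: Ck_onD. Qed.

Lemma Ck_on_sum k (U : set V) (I : Type) (r : seq I) (P : pred I)
    (f : I -> V -> W) : open U -> (forall i, Ck_on k U (f i)) ->
  Ck_on k U (fun x => \sum_(i <- r | P i) f i x).
Proof.
move=> oU cf; elim: r => [|i r IH].
  rewrite (_ : (fun x => _) = cst 0); first exact: Ck_on_cst.
  by apply/funext => x; rewrite big_nil.
case: (boolP (P i)) => Pi; last first.
  by apply: Ck_on_ext IH => // x _; rewrite big_cons (negbTE Pi).
by apply: Ck_on_ext (Ck_onD oU (cf i) IH) => // x _; rewrite big_cons Pi.
Qed.

Lemma smooth_on_sum (U : set V) (I : Type) (r : seq I) (P : pred I)
    (f : I -> V -> W) : open U -> (forall i, smooth_on U (f i)) ->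
  smooth_on U (fun x => \sum_(i <- r | P i) f i x).
Proof. by move=> oU sf k; apply: Ck_on_sum => // i; exact: sf. Qed.

End CkCst.

Section CkReal.
Variables (R : realType) (V : normedModType R).
Implicit Types (U : set V) (f g : V -> R).

Lemma Ck_on_id k U : Ck_on k U (@id V).
Proof.
have cid : forall x, U x -> {for x, continuous (@id V)} by move=> x _; exact: cvg_id.
case: k => [|k]; split=> // v; split=> [x _|]; first exact: derivable_id.
rewrite (_ : (fun x => _) = cst v); first exact: Ck_on_cst.
by apply/funext => x; rewrite derive_id.
Qed.

Lemma smooth_on_id U : smooth_on U (@id V).
Proof. by move=> k; exact: Ck_on_id. Qed.

Lemma Ck_onM k U f g : open U ->
  Ck_on k U f -> Ck_on k U g -> Ck_on k U (fun x => f x * g x).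
Proof.
move=> oU; elim: k f g => [|k IH] f g Cf Cg.
  split=> // x Ux; apply: continuousM.
    exact: Ck_on_cont Cf Ux.
  exact: Ck_on_cont Cg Ux.
split=> [x Ux|v].
  apply: continuousM.
    exact: Ck_on_cont Cf Ux.
  exact: Ck_on_cont Cg Ux.
split=> [x Ux|].
  apply: derivableM.
    exact: Ck_on_derivable Cf Ux.
  exact: Ck_on_derivable Cg Ux.
have C1 := IH _ _ (Ck_on_pred Cf) (Ck_on_derive v Cg).
have C2 := IH _ _ (Ck_on_pred Cg) (Ck_on_derive v Cf).
apply: Ck_on_ext (Ck_onD oU C1 C2) => // x Ux.
by rewrite deriveM //; [exact: Ck_on_derivable Cf Ux|exact: Ck_on_derivable Cg Ux].
Qed.

Lemma smooth_onM U f g : open U ->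
  smooth_on U f -> smooth_on U g -> smooth_on U (fun x => f x * g x).
Proof. by move=> oU sf sg k; exact: Ck_onM. Qed.

Lemma smooth_on_prod U (I : Type) (r : seq I) (P : pred I) (f : I -> V -> R) :
  open U -> (forall i, smooth_on U (f i)) ->
  smooth_on U (fun x => \prod_(i <- r | P i) f i x).
Proof.
move=> oU sf; elim: r => [|i r IH].
  rewrite (_ : (fun x => _) = cst 1); first exact: smooth_on_cst.
  by apply/funext => x; rewrite big_nil.
case: (boolP (P i)) => Pi; last first.
  by apply: smooth_on_ext IH => // x _; rewrite big_cons (negbTE Pi).
by apply: smooth_on_ext (smooth_onM oU (sf i) IH) => // x _; rewrite big_cons Pi.
Qed.

Lemma smooth_onZ U (a : R) f : open U -> smooth_on U f ->
  smooth_on U (fun x => a * f x).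
Proof. by move=> oU; apply: smooth_onM => //; exact: (smooth_on_cst U a). Qed.

Lemma smooth_onN U f : open U -> smooth_on U f -> smooth_on U (fun x => - f x).
Proof.
move=> oU sf; apply: smooth_on_ext (smooth_onZ (-1) oU sf) => // x _.
by rewrite mulN1r.
Qed.

Lemma smooth_onB U f g : open U -> smooth_on U f -> smooth_on U g ->
  smooth_on U (fun x => f x - g x).
Proof. by move=> oU sf sg; apply: smooth_onD => //; exact: smooth_onN. Qed.

Lemma Ck_onV k U f : open U -> (forall x, U x -> f x != 0) ->
  Ck_on k U f -> Ck_on k U (fun x => (f x)^-1).
Proof.
move=> oU f0; have cV (h : V -> R) : (forall x, U x -> h x != 0) ->
    (forall x, U x -> {for x, continuous h}) ->
    (forall x, U x -> {for x, continuous (fun y => (h y)^-1)}).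
  by move=> h0 hc x Ux; apply: continuousV; [exact: h0|exact: hc].
elim: k => [|k IH] Cf.
  by split=> //; apply: cV => // x; exact: Ck_on_cont Cf.
split=> [|v]; first by apply: cV => // x; exact: Ck_on_cont Cf.
split=> [x Ux|].
  by apply: derivableV; [exact: f0|exact: Ck_on_derivable Cf Ux].
have C1 := IH (Ck_on_pred Cf).
have C2 := Ck_onM oU (Ck_onM oU C1 C1) (Ck_on_derive v Cf).
apply: Ck_on_ext oU _ (Ck_onM oU (Ck_on_cst k U (-1 : R)) C2) => x Ux.
rewrite deriveV ?f0//; last exact: Ck_on_derivable Cf Ux.
by rewrite /GRing.scale /= mulN1r -mulNr -invfM -expr2.
Qed.

Lemma smooth_onV U f : open U -> (forall x, U x -> f x != 0) ->
  smooth_on U f -> smooth_on U (fun x => (f x)^-1).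
Proof. by move=> oU f0 sf k; exact: Ck_onV. Qed.

End CkReal.

(** * Mean value theorem along lines and differentiability of C^1 functions *)

Section Lines.
Variables (R : realType) (V : normedModType R).

Lemma derivable_line (W : normedModType R) (g : V -> W) (z v : V) (s : R) :
  derivable g (s *: v + z) v ->
  is_derive s 1 (fun r : R => g (r *: v + z)) ('D_v g (s *: v + z)).
Proof.
move=> dg.
have E : (fun h : R => h^-1 *:
    (((fun r : R => g (r *: v + z)) \o shift s) (h *: 1) - g (s *: v + z)))
   = (fun h : R => h^-1 *: ((g \o shift (s *: v + z)) (h *: v) - g (s *: v + z))).
  by apply/funext => h /=; rewrite [_ *: 1]mulr1 scalerDl addrA.
by apply: DeriveDef; [rewrite /derivable E | rewrite /derive E].
Qed.

Lemma MVT_line (g : V -> R) (z v : V) (s : R) :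
  (forall r : R, `|r| <= `|s| -> derivable g (r *: v + z) v) ->
  exists2 r : R, `|r| <= `|s| & g (s *: v + z) - g z = s * 'D_v g (r *: v + z).
Proof.
move=> dg; pose G r := g (r *: v + z).
have dG (r : R) : `|r| <= `|s| -> is_derive r 1 G ('D_v g (r *: v + z)).
  by move=> rs; apply: derivable_line; exact: dg.
have cG (a b : R) : (forall r, r \in `[a, b] -> `|r| <= `|s|) ->
    {within `[a, b], continuous G}.
  move=> H; apply: derivable_within_continuous => r rab.
  by have [] := dG _ (H _ rab).
have -> : g z = G 0 by rewrite /G scale0r add0r.
case: (leP 0 s) => s0.
- have H (r : R) : r \in `[0, s] -> `|r| <= `|s|.
    by rewrite in_itv /= => /andP[r0 rs]; rewrite !ger0_norm.
  have [] := @MVT_segment R G (fun r => 'D_v g (r *: v + z)) 0 s s0 _ (cG _ _ H).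
    move=> r rs; apply: dG; apply: H.
    by move: rs; rewrite !in_itv /= => /andP[/ltW -> /ltW ->].
  by move=> c /H cs; rewrite subr0 mulrC => E; exists c.
- have H (r : R) : r \in `[s, 0] -> `|r| <= `|s|.
    by rewrite in_itv /= => /andP[r0 rs]; rewrite !ler0_norm ?lerN2 // ltW.
  have [] := @MVT_segment R G (fun r => 'D_v g (r *: v + z)) s 0 (ltW s0) _ (cG _ _ H).
    move=> r rs; apply: dG; apply: H.
    by move: rs; rewrite !in_itv /= => /andP[/ltW -> /ltW ->].
  move=> c /H cs; rewrite sub0r => E; exists c => //.
  by rewrite -opprB E mulrN opprK mulrC.
Qed.

End Lines.

Section C1Differentiable.
Variable R : realType.

Lemma near_ballP (V : normedModType R) (P : set V) (x : V) :
  (\forall w \near x, P w) ->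
  exists2 r : R, 0 < r & forall h, `|h| < r -> P (h + x).
Proof.
move=> /nbhs_normP[r /= r0 Hr]; exists r => // h hr; apply: Hr => /=.
by rewrite opprD addrC addrNK normrN.
Qed.

Lemma near_forall (V : normedModType R) (I : finType) (P : I -> set V) (x : V) :
  (forall i, \forall w \near x, P i w) ->
  \forall w \near x, forall i, P i w.
Proof. exact: filter_forall. Qed.

Lemma near_and (V : normedModType R) (P Q : set V) (x : V) :
  (\forall w \near x, P w) -> (\forall w \near x, Q w) ->
  \forall w \near x, P w /\ Q w.
Proof. by move=> H1 H2; apply: filterI. Qed.

Lemma differentiable_intro (V W : normedModType R) (f : V -> W)
    (df : {linear V -> W}) (x : V) : continuous df ->
  (forall e : R, 0 < e -> exists2 r : R, 0 < r &
     forall h, `|h| < r -> `|f (h + x) - f x - df h| <= e * `|h|) ->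
  differentiable f x.
Proof.
move=> cdf H.
have E : f \o shift x = cst (f x) + df +o_ (0 : V) id.
  apply/eqaddoP => _/posnumP[e].
  have [r r0 Hr] := H e%:num [gt0 of e%:num]; near=> h => /=.
  by rewrite opprD addrA; apply: Hr; near: h; exact: nbhs0_lt.
by apply/diff_locallyP; rewrite (diff_unique cdf E).
Unshelve. all: by end_near. Qed.

Variable m : nat.
Implicit Types (g : 'rV[R]_m -> R) (y h : 'rV[R]_m).

Let trunc (i : nat) h : 'rV[R]_m := \row_j (if (j < i)%N then h ord0 j else 0).

Let truncS (i : 'I_m) h :
  trunc i.+1 h = h ord0 i *: delta_mx ord0 i + trunc i h.
Proof.
apply/rowP => j; rewrite !mxE eqxx /= ltnS leq_eqVlt.
case: (eqVneq j i) => [->|ji]; first by rewrite eqxx ltnn mulr1 addr0.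
by rewrite (negbTE ji : (val j == val i) = false) mulr0 add0r.
Qed.

Lemma mx_norm_le p q (A : 'M[R]_(p, q)) (e : R) : 0 <= e ->
  (forall i j, `|A i j| <= e) -> `|A| <= e.
Proof.
by move=> e0 H; rewrite [leLHS]/Num.Def.normr/= mx_normrE bigmax_le.
Qed.

Lemma coord_le_mx_norm p q (A : 'M[R]_(p, q)) i j : `|A i j| <= `|A|.
Proof.
rewrite [leRHS]/Num.Def.normr/= mx_normrE.
exact: (le_bigmax _ (fun k : 'I_p * 'I_q => `|A k.1 k.2|) (i, j)).
Qed.

(* Telescope [g (y + h) - g y] along the coordinates and apply the mean value
   theorem to each term. *)
Lemma C1_differentiable (U : set 'rV[R]_m) g y : open U -> U y ->
  Ck_on 1 U g -> differentiable g y.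
Proof.
move=> oU Uy Cg.
pose p : 'cV[R]_m := \col_j 'D_(delta_mx ord0 j) g y.
pose L h : R := (h *m p) ord0 ord0.
have Llin : linear L.
  by move=> a u v; rewrite /L mulmxDl -scalemxAl !mxE.
pose LM := GRing.isLinear.Build _ _ _ _ _ Llin.
pose Lf : {linear 'rV[R]_m -> R} := HB.pack L LM.
have LE h : L h = \sum_j h ord0 j * 'D_(delta_mx ord0 j) g y.
  by rewrite /L mxE; apply: eq_bigr => j _; rewrite mxE.
have cL : continuous L.
  rewrite (_ : L = fun h => \sum_j h ord0 j * 'D_(delta_mx ord0 j) g y); last first.
    by apply/funext.
  move=> h; apply: (@Ck_on_cont _ _ _ 0 setT) => //.
  apply: Ck_on_sum; first exact: openT.
  move=> j; split=> // x _.
  by apply: continuousM; [exact: coord_continuous|exact: cst_continuous].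
apply: (@differentiable_intro _ _ g Lf y cL) => e e0.
(* The errors of [m] coordinates are added up; [m.+1] avoids a zero denominator when [m = 0]. *)
pose e' := e / m.+1%:R.
have e'0 : 0 < e' by rewrite divr_gt0.
have H1 : \forall w \near y, forall j : 'I_m,
    `|'D_(delta_mx ord0 j) g w - 'D_(delta_mx ord0 j) g y| <= e'.
  apply: near_forall => j.
  have /cvgrPdist_le/(_ _ e'0) := Ck_on_cont (Ck_on_derive (delta_mx ord0 j) Cg) Uy.
  by apply: filterS => w; rewrite distrC.
have [r r0 Hr] := near_ballP (near_and (open_near oU Uy) H1).
exists r => // h hr.
have Hw w : `|w| <= `|h| -> U (w + y) /\ forall j : 'I_m,
    `|'D_(delta_mx ord0 j) g (w + y) - 'D_(delta_mx ord0 j) g y| <= e'.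
  by move=> wh; apply: Hr; exact: le_lt_trans hr.
(* In the sup norm a staircase point, with some coordinates of [h] dropped and one shortened, is no
   longer than [h], so it stays in the ball where the derivatives are controlled. *)
have ti (i : 'I_m) (c : R) : `|c| <= `|h ord0 i| ->
    `|c *: delta_mx ord0 i + trunc i h| <= `|h|.
  move=> ch; apply: mx_norm_le => // i' j; rewrite !ord1 !mxE eqxx /=.
  case: (eqVneq j i) => [->|ji].
    by rewrite ltnn mulr1 addr0 (le_trans ch) // coord_le_mx_norm.
  rewrite mulr0 add0r; case: ifP => _; rewrite ?normr0 //.
  exact: coord_le_mx_norm.
have step (i : 'I_m) : `|g (trunc i.+1 h + y) - g (trunc i h + y)
      - h ord0 i * 'D_(delta_mx ord0 i) g y| <= e' * `|h|.
  have [|c ch E] := @MVT_line R _ g (trunc i h + y) (delta_mx ord0 i) (h ord0 i).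
    move=> c ch; have [HU _] := Hw _ (ti _ _ ch); rewrite addrA.
    exact: Ck_on_derivable Cg HU.
  have {}E : g (trunc i.+1 h + y) - g (trunc i h + y) = h ord0 i *
      'D_(delta_mx ord0 i) g (c *: delta_mx ord0 i + trunc i h + y).
    by rewrite truncS -!addrA; exact: E.
  rewrite E -mulrBr normrM mulrC ler_pM //; last exact: coord_le_mx_norm.
  by have [_] := Hw _ (ti _ _ ch); apply.
have -> : g (h + y) - g y = \sum_(i < m) (g (trunc i.+1 h + y) - g (trunc i h + y)).
  rewrite -(big_mkord xpredT (fun i => g (trunc i.+1 h + y) - g (trunc i h + y))).
  rewrite telescope_sumr //; congr (g (_ + y) - g _).
    by apply/rowP => j; rewrite !mxE ltn_ord.
  by apply/rowP => j; rewrite !mxE /= add0r.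
rewrite /Lf /= LE -sumrB (le_trans (ler_norm_sum _ _ _)) //.
apply: le_trans (ler_sum _ (fun i _ => step i)) _.
rewrite sumr_const card_ord -mulrnAl ler_wpM2r // /e' -mulr_natr mulrAC.
rewrite ler_pdivrMr // ler_wpM2l ?ler_nat //.
by rewrite ltW.
Qed.

End C1Differentiable.

Lemma continuous_mxP (R : realType) (T : topologicalType) p q
    (f : T -> 'M[R]_(p, q)) (x : T) : {for x, continuous f} <->
  forall i j, {for x, continuous (fun y => f y i j)}.
Proof.
split=> [cf i j|cf].
  apply: (@continuous_comp _ _ _ f (fun A : 'M[R]_(p, q) => A i j)) => //.
  exact: coord_continuous.
apply/cvgrPdist_le => e e0; near=> y.
apply: mx_norm_le; first exact: ltW.
move=> i j; rewrite !mxE.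
move: i j; near: y; apply: filter_forall => i; apply: filter_forall => j.
by have /cvgrPdist_le/(_ _ e0) := cf i j.
Unshelve. all: by end_near. Qed.

Section Entries.
Variables (R : realType) (V : normedModType R) (p q : nat).
Implicit Types f : V -> 'M[R]_(p, q).

Lemma derive_mxE f x v i j : derivable f x v ->
  'D_v f x i j = 'D_v (fun y => f y i j) x.
Proof. by move=> df; rewrite derive_mx // mxE. Qed.

Lemma Ck_on_mxP k (U : set V) f : open U -> Ck_on k U f <->
  forall i j, Ck_on k U (fun x => f x i j).
Proof.
move=> oU; elim: k f => [|k IH] f.
  split=> [[cf _] i j|H].
    by split=> // x Ux; move/continuous_mxP: (cf x Ux); apply.
  by split=> // x Ux; apply/continuous_mxP => i j; have [+ _] := H i j; apply.
split=> [Cf i j|H].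
  split=> [x Ux|v]; first by move/continuous_mxP: (Ck_on_cont Cf Ux); apply.
  split=> [x Ux|]; first by move/derivable_mxP: (Ck_on_derivable (v := v) Cf Ux); apply.
  have [/(_ (Ck_on_derive v Cf))/(_ i j) + _] := IH ('D_v f).
  apply: Ck_on_ext => // x Ux; rewrite derive_mxE //.
  exact: Ck_on_derivable Cf Ux.
split=> [x Ux|v].
  by apply/continuous_mxP => i j; exact: Ck_on_cont (H i j) Ux.
have df x : U x -> derivable f x v.
  by move=> Ux; apply/derivable_mxP => i j; exact: Ck_on_derivable (H i j) Ux.
split=> //; apply/IH => i j; apply: Ck_on_ext (Ck_on_derive v (H i j)) => // x Ux.
by rewrite derive_mxE //; exact: df.
Qed.

Lemma smooth_on_mxP (U : set V) f : open U -> smooth_on U f <->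
  forall i j, smooth_on U (fun x => f x i j).
Proof.
move=> oU; split=> [sf i j k|sf k].
  by move/(Ck_on_mxP _ _ oU): (sf k); apply.
by apply/(Ck_on_mxP _ _ oU) => i j; exact: sf.
Qed.

End Entries.

(** * Chain rule *)

Section Chain.
Variable R : realType.

Lemma derive_line (V W : normedModType R) (f : V -> W) x v :
  derivable f x v -> 'D_v f x = 'D_1 (fun h : R => f (h *: v + x)) 0.
Proof.
move=> df; have E : 0 *: v + x = x by rewrite scale0r add0r.
have [|_ ->] := @derivable_line R V W f x v 0; rewrite E //.
Qed.

(** Only the derivative of [f] in the direction [v] is available, so [f] is restricted to the line
    through [x]: there derivability is differentiability, and differentials can be composed. *)
Lemma is_derive_comp (V W Z : normedModType R) (f : V -> W) (g : W -> Z) x v :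
  derivable f x v -> differentiable g (f x) ->
  is_derive x v (g \o f) ('D_('D_v f x) g (f x)).
Proof.
move=> df dg; pose phi (h : R) := f (h *: v + x).
have phi0 : phi 0 = f x by rewrite /phi scale0r add0r.
have dphi : differentiable phi 0.
  by apply/derivable1_diffP; move/derivable1P: df; exact.
have dgphi : differentiable g (phi 0) by rewrite phi0.
have dc : derivable (g \o f) x v.
  by apply/derivable1P/derivable1_diffP; exact: (differentiable_comp dphi dgphi).
apply: DeriveDef => //; rewrite (derive_line dc).
rewrite -[fun h : R => _]/(g \o phi) deriveE; last exact: differentiable_comp.
rewrite diff_comp // /= -(deriveE (1 : R) dphi) -(deriveE _ dgphi).
by rewrite phi0 (derive_line df).
Qed.

Lemma derive_comp (V W Z : normedModType R) (f : V -> W) (g : W -> Z) x v :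
  derivable f x v -> differentiable g (f x) ->
  'D_v (g \o f) x = 'D_('D_v f x) g (f x).
Proof. by move=> df dg; have [_ ->] := is_derive_comp df dg. Qed.

Lemma derivable_comp (V W Z : normedModType R) (f : V -> W) (g : W -> Z) x v :
  derivable f x v -> differentiable g (f x) -> derivable (g \o f) x v.
Proof. by move=> df dg; have [] := is_derive_comp df dg. Qed.

Lemma derive_rowE (W : normedModType R) m (g : 'rV[R]_m -> W) y w :
  differentiable g y ->
  'D_w g y = \sum_j w ord0 j *: 'D_(delta_mx ord0 j) g y.
Proof.
move=> dg; rewrite deriveE // [X in 'd _ _ X]row_sum_delta linear_sum.
by apply: eq_bigr => j _; rewrite linearZ deriveE.
Qed.

Lemma smooth_differentiable m p q (U : set 'rV[R]_m)
    (g : 'rV[R]_m -> 'M[R]_(p, q)) y :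
  open U -> U y -> smooth_on U g -> differentiable g y.
Proof.
move=> oU Uy sg.
have -> : g = \sum_(i < p) \sum_(j < q) (fun y => g y i j *: delta_mx i j).
  apply/funext => z; rewrite fct_sumE {1}[g z]matrix_sum_delta.
  by apply: eq_bigr => i _; rewrite fct_sumE.
apply: differentiable_sum => i; apply: differentiable_sum => j.
apply: differentiableZl; apply: (C1_differentiable oU Uy).
by move/(smooth_on_mxP _ oU): sg => /(_ i j); apply.
Qed.

(** The derivative of the composite is a sum of components of ['D_v f] times partial derivatives of
    [g] composed with [f]. The induction hypothesis is applied to these partial derivatives, hence
    is general in [g] while [f] stays fixed. *)
Lemma Ck_on_comp_row k (V : normedModType R) m (U : set V) (U' : set 'rV[R]_m)
    (f : V -> 'rV[R]_m) (g : 'rV[R]_m -> R) : open U -> open U' ->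
  (forall x, U x -> U' (f x)) -> Ck_on k U f -> Ck_on k U' g ->
  Ck_on k U (g \o f).
Proof.
move=> oU oU' fU; have cc g' j : Ck_on j U f -> Ck_on j U' g' ->
    forall x, U x -> {for x, continuous (g' \o f)}.
  move=> Cf Cg' x Ux; apply: continuous_comp; first exact: Ck_on_cont Cf Ux.
  exact: Ck_on_cont Cg' (fU _ Ux).
elim: k g => [|k IH] g Cf Cg; first by split=> //; exact: cc Cf Cg.
split=> [|v]; first exact: cc Cf Cg.
have dg x : U x -> differentiable g (f x).
  move=> Ux; apply: (C1_differentiable oU' (fU _ Ux)).
  split; first by move=> y; exact: Ck_on_cont Cg.
  move=> w; split; first by move=> y; exact: Ck_on_derivable Cg.
  by split=> // y U'y; exact: Ck_on_cont (Ck_on_derive w Cg) U'y.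
split=> [x Ux|].
  by apply: derivable_comp; [exact: Ck_on_derivable Cf Ux|exact: dg].
have Cs : Ck_on k U (fun x => \sum_j ('D_v f x) ord0 j *
    ('D_(delta_mx ord0 j) g \o f) x).
  apply: Ck_on_sum => // j; apply: Ck_onM => //.
    by have /(Ck_on_mxP _ _ oU) := Ck_on_derive v Cf; apply.
  by apply: IH; [exact: Ck_on_pred|exact: Ck_on_derive].
apply: Ck_on_ext Cs => // x Ux.
rewrite (derive_comp (Ck_on_derivable (v := v) Cf Ux) (dg x Ux)).
by rewrite (derive_rowE _ (dg x Ux)).
Qed.

Lemma smooth_on_comp_row (V : normedModType R) m (U : set V)
    (U' : set 'rV[R]_m) (f : V -> 'rV[R]_m) (g : 'rV[R]_m -> R) :
  open U -> open U' -> (forall x, U x -> U' (f x)) ->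
  smooth_on U f -> smooth_on U' g -> smooth_on U (g \o f).
Proof. by move=> oU oU' fU sf sg k; exact: Ck_on_comp_row (sf k) (sg k). Qed.

Lemma smooth_on_comp (V : normedModType R) m p q (U : set V)
    (U' : set 'rV[R]_m) (f : V -> 'rV[R]_m) (g : 'rV[R]_m -> 'M[R]_(p, q)) :
  open U -> open U' -> (forall x, U x -> U' (f x)) ->
  smooth_on U f -> smooth_on U' g -> smooth_on U (g \o f).
Proof.
move=> oU oU' fU sf /(smooth_on_mxP _ oU') sg.
by apply/(smooth_on_mxP _ oU) => i j; exact: smooth_on_comp_row sf (sg i j).
Qed.

Lemma Ck_on_comp_real k (V : normedModType R) (U : set V) (U' : set R)
    (f : V -> R) (g : R -> R) : open U -> open U' ->
  (forall x, U x -> U' (f x)) -> Ck_on k U f -> Ck_on k U' g ->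
  Ck_on k U (g \o f).
Proof.
move=> oU oU' fU; have cc g' j : Ck_on j U f -> Ck_on j U' g' ->
    forall x, U x -> {for x, continuous (g' \o f)}.
  move=> Cf Cg' x Ux; apply: continuous_comp; first exact: Ck_on_cont Cf Ux.
  exact: Ck_on_cont Cg' (fU _ Ux).
elim: k g => [|k IH] g Cf Cg; first by split=> //; exact: cc Cf Cg.
split=> [|v]; first exact: cc Cf Cg.
have dg x : U x -> differentiable g (f x).
  move=> Ux; apply/derivable1_diffP.
  exact: Ck_on_derivable Cg (fU _ Ux).
split=> [x Ux|].
  by apply: derivable_comp; [exact: Ck_on_derivable Cf Ux|exact: dg].
have Cs : Ck_on k U (fun x => 'D_v f x * ('D_1 g \o f) x).
  apply: Ck_onM => //; first exact: Ck_on_derive.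
  by apply: IH; [exact: Ck_on_pred|exact: Ck_on_derive].
apply: Ck_on_ext Cs => // x Ux.
rewrite (derive_comp (Ck_on_derivable (v := v) Cf Ux) (dg x Ux)).
rewrite /= !(deriveE _ (dg x Ux)).
transitivity ('d g (f x) ('D_v f x *: (1 : R^o))); first by rewrite linearZ.
by congr ('d g _ _); exact: mulr1.
Qed.

Lemma smooth_on_comp_realR (V : normedModType R) (U : set V) (U' : set R)
    (f : V -> R) (g : R -> R) : open U -> open U' ->
  (forall x, U x -> U' (f x)) -> smooth_on U f -> smooth_on U' g ->
  smooth_on U (g \o f).
Proof. by move=> oU oU' fU sf sg k; exact: Ck_on_comp_real (sf k) (sg k). Qed.

Lemma smooth_on_comp_real (V : normedModType R) p q (U : set V) (U' : set R)
    (f : V -> R) (g : R -> 'M[R]_(p, q)) : open U -> open U' ->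
  (forall x, U x -> U' (f x)) -> smooth_on U f -> smooth_on U' g ->
  smooth_on U (g \o f).
Proof.
move=> oU oU' fU sf /(smooth_on_mxP _ oU') sg.
by apply/(smooth_on_mxP _ oU) => i j; exact: smooth_on_comp_realR sf (sg i j).
Qed.

End Chain.

(** * Symmetry of second derivatives *)

Section Schwarz.
Variables (R : realType) (V : normedModType R).

Lemma is_derive_shiftl (W : normedModType R) (g : V -> W) (w z v : V) :
  derivable g (w + z) v ->
  is_derive z v (fun y => g (w + y)) ('D_v g (w + z)).
Proof.
move=> dg.
have E : (fun h : R => h^-1 *: (((fun y => g (w + y)) \o shift z) (h *: v) - g (w + z)))
   = (fun h : R => h^-1 *: ((g \o shift (w + z)) (h *: v) - g (w + z))).
  by apply/funext => h /=; rewrite addrCA.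
by apply: DeriveDef; [rewrite /derivable E | rewrite /derive E].
Qed.

(** Two uses of the mean value theorem: for the increment of [g] by [h *: v], along [u], then for
    ['D_u g], along [v]. The left side is symmetric in [u] and [v], which forces the mixed
    derivatives to agree. *)
Lemma second_difference (U : set V) (g : V -> R) (y u v : V) (h : R) :
  Ck_on 2 U g ->
  (forall a b : R, `|a| <= `|h| -> `|b| <= `|h| -> U (a *: v + (b *: u + y))) ->
  exists a b : R, [/\ `|a| <= `|h|, `|b| <= `|h| &
    g (h *: v + (h *: u + y)) - g (h *: u + y) - (g (h *: v + y) - g y)
      = h * h * 'D_v ('D_u g) (a *: v + (b *: u + y))].
Proof.
move=> Cg HU; have h0 : `|0 : R| <= `|h| by rewrite normr0.
pose phi z := g (h *: v + z) - g z.
have dphi (b : R) : `|b| <= `|h| -> is_derive (b *: u + y) u phi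
    ('D_u g (h *: v + (b *: u + y)) - 'D_u g (b *: u + y)).
  move=> bh; apply: is_deriveB.
    by apply: is_derive_shiftl; exact: Ck_on_derivable Cg (HU _ _ _ bh).
  have Ub : U (b *: u + y) by have := HU 0 b h0 bh; rewrite scale0r add0r.
  by apply: DeriveDef => //; exact: Ck_on_derivable Cg Ub.
have [b bh Eb] : exists2 b : R, `|b| <= `|h| &
    phi (h *: u + y) - phi y = h * 'D_u phi (b *: u + y).
  by apply: MVT_line => b bh; have [] := dphi b bh.
have [a ah Ea] : exists2 a : R, `|a| <= `|h| &
    'D_u g (h *: v + (b *: u + y)) - 'D_u g (b *: u + y) =
    h * 'D_v ('D_u g) (a *: v + (b *: u + y)).
  apply: (@MVT_line R V ('D_u g) (b *: u + y) v h) => a ah.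
  exact: Ck_on_derivable (Ck_on_derive u Cg) (HU _ _ ah bh).
exists a, b; split=> //; rewrite -mulrA -Ea.
by have [_ <-] := dphi b bh; exact: Eb.
Qed.

Let dist_le_split (e s t p : R) :
  `|p - t| <= e / 2 -> `|p - s| <= e / 2 -> `|s - t| <= e.
Proof.
move=> H1 H2; rewrite -(subrKA p) (splitr e) (le_trans (ler_normD _ _)) //.
by rewrite lerD // distrC.
Qed.

Lemma Schwarz_real (U : set V) (g : V -> R) (y u v : V) : open U -> U y ->
  Ck_on 2 U g -> 'D_u ('D_v g) y = 'D_v ('D_u g) y.
Proof.
move=> oU Uy Cg; apply/eqP; rewrite -subr_eq0 -normr_le0.
apply/ler_addgt0Pl => e e0; rewrite addr0.
have e2 : 0 < e / 2 by rewrite divr_gt0.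
have H u' v' : \forall w \near y, `|'D_u' ('D_v' g) w - 'D_u' ('D_v' g) y| <= e / 2.
  have C := Ck_on_cont (Ck_on_derive u' (Ck_on_derive v' Cg)) Uy.
  have /cvgrPdistC_le := C; exact.
have [r r0 Hr] := near_ballP (near_and (open_near oU Uy) (near_and (H u v) (H v u))).
(* With this [h], every [a *: v + b *: u] whose coefficients are at most [h] in absolute value has
   norm at most [r / 2]; the 1 keeps the denominator nonzero for [u = v = 0]. *)
pose h := r / 2 / (`|u| + `|v| + 1).
have d0 : 0 < `|u| + `|v| + 1 by rewrite ltr_wpDl // addr_ge0.
have h0 : 0 < h by rewrite !divr_gt0.
have Hh (a b : R) : `|a| <= `|h| -> `|b| <= `|h| -> `|a *: v + b *: u| < r.
  move=> ah bh; apply: (@le_lt_trans _ _ (r / 2)); last by rewrite ltr_pdivrMr // ltr_pMr // ltr1n.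
  apply: (le_trans (ler_normD _ _)); rewrite !normrZ.
  apply: (@le_trans _ _ (`|h| * `|v| + `|h| * `|u|)).
    by rewrite lerD // ler_wpM2r.
  rewrite -mulrDr gtr0_norm // /h -[leLHS]mulrA.
  rewrite ler_piMr ?divr_ge0 ?(ltW r0) //.
  by rewrite mulrC ler_pdivrMr // mul1r addrC lerDl.
have [|a [b [ah bh E1]]] := @second_difference U g y u v h Cg.
  by move=> a b ah bh; have [+ _] := Hr _ (Hh _ _ ah bh); rewrite addrA.
have [|c [d [ch dh E2]]] := @second_difference U g y v u h Cg.
  move=> a' b' ah' bh'; have [+ _] := Hr _ (Hh _ _ bh' ah').
  by rewrite addrA [_ *: u + _]addrC.
(* Both orders of differencing give the same second difference; dividing by [h * h], the mixed
   derivatives agree at two points near [y], and continuity moves both to [y]. *)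
have E : 'D_v ('D_u g) (a *: v + (b *: u + y)) = 'D_u ('D_v g) (c *: u + (d *: v + y)).
  have cancel (s t p q : R) : p = h * h * s -> q = h * h * t -> p = q -> s = t.
    by move=> -> ->; apply: mulfI; rewrite mulf_neq0 // gt_eqF.
  apply: (cancel _ _ _ _ E1 E2); rewrite [h *: v + (h *: u + y)]addrCA.
  have swap (p q s t : R) : p - q - (s - t) = p - s - (q - t).
    by rewrite !opprD !opprK !addrA; congr (_ + _); rewrite addrAC.
  exact: swap.
have [_ [_ B1]] := Hr _ (Hh _ _ ah bh).
have [_ [B2 _]] := Hr _ (Hh _ _ dh ch).
rewrite -addrA E in B1; rewrite [d *: v + _]addrC -addrA in B2.
exact: dist_le_split B1 B2.
Qed.

Lemma Schwarz p q (U : set V) (g : V -> 'M[R]_(p, q)) (y u v : V) :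
  open U -> U y -> smooth_on U g -> 'D_u ('D_v g) y = 'D_v ('D_u g) y.
Proof.
move=> oU Uy sg; have sij := (smooth_on_mxP g oU).1 sg.
have E w x i j : U x -> 'D_w g x i j = 'D_w (fun z => g z i j) x.
  by move=> Ux; rewrite derive_mxE //; exact: smooth_on_derivable sg Ux.
have E2 w w' i j : 'D_w ('D_w' g) y i j = 'D_w ('D_w' (fun z => g z i j)) y.
  rewrite derive_mxE.
    by apply: near_eq_derive; apply: filterS (open_near oU Uy) => x Ux; exact: E.
  exact: smooth_on_derivable (smooth_on_derive w' sg) Uy.
apply/matrixP => i j.
have S := @Schwarz_real U (fun z => g z i j) y u v oU Uy (sij i j 2%N).
exact: (etrans (E2 u v i j) (etrans S (esym (E2 v u i j)))).
Qed.

End Schwarz.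

Section RealFunctions.
Variable R : realType.
Implicit Types (U : set R) (f : R -> R).

(** A bootstrap in one variable: every ['D_v f] is a constant multiple of [f'], so one order is
    gained whenever [f'] is built from functions known to be C^k. Square root, sine, cosine and the
    flat functions are treated this way. *)
Lemma Ck_on_primitive k U f f' : open U ->
  (forall x, U x -> is_derive x 1 f (f' x)) -> Ck_on k U f' -> Ck_on k.+1 U f.
Proof.
move=> oU df Cf'.
have dif x : U x -> differentiable f x.
  by move=> Ux; apply/derivable1_diffP; have [] := df x Ux.
split=> [x Ux|v]; first exact/differentiable_continuous/dif.
split=> [x Ux|]; first exact/diff_derivable/dif.
apply: Ck_on_ext oU _ (Ck_onM oU (Ck_on_cst k U (v : R)) Cf') => x Ux.
have [_ <-] := df x Ux; rewrite !(deriveE _ (dif x Ux)) /=.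
transitivity ('d f x (v *: (1 : R^o))); first by rewrite linearZ.
by congr ('d f _ _); exact: mulr1.
Qed.

Lemma smooth_on_primitive U f f' : open U ->
  (forall x, U x -> is_derive x 1 f (f' x)) -> smooth_on U f' -> smooth_on U f.
Proof.
by move=> oU df sf' k; apply: Ck_on_pred; exact: Ck_on_primitive df (sf' k).
Qed.

Lemma smooth_on_sqrt : smooth_on [set x : R | 0 < x] Num.sqrt.
Proof.
have oU : open [set x : R | 0 < x] by exact: open_gt.
elim=> [|k IH].
  by split=> // x _; exact: sqrt_continuous.
apply: (@Ck_on_primitive k _ _ (fun x => (2 * Num.sqrt x)^-1)) => //.
apply: Ck_onV => // [x x0|]; first by rewrite mulf_neq0 // gt_eqF // sqrtr_gt0.
by apply: Ck_onM => //; exact: Ck_on_cst.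
Qed.

Lemma smooth_on_sin_cos : smooth_on setT (@sin R) /\ smooth_on setT (@cos R).
Proof.
suff H k : Ck_on k setT (@sin R) /\ Ck_on k setT (@cos R).
  by split=> k; have [] := H k.
have oT : open [set: R] by exact: openT.
elim: k => [|k [IHs IHc]].
  by split; split=> // x _; [apply: continuous_sin|apply: continuous_cos].
split.
  apply: (@Ck_on_primitive k _ _ (@cos R)) => // x _; exact: is_derive_sin.
apply: (@Ck_on_primitive k _ _ (fun x => -1 * sin x)) => //.
  by move=> x _; rewrite mulN1r; exact: is_derive_cos.
by apply: Ck_onM => //; exact: Ck_on_cst.
Qed.

End RealFunctions.

Section MatrixFunctions.
Variables (R : realType) (V : normedModType R) (U : set V).
Hypothesis oU : open U.

Lemma smooth_on_entry m n (A : V -> 'M[R]_(m, n)) i j :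
  smooth_on U A -> smooth_on U (fun x => A x i j).
Proof. by move/(smooth_on_mxP _ oU); apply. Qed.

Lemma smooth_on_mulmx m n p (A : V -> 'M[R]_(m, n)) (B : V -> 'M[R]_(n, p)) :
  smooth_on U A -> smooth_on U B -> smooth_on U (fun x => A x *m B x).
Proof.
move=> sA sB; apply/(smooth_on_mxP _ oU) => i j.
have S : smooth_on U (fun x => \sum_k A x i k * B x k j).
  apply: smooth_on_sum => // k.
  by apply: smooth_onM => //; exact: smooth_on_entry.
by apply: smooth_on_ext S => // x _; rewrite mxE.
Qed.

Lemma smooth_on_trmx m n (A : V -> 'M[R]_(m, n)) :
  smooth_on U A -> smooth_on U (fun x => (A x)^T).
Proof.
move=> sA; apply/(smooth_on_mxP _ oU) => i j.
by apply: smooth_on_ext (smooth_on_entry j i sA) => // x _; rewrite mxE.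
Qed.

Lemma smooth_on_scale m n (a : V -> R) (A : V -> 'M[R]_(m, n)) :
  smooth_on U a -> smooth_on U A -> smooth_on U (fun x => a x *: A x).
Proof.
move=> sa sA; apply/(smooth_on_mxP _ oU) => i j.
apply: smooth_on_ext (smooth_onM oU sa (smooth_on_entry i j sA)) => // x _.
by rewrite mxE.
Qed.

Lemma smooth_on_det n (A : V -> 'M[R]_n) :
  smooth_on U A -> smooth_on U (fun x => \det (A x)).
Proof.
move=> sA; apply: smooth_on_sum => // s; apply: smooth_onZ => //.
by apply: smooth_on_prod => // i; exact: smooth_on_entry.
Qed.

(** Cramer's rule: the inverse is the adjugate, polynomial in the entries, divided by the
    determinant. *)
Lemma smooth_on_invmx n (A : V -> 'M[R]_n) :
  (forall x, U x -> A x \in unitmx) ->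
  smooth_on U A -> smooth_on U (fun x => invmx (A x)).
Proof.
move=> uA sA.
have sadj : smooth_on U (fun x => \adj (A x)).
  apply/(smooth_on_mxP _ oU) => i j.
  have S : smooth_on U (fun x => (-1) ^+ (j + i) * \det (row' j (col' i (A x)))).
    apply: smooth_onZ => //; apply: smooth_on_det.
    apply/(smooth_on_mxP _ oU) => k l.
    by apply: smooth_on_ext (smooth_on_entry (lift j k) (lift i l) sA) => // x _; rewrite !mxE.
  by apply: smooth_on_ext S => // x _; rewrite mxE.
have sinv : smooth_on U (fun x => (\det (A x))^-1).
  apply: smooth_onV => // [x Ux|]; last exact: smooth_on_det.
  by rewrite -unitfE; move: (uA x Ux); rewrite unitmxE.
apply: smooth_on_ext (smooth_on_scale sinv sadj) => // x Ux.
by rewrite /invmx uA.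
Qed.

Lemma smooth_on_sqrt_comp (f : V -> R) : (forall x, U x -> 0 < f x) ->
  smooth_on U f -> smooth_on U (fun x => Num.sqrt (f x)).
Proof.
move=> f0 sf; have oP : open [set x : R | 0 < x] by exact: open_gt.
exact: (smooth_on_comp_realR oU oP f0 sf (@smooth_on_sqrt R)).
Qed.

Lemma smooth_on_cos (f : V -> R) :
  smooth_on U f -> smooth_on U (fun x => cos (f x)).
Proof.
move=> sf; apply: (@smooth_on_comp_realR R V U setT f) => //.
  exact: openT.
exact: (smooth_on_sin_cos R).2.
Qed.

Lemma smooth_on_sin (f : V -> R) :
  smooth_on U f -> smooth_on U (fun x => sin (f x)).
Proof.
move=> sf; apply: (@smooth_on_comp_realR R V U setT f) => //.
  exact: openT.
exact: (smooth_on_sin_cos R).1.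
Qed.

End MatrixFunctions.

Section DeriveMx.
Variables (R : realType) (V : normedModType R) (x v : V).


Lemma is_derive_sumR n (f : 'I_n -> V -> R) :
  (forall i, derivable (f i) x v) ->
  is_derive x v (fun y => \sum_i f i y) (\sum_i 'D_v (f i) x).
Proof.
move=> df; have E : (fun y => \sum_i f i y) = \sum_i f i.
  by apply/funext => y; rewrite fct_sumE.
rewrite E; apply: DeriveDef; first exact: derivable_sum.
exact: derive_sum.
Qed.

Lemma is_derive_mulmx m n p (A : V -> 'M[R]_(m, n)) (B : V -> 'M[R]_(n, p)) :
  derivable A x v -> derivable B x v ->
  is_derive x v (fun y => A y *m B y) ('D_v A x *m B x + A x *m 'D_v B x).
Proof.
move=> dA dB.
have dAi i j : derivable (fun y => A y i j) x v by move/derivable_mxP: dA; apply.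
have dBi i j : derivable (fun y => B y i j) x v by move/derivable_mxP: dB; apply.
have H i j : is_derive x v (fun y => (A y *m B y) i j)
    (\sum_k ('D_v (fun y => A y i k) x * B x k j + A x i k * 'D_v (fun y => B y k j) x)).
  have -> : (fun y => (A y *m B y) i j) = (fun y => \sum_k A y i k * B y k j).
    by apply/funext => y; rewrite mxE.
  apply: is_derive_eq.
    by apply: is_derive_sumR => k; exact: derivableM.
  apply: eq_bigr => k _; rewrite deriveM // addrC /GRing.scale /=.
  by rewrite mulrC.
have dAB : derivable (fun y => A y *m B y) x v.
  by apply/derivable_mxP => i j; have [] := H i j.
apply: DeriveDef => //; apply/matrixP => i j.
rewrite derive_mxE //; have [_ ->] := H i j.
by rewrite !mxE -big_split; apply: eq_bigr => k _; rewrite !derive_mxE.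
Qed.

Lemma is_derive_trmx m n (A : V -> 'M[R]_(m, n)) :
  derivable A x v -> is_derive x v (fun y => (A y)^T) ('D_v A x)^T.
Proof.
move=> dA.
have dAi i j : derivable (fun y => A y i j) x v by move/derivable_mxP: dA; apply.
have E i j : (fun y => (A y)^T i j) = (fun y => A y j i).
  by apply/funext => y; rewrite mxE.
have dT : derivable (fun y => (A y)^T) x v.
  by apply/derivable_mxP => i j; rewrite E.
by apply: DeriveDef => //; apply/matrixP => i j; rewrite derive_mxE // E mxE derive_mxE.
Qed.

End DeriveMx.

(** * Geometry in charts *)

Lemma open_setI_preimage (X Y : topologicalType) (U : set X) (f : X -> Y)
    (W : set Y) : open U -> open W -> (forall x, U x -> {for x, continuous f}) ->
  open (U `&` f @^-1` W).
Proof.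
move=> oU oW cf; rewrite openE => x [Ux Wfx]; rewrite /interior.
apply: filterI; first exact: open_near.
by apply: cf => //; exact: open_near.
Qed.

Lemma derive_ext_open (R : realType) (V W : normedModType R) (U : set V)
    (f g : V -> W) x v : open U -> U x -> (forall y, U y -> f y = g y) ->
  'D_v f x = 'D_v g x.
Proof.
by move=> oU Ux fg; apply: near_eq_derive; apply: filterS (open_near oU Ux).
Qed.

Section Bilinear.
Variables (R : realType) (n : nat).
Implicit Types (A B : 'M[R]_n) (u v w : 'rV[R]_n).

Definition bil A u v : R := (u *m A *m v^T) ord0 ord0.

Lemma bilE A u v : bil A u v = \sum_i \sum_j u ord0 i * A i j * v ord0 j.
Proof.
rewrite /bil mxE exchange_big /=; apply: eq_bigr => j _.
by rewrite !mxE mulr_suml.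
Qed.

Lemma bilDl A u v w : bil A (u + v) w = bil A u w + bil A v w.
Proof. by rewrite /bil !mulmxDl mxE. Qed.

Lemma bilDr A u v w : bil A u (v + w) = bil A u v + bil A u w.
Proof. by rewrite /bil linearD mulmxDr mxE. Qed.

Lemma bilZl A (a : R) u v : bil A (a *: u) v = a * bil A u v.
Proof. by rewrite /bil -!scalemxAl mxE. Qed.

Lemma bilZr A (a : R) u v : bil A u (a *: v) = a * bil A u v.
Proof. by rewrite /bil linearZ -scalemxAr mxE. Qed.

Lemma bilNl A u v : bil A (- u) v = - bil A u v.
Proof. by rewrite -scaleN1r bilZl mulN1r. Qed.

Lemma bil0l A v : bil A 0 v = 0.
Proof. by rewrite /bil !mul0mx mxE. Qed.

Lemma bil0r A v : bil A v 0 = 0.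
Proof. by rewrite /bil trmx0 mulmx0 mxE. Qed.

Lemma bil_mul A B u v : bil A (u *m B) (v *m B) = bil (B *m A *m B^T) u v.
Proof. by rewrite /bil trmx_mul !mulmxA. Qed.

Lemma bilC A u v : A^T = A -> bil A u v = bil A v u.
Proof.
move=> sA; rewrite /bil; transitivity ((u *m A *m v^T)^T ord0 ord0).
  by rewrite [RHS]mxE.
by rewrite !trmx_mul trmxK sA mulmxA.
Qed.

Lemma bil_eq0 A u : A \in unitmx -> (forall v, bil A u v = 0) -> u = 0.
Proof.
move=> uA H; apply: (can_inj (mulmxK uA)); rewrite mul0mx.
apply/rowP => j; rewrite [RHS]mxE -(H (delta_mx ord0 j)) /bil [RHS]mxE.
rewrite (bigD1 j) //= big1 ?addr0.
  by rewrite !mxE !eqxx mulr1.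
by move=> k kj; rewrite !mxE eqxx /= (negbTE kj) mulr0.
Qed.

Lemma bil_sum (I : finType) (a : I -> R) (A : I -> 'M[R]_n) u v :
  bil (\sum_i a i *: A i) u v = \sum_i a i * bil (A i) u v.
Proof.
rewrite /bil mulmx_sumr mulmx_suml summxE; apply: eq_bigr => i _.
by rewrite -scalemxAr -scalemxAl mxE.
Qed.

Lemma is_derive_bil (V : normedModType R) (A : V -> 'M[R]_n)
    (a b : V -> 'rV[R]_n) (x v : V) :
  derivable A x v -> derivable a x v -> derivable b x v ->
  is_derive x v (fun y => bil (A y) (a y) (b y))
    (bil ('D_v A x) (a x) (b x) + bil (A x) ('D_v a x) (b x)
     + bil (A x) (a x) ('D_v b x)).
Proof.
move=> dA da db.
have [d1 e1] := is_derive_mulmx da dA.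
have [d2 e2] := is_derive_trmx db.
have [d3 e3] := is_derive_mulmx d1 d2.
apply: DeriveDef; first by move/derivable_mxP: d3 => /(_ ord0 ord0).
rewrite -(derive_mxE ord0 ord0 d3) e3 e1 e2 mulmxDl !mxE /bil.
by rewrite !mxE; congr (_ + _); rewrite addrC.
Qed.

Lemma is_derive_bil_cst (V : normedModType R) (A : V -> 'M[R]_n)
    (a b : 'rV[R]_n) (x v : V) : derivable A x v ->
  is_derive x v (fun y => bil (A y) a b) (bil ('D_v A x) a b).
Proof.
move=> dA; have := is_derive_bil dA (derivable_cst a x v) (derivable_cst b x v).
by rewrite !derive_cst bil0l bil0r !addr0.
Qed.

Lemma smooth_on_bil (V : normedModType R) (U : set V) (A : V -> 'M[R]_n)
    (a b : V -> 'rV[R]_n) : open U ->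
  smooth_on U A -> smooth_on U a -> smooth_on U b ->
  smooth_on U (fun x => bil (A x) (a x) (b x)).
Proof.
move=> oU sA sa sb; apply: smooth_on_entry => //.
apply: smooth_on_mulmx; [by []|exact: smooth_on_mulmx|exact: smooth_on_trmx].
Qed.

Lemma mulmx_ext m (A B : 'M[R]_(n, m)) :
  (forall v : 'rV[R]_n, v *m A = v *m B) -> A = B.
Proof. by move=> H; apply/row_matrixP => i; rewrite !rowE. Qed.

End Bilinear.

Section Jacobian.
Variable R : realType.

(** Vectors are rows, so this is the transpose of the usual Jacobian matrix, and composites multiply
    from left to right. *)
Definition jac n m (f : 'rV[R]_n -> 'rV[R]_m) y : 'M[R]_(n, m) :=
  \matrix_(i, j) ('D_(delta_mx ord0 i) f y) ord0 j.

Lemma derive_jac n m (f : 'rV[R]_n -> 'rV[R]_m) y v :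
  differentiable f y -> 'D_v f y = v *m jac f y.
Proof.
move=> df; rewrite (derive_rowE v df); apply/rowP => j.
by rewrite summxE mxE; apply: eq_bigr => i _; rewrite !mxE.
Qed.

Lemma smooth_on_jac n m (U : set 'rV[R]_n) (f : 'rV[R]_n -> 'rV[R]_m) :
  open U -> smooth_on U f -> smooth_on U (jac f).
Proof.
move=> oU sf; apply/(smooth_on_mxP _ oU) => i j.
have := smooth_on_entry oU ord0 j (smooth_on_derive (delta_mx ord0 i) sf).
by apply: smooth_on_ext => // x _; rewrite mxE.
Qed.

Lemma derive_jac2 n m (U : set 'rV[R]_n) (f : 'rV[R]_n -> 'rV[R]_m) y u w :
  open U -> U y -> smooth_on U f ->
  w *m 'D_u (jac f) y = 'D_u ('D_w f) y.
Proof.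
move=> oU Uy sf.
have dJ : derivable (jac f) y u.
  exact: smooth_on_derivable (smooth_on_jac oU sf) Uy.
have [_ E] := is_derive_mulmx (derivable_cst w y u) dJ.
rewrite derive_cst mul0mx add0r in E; rewrite -E.
apply: (derive_ext_open _ oU Uy) => z Uz.
by rewrite (derive_jac w (smooth_differentiable oU Uz sf)).
Qed.

End Jacobian.

(** * Change of charts for points and tangent vectors *)

Section Charts.
Variables (R : realType) (n : nat) (M : manifold R n).
Implicit Types (c d e : chart R n M) (p : M) (y u v w z : 'rV[R]_n).

Definition tdom c d : set 'rV[R]_n := ccod c `&` cinv c @^-1` cdom d.
Definition trans c d : 'rV[R]_n -> 'rV[R]_n := cmap d \o cinv c.

Lemma open_tdom c d : open (tdom c d).
Proof.
by apply: open_setI_preimage; [exact: ccod_open|exact: cdom_open|exact: cinv_cont].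
Qed.

Lemma smooth_trans c d : atlas M c -> atlas M d ->
  smooth_on (tdom c d) (trans c d).
Proof. exact: atlas_compat. Qed.

Lemma trans_tdom c d y : tdom c d y -> tdom d c (trans c d y).
Proof.
move=> [ccy cdy]; split; first exact: cmap_cod.
by rewrite /preimage /trans /= cmapK //; exact: cinv_dom.
Qed.

Lemma tdom_cmap c d p : cdom c p -> cdom d p -> tdom c d (cmap c p).
Proof. by move=> cp dp; split; [exact: cmap_cod|rewrite /preimage /= cmapK]. Qed.

Lemma trans_cmap c d p : cdom c p -> trans c d (cmap c p) = cmap d p.
Proof. by move=> cp; rewrite /trans /= cmapK. Qed.

Lemma differentiable_trans c d y : atlas M c -> atlas M d -> tdom c d y ->
  differentiable (trans c d) y.
Proof.
move=> ac ad cdy.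
exact: (smooth_differentiable (open_tdom (c:=c) (d:=d)) cdy (smooth_trans ac ad)).
Qed.

Lemma jac_trans_comp c d e p : atlas M c -> atlas M d -> atlas M e ->
  cdom c p -> cdom d p -> cdom e p ->
  jac (trans c e) (cmap c p) =
  jac (trans c d) (cmap c p) *m jac (trans d e) (cmap d p).
Proof.
move=> ac ad ae cp dp ep; apply: mulmx_ext => v.
have dcd := differentiable_trans ac ad (tdom_cmap cp dp).
have dce := differentiable_trans ac ae (tdom_cmap cp ep).
have dde := differentiable_trans ad ae (tdom_cmap dp ep).
rewrite mulmxA -(derive_jac v dce) -(derive_jac v dcd) -(derive_jac _ dde).
rewrite -(trans_cmap d cp) -(derive_comp (diff_derivable dcd)); last first.
  by rewrite trans_cmap.
apply: (derive_ext_open _ (open_tdom (c:=c) (d:=d)) (tdom_cmap cp dp)) => y [cy dy].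
by rewrite /trans /= cmapK.
Qed.

Lemma jac_trans_id c p : atlas M c -> cdom c p ->
  jac (trans c c) (cmap c p) = 1%:M.
Proof.
move=> ac cp; apply: mulmx_ext => v; rewrite mulmx1.
rewrite -(derive_jac v (differentiable_trans ac ac (tdom_cmap cp cp))).
rewrite -[RHS](derive_id (cmap c p) v).
apply: (derive_ext_open _ (open_tdom (c:=c) (d:=c)) (tdom_cmap cp cp)) => y [cy _].
by rewrite /trans /= cinvK.
Qed.

Lemma jac_transK c d p : atlas M c -> atlas M d -> cdom c p -> cdom d p ->
  jac (trans c d) (cmap c p) *m jac (trans d c) (cmap d p) = 1%:M.
Proof.
by move=> ac ad cp dp; rewrite -(jac_trans_comp ac ad ac cp dp cp) jac_trans_id.
Qed.

Lemma in_chartE c p v : atlas M c -> cdom c p ->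
  in_chart c p v = v *m jac (trans (chart_at p) c) (cmap (chart_at p) p).
Proof.
move=> ac cp; rewrite /in_chart (derive_jac v) //.
exact: differentiable_trans (chart_at_atlas p) ac (tdom_cmap (chart_at_dom p) cp).
Qed.

Lemma of_chartE c p v : atlas M c -> cdom c p ->
  of_chart c (cmap c p) v = v *m jac (trans c (chart_at p)) (cmap c p).
Proof.
move=> ac cp; rewrite /of_chart cmapK // (derive_jac v) //.
exact: differentiable_trans ac (chart_at_atlas p) (tdom_cmap cp (chart_at_dom p)).
Qed.

Lemma in_chart_at p v : in_chart (chart_at p) p v = v.
Proof.
rewrite (in_chartE v (chart_at_atlas p) (chart_at_dom p)).
by rewrite (jac_trans_id (chart_at_atlas p) (chart_at_dom p)) mulmx1.
Qed.

Lemma in_chart_trans c d p v : atlas M c -> atlas M d -> cdom c p -> cdom d p ->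
  in_chart d p v = in_chart c p v *m jac (trans c d) (cmap c p).
Proof.
move=> ac ad cp dp; rewrite (in_chartE v ac cp) (in_chartE v ad dp) -mulmxA.
by rewrite -(jac_trans_comp (chart_at_atlas p) ac ad (chart_at_dom p) cp dp).
Qed.

Lemma in_chartK c p v : atlas M c -> cdom c p ->
  of_chart c (cmap c p) (in_chart c p v) = v.
Proof.
move=> ac cp; rewrite (of_chartE _ ac cp) (in_chartE v ac cp) -mulmxA.
by rewrite (jac_transK (chart_at_atlas p) ac (chart_at_dom p) cp) mulmx1.
Qed.

Lemma of_chartK c p v : atlas M c -> cdom c p ->
  in_chart c p (of_chart c (cmap c p) v) = v.
Proof.
move=> ac cp; rewrite (of_chartE v ac cp) (in_chartE _ ac cp) -mulmxA.
by rewrite (jac_transK ac (chart_at_atlas p) cp (chart_at_dom p)) mulmx1.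
Qed.

Lemma in_chart_inj c p : atlas M c -> cdom c p -> injective (in_chart c p).
Proof. by move=> ac cp u v E; rewrite -(in_chartK u ac cp) E in_chartK. Qed.

Lemma in_chartD c p u v : atlas M c -> cdom c p ->
  in_chart c p (u + v) = in_chart c p u + in_chart c p v.
Proof. by move=> ac cp; rewrite !in_chartE // mulmxDl. Qed.

Lemma in_chartZ c p (a : R) u : atlas M c -> cdom c p ->
  in_chart c p (a *: u) = a *: in_chart c p u.
Proof. by move=> ac cp; rewrite !in_chartE // -scalemxAl. Qed.

Lemma in_chart0 c p : atlas M c -> cdom c p -> in_chart c p 0 = 0.
Proof. by move=> ac cp; rewrite in_chartE // mul0mx. Qed.

End Charts.

Section Maps.
Variables (R : realType) (n : nat) (M : manifold R n) (V : normedModType R).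
Variables (F : V -> M) (U : set V).
Hypotheses (oU : open U) (sF : smooth_into F U).

Lemma open_chart_dom (c : chart R n M) : open (U `&` F @^-1` cdom c).
Proof.
by apply: open_setI_preimage oU (@cdom_open _ _ _ c) _; exact: sF.1.
Qed.

(** By the chain rule through the transition map, the preferred chart in which [push] is written can
    be traded for any chart around [F x]; with [c] fixed, [push] can be differentiated again. *)
Lemma in_chart_push (c : chart R n M) x v : atlas M c -> U x -> cdom c (F x) ->
  in_chart c (F x) (push F x v) = 'D_v (cmap c \o F) x.
Proof.
move=> ac Ux cFx; pose d := chart_at (F x).
have ad : atlas M d := chart_at_atlas _.
have dFx : cdom d (F x) := chart_at_dom _.
have dx : derivable (cmap d \o F) x v.
  by apply: smooth_on_derivable (sF.2 d ad) _; split.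
have dt := differentiable_trans ad ac (tdom_cmap dFx cFx).
have E := derive_comp dx (dt : differentiable (trans d c) ((cmap d \o F) x)).
rewrite (in_chartE _ ac cFx) -(derive_jac _ dt) /push -E.
apply: (derive_ext_open _ (open_chart_dom d) (conj Ux dFx)) => y [_ dFy].
by rewrite /trans /= cmapK.
Qed.

Lemma smooth_along_push v : smooth_along F U (fun x => push F x v).
Proof.
move=> c ac; have := smooth_on_derive v (sF.2 c ac).
apply: smooth_on_ext (open_chart_dom c) _ => x [Ux cFx].
by rewrite in_chart_push.
Qed.

Lemma smooth_alongD Y Z : smooth_along F U Y -> smooth_along F U Z ->
  smooth_along F U (fun x => Y x + Z x).
Proof.
move=> sY sZ c ac; have oc := open_chart_dom c.
apply: smooth_on_ext oc _ (smooth_onD oc (sY c ac) (sZ c ac)) => x [_ cFx].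
by rewrite in_chartD.
Qed.

Lemma smooth_alongZ (a : V -> R) Y : smooth_on U a -> smooth_along F U Y ->
  smooth_along F U (fun x => a x *: Y x).
Proof.
move=> sa sY c ac; have oc := open_chart_dom c.
have sa' := smooth_on_subset (@subIsetl _ U (F @^-1` cdom c)) sa.
apply: smooth_on_ext oc _ (smooth_on_scale oc sa' (sY c ac)) => x [_ cFx].
by rewrite in_chartZ.
Qed.

Lemma smooth_along_ext Y Z : (forall x, U x -> Y x = Z x) ->
  smooth_along F U Y -> smooth_along F U Z.
Proof.
move=> YZ sY c ac; apply: smooth_on_ext (open_chart_dom c) _ (sY c ac) => x [Ux _].
by rewrite YZ.
Qed.

Lemma smooth_along_derivable Y c x v : smooth_along F U Y -> atlas M c -> U x ->
  cdom c (F x) -> derivable (fun y => in_chart c (F y) (Y y)) x v.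
Proof. by move=> sY ac Ux cx; apply: smooth_on_derivable (sY c ac) _; split. Qed.

End Maps.

(** The end of the change of chart for Christoffel symbols: [a1], [a2], [a3] are derivatives of the
    metric, and [P], [Q], [S] with their primed versions are products with second derivatives of the
    transition map. Symmetry of the latter leaves only [P]. *)
Lemma chr_algebra (R : realType) (X P P' Q Q' S S' C a1 a2 a3 : R) :
  2 * X = (a1 + P + Q) + (a2 + P' + S) - (a3 + Q' + S') ->
  2 * C = a1 + a2 - a3 -> P' = P -> Q = Q' -> S' = S -> X - (P + C) = 0.
Proof. by lra. Qed.

(** * Koszul's formula and the Levi-Civita connection in charts *)

Section KoszulAlgebra.
Variables (R : realType) (n : nat) (G : 'M[R]_n) (D : 'I_n -> 'M[R]_n).
Hypotheses (uG : G \in unitmx) (symG : G^T = G).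
Implicit Types u w z : 'rV[R]_n.

(** Pure linear algebra, with [D k] standing for a partial derivative of the metric: lowering the
    index by [G] cancels [invmx G], and the remaining triple sums match after renaming indices. *)
Lemma koszul_algebra u w z (Du Dw Dz : 'M[R]_n) (chr : 'rV[R]_n) :
  Du = \sum_k u ord0 k *: D k -> Dw = \sum_k w ord0 k *: D k ->
  Dz = \sum_k z ord0 k *: D k ->
  chr = \row_k \sum_i \sum_j (2^-1 * \sum_m invmx G k m *
    (D i j m + D j i m - D m i j)) * u ord0 i * w ord0 j ->
  2 * bil G chr z = bil Du w z + bil Dw u z - bil Dz u w.
Proof.
move=> Eu Ew Ez Ec.
(* Twice the Christoffel symbols of the first kind, contracted with [u] and [w]. *)
pose S : 'rV[R]_n := \row_m \sum_i \sum_j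
  (D i j m + D j i m - D m i j) * u ord0 i * w ord0 j.
have chrE : chr = 2^-1 *: (S *m invmx G).
  rewrite Ec; apply/rowP => k; rewrite !mxE.
  under [in RHS]eq_bigr do rewrite mxE mulr_suml.
  rewrite [in RHS]exchange_big mulr_sumr; apply: eq_bigr => i _ /=.
  under [in RHS]eq_bigr do rewrite mulr_suml.
  rewrite [in RHS]exchange_big mulr_sumr; apply: eq_bigr => j _ /=.
  rewrite -!mulrA mulr_suml; congr (_ * _); apply: eq_bigr => m _.
  have -> : invmx G m k = invmx G k m by rewrite -[in LHS]symG -trmx_inv mxE.
  by rewrite [RHS]mulrC !mulrA.
have E0 : bil G (S *m invmx G) z = (S *m z^T) ord0 ord0.
  by rewrite /bil mulmxKV.
have two0 : (2 : R) != 0 by rewrite pnatr_eq0.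
rewrite chrE bilZl E0 (mulVKf two0) [LHS]mxE Eu Ew Ez !bil_sum.
have E1 : \sum_k u ord0 k * bil (D k) w z =
  \sum_m \sum_i \sum_j D i j m * u ord0 i * w ord0 j * z ord0 m.
  rewrite [RHS]exchange_big; apply: eq_bigr => i _ /=.
  rewrite [RHS]exchange_big bilE mulr_sumr; apply: eq_bigr => j _ /=.
  rewrite mulr_sumr; apply: eq_bigr => m _.
  by ring.
have E2 : \sum_k w ord0 k * bil (D k) u z =
  \sum_m \sum_i \sum_j D j i m * u ord0 i * w ord0 j * z ord0 m.
  under [RHS]eq_bigr do rewrite exchange_big.
  rewrite [RHS]exchange_big; apply: eq_bigr => j _ /=.
  rewrite [RHS]exchange_big bilE mulr_sumr; apply: eq_bigr => i _ /=.
  rewrite mulr_sumr; apply: eq_bigr => m _.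
  by ring.
have E3 : \sum_k z ord0 k * bil (D k) u w =
  \sum_m \sum_i \sum_j D m i j * u ord0 i * w ord0 j * z ord0 m.
  apply: eq_bigr => m _; rewrite bilE mulr_sumr; apply: eq_bigr => i _.
  rewrite mulr_sumr; apply: eq_bigr => j _.
  by ring.
rewrite E1 E2 E3 -big_split -sumrB; apply: eq_bigr => m _ /=.
rewrite !mxE mulr_suml -big_split -sumrB; apply: eq_bigr => i _ /=.
rewrite mulr_suml -big_split -sumrB; apply: eq_bigr => j _ /=.
by rewrite -!mulrA -mulrDl -mulrBl.
Qed.

End KoszulAlgebra.

Section Metric.
Variables (R : realType) (n : nat) (M : manifold R n) (g : metric M).
Implicit Types (c d : chart R n M) (p : M) (y u v w z : 'rV[R]_n).

Lemma innerE p u v : inner g p u v = bil (gmx g p) u v.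
Proof. by []. Qed.

Lemma innerC p u v : inner g p u v = inner g p v u.
Proof. by rewrite !innerE bilC // gmx_sym. Qed.

Lemma inner_gt0 p v : v <> 0 -> 0 < inner g p v v.
Proof. exact: gmx_pos. Qed.

Lemma gramE c p : atlas M c -> cdom c p ->
  gram g c (cmap c p) = jac (trans c (chart_at p)) (cmap c p) *m gmx g p
     *m (jac (trans c (chart_at p)) (cmap c p))^T.
Proof.
move=> ac cp; apply/matrixP => i j; rewrite mxE !(of_chartE _ ac cp) (cmapK cp).
rewrite innerE bil_mul /bil -rowE.
rewrite [LHS]mxE (bigD1 j) //= big1 ?addr0; first by rewrite !mxE !eqxx mulr1.
by move=> k kj; rewrite !mxE eqxx /= (negbTE kj) mulr0.
Qed.

Lemma inner_gram c p u v : atlas M c -> cdom c p ->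
  inner g p u v = bil (gram g c (cmap c p)) (in_chart c p u) (in_chart c p v).
Proof.
move=> ac cp; rewrite gramE // -bil_mul -!of_chartE //.
by rewrite !in_chartK.
Qed.

Lemma gram_sym c y : (gram g c y)^T = gram g c y.
Proof.
apply/matrixP => i j; rewrite mxE [RHS]mxE [LHS]mxE.
exact: innerC.
Qed.

(** A vector in the kernel of the Gram matrix would have length 0 in the metric. *)
Lemma gram_unit c y : atlas M c -> ccod c y -> gram g c y \in unitmx.
Proof.
move=> ac cy; have cp := cinv_dom cy; rewrite -(cinvK cy).
rewrite -row_free_unit; apply: inj_row_free => v vG0; apply: contrapT => v0.
pose w := of_chart c (cmap c (cinv c y)) v.
have w0 : w <> 0.
  by move=> w0; apply: v0; rewrite -(of_chartK v ac cp) -/w w0 in_chart0.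
have := inner_gt0 (cinv c y) w0.
rewrite (inner_gram _ _ ac cp) of_chartK // /bil vG0 mul0mx mxE.
by rewrite ltxx.
Qed.

Lemma gram_trans c d y : atlas M c -> atlas M d -> tdom c d y ->
  gram g c y = jac (trans c d) y *m gram g d (trans c d y) *m (jac (trans c d) y)^T.
Proof.
move=> ac ad [cy dy]; have cp := cinv_dom cy.
rewrite /trans /= -/(trans c d) -{1 2 4}(cinvK cy).
rewrite (gramE ac cp) (gramE ad dy).
rewrite (jac_trans_comp ac ad (chart_at_atlas _) cp dy (chart_at_dom _)).
by rewrite trmx_mul !mulmxA.
Qed.

Lemma smooth_gram c : atlas M c -> smooth_on (ccod c) (gram g c).
Proof. exact: gmx_smooth. Qed.

Definition chr c y u w : 'rV[R]_n :=
  \row_(k < n) \sum_(i < n) \sum_(j < n)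
     christoffel g c y k i j * u ord0 i * w ord0 j.

(** Free of indices and of the inverse matrix, this still determines [chr], the Gram matrix being
    invertible. The change of chart and the compatibility with the metric both follow from it. *)
Lemma koszul c y u w z : atlas M c -> ccod c y ->
  2 * bil (gram g c y) (chr c y u w) z =
  bil ('D_u (gram g c) y) w z + bil ('D_w (gram g c) y) u z
  - bil ('D_z (gram g c) y) u w.
Proof.
move=> ac cy.
have dG := smooth_differentiable (@ccod_open _ _ _ c) cy (smooth_gram ac).
apply: (koszul_algebra (gram_unit ac cy) (gram_sym c y) (derive_rowE u dG)
  (derive_rowE w dG) (derive_rowE z dG)).
by [].
Qed.

Lemma smooth_christoffel c k i j : atlas M c ->
  smooth_on (ccod c) (fun y => christoffel g c y k i j).
Proof.
move=> ac; have oc := @ccod_open _ _ _ c.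
have sd a b e : smooth_on (ccod c) (fun y => dgram g c y a b e).
  exact: (smooth_on_entry oc b e (smooth_on_derive (delta_mx ord0 a) (smooth_gram ac))).
apply: smooth_onZ => //; apply: smooth_on_sum => // m.
apply: smooth_onM => //.
  apply: smooth_on_entry => //; apply: smooth_on_invmx => // [y cy|].
    exact: gram_unit.
  exact: smooth_gram.
by apply: smooth_onB => //; apply: smooth_onD.
Qed.

Lemma smooth_on_chr (V : normedModType R) (U : set V) c
    (y u w : V -> 'rV[R]_n) : open U -> atlas M c ->
  (forall x, U x -> ccod c (y x)) -> smooth_on U y -> smooth_on U u ->
  smooth_on U w -> smooth_on U (fun x => chr c (y x) (u x) (w x)).
Proof.
move=> oU ac cy sy su sw; apply/(smooth_on_mxP _ oU) => k l.
have S : smooth_on U (fun x => \sum_(i < n) \sum_(j < n)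
    christoffel g c (y x) l i j * u x ord0 i * w x ord0 j).
  apply: smooth_on_sum => // i; apply: smooth_on_sum => // j.
  apply: smooth_onM => //; last exact: smooth_on_entry.
  apply: smooth_onM => //; last exact: smooth_on_entry.
  exact: (smooth_on_comp_row oU (@ccod_open _ _ _ c) cy sy
    (smooth_christoffel l i j ac)).
by apply: smooth_on_ext oU _ S => x _; rewrite mxE.
Qed.

(* Both sides are compared through the metric of [d]: by Koszul's formula their
   products with [z *m jac (trans c d) y] differ by second derivatives of the
   transition map, which cancel by symmetry. *)
Lemma chr_trans c d y u w : atlas M c -> atlas M d -> tdom c d y ->
  chr c y u w *m jac (trans c d) y =
  'D_u ('D_w (trans c d)) y
  + chr d (trans c d y) (u *m jac (trans c d) y) (w *m jac (trans c d) y).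
Proof.
move=> ac ad tcd; set J := jac (trans c d) y; set f := trans c d.
have oT := @open_tdom _ _ _ c d.
have sf : smooth_on (tdom c d) f := smooth_trans ac ad.
have dcod : ccod d (f y) by have [] := trans_tdom tcd.
have cy : ccod c y := tcd.1.
have DfE v : 'D_v f y = v *m J := derive_jac v (smooth_differentiable oT tcd sf).
have Jinv : J *m jac (trans d c) (f y) = 1%:M.
  have := jac_transK ac ad (cinv_dom cy) tcd.2.
  by rewrite (cinvK cy).
have dgd : differentiable (gram g d) (f y).
  exact: smooth_differentiable (@ccod_open _ _ _ d) dcod (smooth_gram ad).
(* Derivative of the transformation law of the metric: the product rule gives the derivative of the
   metric in [d] and, for each of the two Jacobian factors, a second derivative of [f]. *)
have DG a b v : bil ('D_v (gram g c) y) a b =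
    bil ('D_(v *m J) (gram g d) (f y)) (a *m J) (b *m J)
    + bil (gram g d (f y)) ('D_v ('D_a f) y) (b *m J)
    + bil (gram g d (f y)) (a *m J) ('D_v ('D_b f) y).
  have dc : derivable (gram g c) y v.
    exact: smooth_on_derivable (smooth_gram ac) cy.
  have df : derivable f y v by exact: smooth_on_derivable sf tcd.
  have dDf e : derivable ('D_e f) y v.
    by exact: smooth_on_derivable (smooth_on_derive e sf) tcd.
  have G1 : 'D_v (gram g d \o f) y = 'D_(v *m J) (gram g d) (f y).
    exact: (etrans (derive_comp df dgd) (congr1 (fun t => 'D_t (gram g d) (f y)) (DfE v))).
  have [_ E1] := is_derive_bil_cst a b dc.
  have [_ E2] := is_derive_bil (derivable_comp df dgd) (dDf a) (dDf b).
  apply: (etrans (esym E1)); apply: etrans.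
    apply: (derive_ext_open (g := fun x =>
      bil ((gram g d \o f) x) ('D_a f x) ('D_b f x)) _ oT tcd) => x tx.
    have dx := smooth_differentiable oT tx sf.
    rewrite (gram_trans ac ad tx) -bil_mul.
    by congr bil; [exact: (esym (derive_jac a dx))|exact: (esym (derive_jac b dx))].
  apply: (etrans E2).
  exact: (f_equal2 +%R (f_equal2 +%R (f_equal3 (@bil R n) G1 (DfE a) (DfE b))
    (f_equal3 (@bil R n) erefl erefl (DfE b)))
    (f_equal3 (@bil R n) erefl (DfE a) erefl)).
apply/eqP; rewrite -subr_eq0; apply/eqP.
apply: (bil_eq0 (gram_unit ad dcod)) => z'.
have {z'}[z ->] : exists z, z' = z *m J.
  exists (z' *m jac (trans d c) (f y)); rewrite -mulmxA.
  have := jac_transK ad ac tcd.2 (cinv_dom cy).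
  by rewrite -/f (cinvK cy) => ->; rewrite mulmx1.
have tsym a b : bil (gram g d (f y)) a b = bil (gram g d (f y)) b a.
  by apply: bilC; exact: gram_sym.
have K1 := koszul u w z ac cy.
have {}K1 := etrans K1 (f_equal2 (fun s t => s - t)
  (f_equal2 +%R (DG w z u) (DG u z w)) (DG u w z)).
have K2 := koszul (u *m J) (w *m J) (z *m J) ad dcod.
rewrite bilDl bilNl bilDl bil_mul -(gram_trans ac ad tcd).
apply: (chr_algebra K1 K2).
- by rewrite (Schwarz w u oT tcd sf).
- by rewrite tsym (Schwarz z u oT tcd sf).
- by rewrite (Schwarz z w oT tcd sf).
Qed.

End Metric.

Lemma compat_algebra (R : realType) (T X Y p q q' a a' b c : R) :
  2 * p = a + b - c -> 2 * q = a' + c - b -> a' = a -> q' = q -> T = a ->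
  T + X + Y = (X + p) + (Y + q').
Proof. by move=> *; lra. Qed.

Section Covariant.
Variables (R : realType) (n : nat) (M : manifold R n) (g : metric M).
Variables (V : normedModType R) (F : V -> M) (U : set V).
Hypotheses (oU : open U) (sF : smooth_into F U).
Implicit Types (c d : chart R n M) (Y Z : V -> 'rV[R]_n).

(** Independence of the chart. Components in [c] are those in the preferred chart times the Jacobian
    of the transition map; differentiating this Jacobian along [F] produces a second derivative,
    exactly the term by which [chr] fails to be a tensor in [chr_trans]. *)
Lemma covdE Y c x v : smooth_along F U Y -> atlas M c -> U x -> cdom c (F x) ->
  in_chart c (F x) (covd g F Y x v) =
  'D_v (fun y => in_chart c (F y) (Y y)) x
  + chr g c (cmap c (F x)) ('D_v (cmap c \o F) x) (in_chart c (F x) (Y x)).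
Proof.
move=> sY ac Ux cx; pose d := chart_at (F x).
have ad : atlas M d := chart_at_atlas _.
have dx : cdom d (F x) := chart_at_dom _.
pose f := trans d c; pose Fd := cmap d \o F.
pose Yd y := in_chart d (F y) (Y y); pose u := 'D_v Fd x.
have oT := @open_tdom _ _ _ d c.
have tx : tdom d c (Fd x) := tdom_cmap dx cx.
have sf : smooth_on (tdom d c) f := smooth_trans ad ac.
have df := smooth_differentiable oT tx sf.
have dFd : derivable Fd x v.
  by apply: smooth_on_derivable (sF.2 d ad) _; split.
have dYd : derivable Yd x v := smooth_along_derivable sY ad Ux dx.
have E0 : covd g F Y x v = 'D_v Yd x + chr g d (Fd x) u (Y x) by [].
have Yx : Yd x = Y x := in_chart_at (F x) (Y x).
have dJ : differentiable (jac f) (Fd x).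
  exact: smooth_differentiable oT tx (smooth_on_jac oT sf).
have E1 : 'D_v (fun y => in_chart c (F y) (Y y)) x =
    'D_v Yd x *m jac f (Fd x) + 'D_u ('D_(Y x) f) (Fd x).
  have [_ E] := is_derive_mulmx dYd (derivable_comp dFd dJ).
  apply: (@etrans _ _ ('D_v (fun y => Yd y *m (jac f \o Fd) y) x)).
    have oI := openI (open_chart_dom oU sF d) (open_chart_dom oU sF c).
    apply: (derive_ext_open _ oI) => [|y [[_ dy] [_ cy]]]; first by split.
    exact: in_chart_trans ad ac dy cy.
  apply: (etrans E); congr +%R; rewrite Yx.
  apply: (etrans _ (derive_jac2 u (Y x) oT tx sf)).
  exact: (congr1 (fun t => Y x *m t) (derive_comp dFd dJ)).
have E2 : 'D_v (cmap c \o F) x = u *m jac f (Fd x).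
  apply: (etrans _ (derive_jac u df)); apply: (etrans _ (derive_comp dFd df)).
  apply: (derive_ext_open _ (open_chart_dom oU sF d) (conj Ux dx)) => y [_ dy].
  by rewrite /f /Fd /trans /= cmapK.
have E3 : in_chart c (F x) (Y x) = Y x *m jac f (Fd x) := in_chartE (Y x) ac cx.
rewrite E0 (in_chartE _ ac cx) -/d -/f -/(Fd x) mulmxDl E1 E2 E3.
rewrite -[cmap c (F x)](trans_cmap c dx) -/f -/(Fd x).
rewrite -addrA; congr (_ + _).
exact: (chr_trans g u (Y x) ad ac tx).
Qed.

Lemma smooth_along_covd Y v :
  smooth_along F U Y -> smooth_along F U (fun x => covd g F Y x v).
Proof.
move=> sY c ac; have oc := open_chart_dom oU sF c.
have s1 := smooth_on_derive v (sY c ac).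
have cc x : (U `&` F @^-1` cdom c) x -> ccod c ((cmap c \o F) x).
  by move=> [_ cx]; exact: cmap_cod.
have s2 := smooth_on_chr g oc ac cc (sF.2 c ac) (smooth_on_derive v (sF.2 c ac)) (sY c ac).
apply: smooth_on_ext oc _ (smooth_onD oc s1 s2) => x [Ux cx].
exact: esym (covdE v sY ac Ux cx).
Qed.

Lemma smooth_on_inner Y Z : smooth_along F U Y -> smooth_along F U Z ->
  smooth_on U (fun x => inner g (F x) (Y x) (Z x)).
Proof.
move=> sY sZ; apply: smooth_on_local => x Ux.
pose c := chart_at (F x); have ac : atlas M c := chart_at_atlas _.
exists (U `&` F @^-1` cdom c); first by split=> //; exact: chart_at_dom.
have oc := open_chart_dom oU sF c.
have cc y : (U `&` F @^-1` cdom c) y -> ccod c ((cmap c \o F) y).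
  by move=> [_ cy]; exact: cmap_cod.
have sG := smooth_on_comp oc (@ccod_open _ _ _ c) cc (sF.2 c ac) (smooth_gram g ac).
apply: smooth_on_ext oc _ (smooth_on_bil oc sG (sY c ac) (sZ c ac)) => y [_ cy].
exact: esym (inner_gram g _ _ ac cy).
Qed.

(** Two instances of Koszul's formula with [Y] and [Z] exchanged: in their sum the derivative of the
    metric in the direction of motion appears twice and the other terms cancel. *)
Lemma derive_inner Y Z x v : smooth_along F U Y -> smooth_along F U Z -> U x ->
  'D_v (fun y => inner g (F y) (Y y) (Z y)) x =
  inner g (F x) (covd g F Y x v) (Z x) + inner g (F x) (Y x) (covd g F Z x v).
Proof.
move=> sY sZ Ux; pose c := chart_at (F x).
have ac : atlas M c := chart_at_atlas _.
have cx : cdom c (F x) := chart_at_dom _.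
pose Yc y := in_chart c (F y) (Y y); pose Zc y := in_chart c (F y) (Z y).
pose Fc := cmap c \o F; pose u := 'D_v Fc x; pose G := gram g c (Fc x).
have cFx : ccod c (Fc x) := cmap_cod cx.
have dF : derivable Fc x v.
  by apply: smooth_on_derivable (sF.2 c ac) _; split.
have dG := smooth_differentiable (@ccod_open _ _ _ c) cFx (smooth_gram g ac).
have dY : derivable Yc x v := smooth_along_derivable sY ac Ux cx.
have dZ : derivable Zc x v := smooth_along_derivable sZ ac Ux cx.
have [_ E] := is_derive_bil (derivable_comp dF dG) dY dZ.
have oc := open_chart_dom oU sF c.
apply: (@etrans _ _ ('D_v (fun y => bil ((gram g c \o Fc) y) (Yc y) (Zc y)) x)).
  apply: (derive_ext_open _ oc) => [|y [_ cy]]; first by split.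
  exact: inner_gram.
apply: (etrans E); rewrite !(inner_gram g _ _ ac cx) -/(Fc x) -/G.
rewrite (covdE v sY ac Ux cx) (covdE v sZ ac Ux cx) bilDl bilDr.
rewrite -/(Yc x) -/(Zc x) -/Yc -/Zc -/Fc -/u -/(Fc x).
have K1 := koszul g u (Yc x) (Zc x) ac cFx.
have K2 := koszul g u (Zc x) (Yc x) ac cFx.
have tsym A B : bil G A B = bil G B A by apply: bilC; exact: gram_sym.
have gsym A B w : bil ('D_w (gram g c) (Fc x)) A B = bil ('D_w (gram g c) (Fc x)) B A.
  apply: bilC; have dg := diff_derivable (v := w) dG.
  have [_ E'] := is_derive_trmx dg; apply: (etrans (esym E')).
  exact: (congr1 (fun h => 'D_w h (Fc x)) (funext (gram_sym g c))).
have D1 := congr1 (fun t => bil t (Yc x) (Zc x)) (derive_comp dF dG).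
have K := compat_algebra (bil G ('D_v Yc x) (Zc x)) (bil G (Yc x) ('D_v Zc x))
  K1 K2 (gsym _ _ _) (tsym _ _) D1.
exact: K.
Qed.

End Covariant.

Section Composition.
Variables (R : realType) (n m : nat) (M : manifold R n) (g : metric M).
Variables (V : normedModType R) (F : 'rV[R]_m -> M) (U : set 'rV[R]_m).
Variables (u : V -> 'rV[R]_m).
Hypotheses (oU : open U) (sF : smooth_into F U).
Implicit Types (Y : 'rV[R]_m -> 'rV[R]_n).

Lemma push_comp x v : derivable u x v -> U (u x) ->
  push (F \o u) x v = push F (u x) ('D_v u x).
Proof.
move=> du Uux; pose c := chart_at (F (u x)).
have ac : atlas M c := chart_at_atlas _.
have cx : cdom c (F (u x)) := chart_at_dom _.
have oc := open_chart_dom oU sF c.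
exact: (derive_comp du (smooth_differentiable oc (conj Uux cx) (sF.2 c ac))).
Qed.

(** The direction enters [covd] only through first derivatives, so the chain rule suffices. This
    turns [Dt] along a curve on a surface into [covd] along a parametrisation of the surface. *)
Lemma covd_comp Y x v : smooth_along F U Y -> derivable u x v -> U (u x) ->
  covd g (F \o u) (Y \o u) x v = covd g F Y (u x) ('D_v u x).
Proof.
move=> sY du Uux; pose c := chart_at (F (u x)).
have ac : atlas M c := chart_at_atlas _.
have cx : cdom c (F (u x)) := chart_at_dom _.
have oc := open_chart_dom oU sF c.
have E1 := derive_comp du (smooth_differentiable oc (conj Uux cx) (sY c ac)).
have E2 := push_comp du Uux.
exact: (f_equal2 +%R E1
  (congr1 (fun t => chr g c (cmap c (F (u x))) t (Y (u x))) E2)).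
Qed.

Variable (U' : set V).
Hypotheses (oU' : open U') (su : smooth_on U' u).
Hypothesis (uU : forall x, U' x -> U (u x)).

Lemma continuous_map_comp x : U' x -> {for x, continuous (F \o u)}.
Proof.
move=> Ux; apply: continuous_comp; first exact: smooth_on_cont su Ux.
exact: sF.1 (uU Ux).
Qed.

Lemma smooth_on_chart_comp (c : chart R n M) (W : normedModType R)
    p q (f : 'rV[R]_m -> 'M[R]_(p, q)) :
  smooth_on (U `&` F @^-1` cdom c) f ->
  smooth_on (U' `&` (F \o u) @^-1` cdom c) (f \o u).
Proof.
have oc := open_chart_dom oU sF c.
have oc' : open (U' `&` (F \o u) @^-1` cdom c).
  by apply: open_setI_preimage oU' (@cdom_open _ _ _ c) _; exact: continuous_map_comp.
move=> sf; apply: (smooth_on_comp oc' oc _ _ sf).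
  by move=> x [Ux cx]; split=> //; exact: uU.
exact: smooth_on_subset (@subIsetl _ _ _) su.
Qed.

Lemma smooth_into_comp : smooth_into (F \o u) U'.
Proof.
split=> [x|c ac]; first exact: continuous_map_comp.
exact: (smooth_on_chart_comp V (sF.2 c ac)).
Qed.

Lemma smooth_along_comp Y :
  smooth_along F U Y -> smooth_along (F \o u) U' (Y \o u).
Proof. by move=> sY c ac; exact: (smooth_on_chart_comp V (sY c ac)). Qed.

End Composition.

Section Ext.
Variables (R : realType) (n : nat) (M : manifold R n) (g : metric M).
Variables (V : normedModType R) (U : set V).
Hypothesis oU : open U.

Lemma push_ext (F G : V -> M) x v : U x ->
  (forall y, U y -> F y = G y) -> push F x v = push G x v.
Proof.
move=> Ux FG; rewrite /push (FG x Ux).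
by apply: (derive_ext_open _ oU Ux) => y Uy /=; rewrite FG.
Qed.

Lemma smooth_into_ext (F G : V -> M) :
  (forall y, U y -> F y = G y) -> smooth_into F U -> smooth_into G U.
Proof.
move=> FG [cF sF]; have E c : U `&` F @^-1` cdom c = U `&` G @^-1` cdom c.
  by apply/seteqP; split=> x [Ux]; rewrite /preimage /= FG.
split=> [x Ux|c ac].
  apply: continuous_near_eq (cF x Ux).
  by apply: filterS (open_near oU Ux) => y Uy; exact: FG.
rewrite -E; have oc := open_chart_dom oU (conj cF sF) c.
by apply: smooth_on_ext oc _ (sF c ac) => x [Ux _] /=; rewrite FG.
Qed.

Lemma smooth_into_local (F : V -> M) :
  (forall x, U x -> exists2 U' : set V, open U' /\ U' x & smooth_into F U') ->
  smooth_into F U.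
Proof.
move=> H; split=> [x /H[U' [oU' U'x] [+ _]]|c ac]; first exact.
apply: smooth_on_local => x [/H[U' [oU' U'x] sF] cx].
by exists (U' `&` F @^-1` cdom c) => //; exact: sF.2.
Qed.

Lemma smooth_into_subset (U' : set V) (F : V -> M) :
  U' `<=` U -> smooth_into F U -> smooth_into F U'.
Proof.
move=> U'U [cF sF]; split=> [x /U'U|c ac]; first exact: cF.
by apply: smooth_on_subset (sF c ac) => x [/U'U].
Qed.

Lemma smooth_along_subset (U' : set V) (F : V -> M) Y :
  U' `<=` U -> smooth_along F U Y -> smooth_along F U' Y.
Proof. by move=> U'U sY c ac; apply: smooth_on_subset (sY c ac) => x [/U'U]. Qed.

End Ext.

Section Periodic.
Variables (R : realType) (l : R).

Lemma derive_periodic (W : normedModType R) (f : R -> W) t v :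
  (forall s, f (s + l) = f s) -> 'D_v f (t + l) = 'D_v f t.
Proof.
move=> fp; rewrite /derive.
have -> : (fun h : R => h^-1 *: ((f \o shift (t + l)) (h *: v) - f (t + l))) =
    (fun h : R => h^-1 *: ((f \o shift t) (h *: v) - f t)) => //.
by apply/funext => h /=; rewrite addrA !fp.
Qed.

Variables (n : nat) (M : manifold R n) (g : metric M) (c : R -> M).
Hypothesis cp : forall s, c (s + l) = c s.

Lemma velocity_periodic t : velocity c (t + l) = velocity c t.
Proof.
rewrite /velocity /push cp; apply: (@derive_periodic _ _ t 1) => s /=.
by rewrite cp.
Qed.

Lemma Dt_periodic (Y : R -> 'rV[R]_n) t : (forall s, Y (s + l) = Y s) ->
  Dt g c Y (t + l) = Dt g c Y t.
Proof.
move=> Yp; rewrite /Dt /covd cp Yp; pose d := chart_at (c t).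
have E1 : 'D_1 (fun y => in_chart d (c y) (Y y)) (t + l) =
    'D_1 (fun y => in_chart d (c y) (Y y)) t.
  by apply: derive_periodic => s; rewrite cp Yp.
exact: (f_equal2 +%R E1
  (congr1 (fun w => chr g d (cmap d (c t)) w (Y t)) (velocity_periodic t))).
Qed.

End Periodic.

Section Frame.
Variables (R : realType) (n : nat) (M : manifold R n) (g : metric M) (p : M).
Implicit Types u v w z : 'rV[R]_n.

Lemma innerDl u v w : inner g p (u + v) w = inner g p u w + inner g p v w.
Proof. exact: bilDl. Qed.

Lemma innerZl (a : R) u v : inner g p (a *: u) v = a * inner g p u v.
Proof. exact: bilZl. Qed.

Lemma innerZr (a : R) u v : inner g p u (a *: v) = a * inner g p u v.
Proof. exact: bilZr. Qed.

Lemma innerNl u v : inner g p (- u) v = - inner g p u v.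
Proof. exact: bilNl. Qed.

Lemma inner_lin2 (a b : R) u v w :
  inner g p (a *: u + b *: v) w = a * inner g p u w + b * inner g p v w.
Proof. by rewrite innerDl !innerZl. Qed.

Lemma inner0l v : inner g p 0 v = 0.
Proof. exact: bil0l. Qed.

Lemma inner_ge0 u : 0 <= inner g p u u.
Proof.
have [->|/eqP/(inner_gt0 g p)/ltW//] := eqVneq u 0.
by rewrite inner0l.
Qed.

Lemma gnorm_sqr u : Defs.gnorm g p u ^+ 2 = inner g p u u.
Proof. by rewrite /Defs.gnorm sqr_sqrtr // inner_ge0. Qed.

Lemma gnorm1P u : Defs.gnorm g p u = 1 <-> inner g p u u = 1.
Proof.
split=> [u1|u1]; first by rewrite -gnorm_sqr u1 expr1n.
by rewrite /Defs.gnorm u1 sqrtr1.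
Qed.

(** With the [E i] as rows of [A] and [G] the metric at [p], orthonormality reads [A G A^T = 1], so
    [G A^T] is invertible; the products of [z] with the [E i] are the entries of [z G A^T]. *)
Lemma orthonormal_unitmx (E : 'I_n -> 'rV[R]_n) :
  (forall i j, inner g p (E i) (E j) = (i == j)%:R) ->
  forall z, (forall i, inner g p z (E i) = 0) -> z = 0.
Proof.
move=> EE z zE; pose A : 'M[R]_n := \matrix_i E i.
have AG : A *m (gmx g p *m A^T) = 1%:M.
  apply/matrixP => i j; rewrite mulmxA [RHS]mxE -EE /inner [LHS]mxE [RHS]mxE.
  apply: eq_bigr => k _; rewrite [X in _ * X]mxE [in RHS]mxE [X in _ * X]mxE.
  rewrite [X in _ = _ * X]mxE; congr (_ * _).
  by rewrite !mxE; apply: eq_bigr => k' _; rewrite !mxE.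
have uA : gmx g p *m A^T \in unitmx by have [] := mulmx1_unit AG.
apply: (can_inj (mulmxK uA)); rewrite mul0mx mulmxA.
apply/rowP => i; rewrite [RHS]mxE -(zE i) /inner [LHS]mxE [RHS]mxE.
by apply: eq_bigr => k _; congr (_ * _); rewrite !mxE.
Qed.

End Frame.

Lemma orthonormal3_eq0 (R : realType) (M : manifold R 3) (g : metric M) p
    (a b c z : 'rV[R]_3) :
  inner g p a a = 1 -> inner g p b b = 1 -> inner g p c c = 1 ->
  inner g p a b = 0 -> inner g p a c = 0 -> inner g p b c = 0 ->
  inner g p z a = 0 -> inner g p z b = 0 -> inner g p z c = 0 -> z = 0.
Proof.
move=> aa bb cc ab ac bc za zb zc.
pose E (i : 'I_3) := tnth [tuple a; b; c] i.
have ba : inner g p b a = 0 by rewrite innerC.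
have ca : inner g p c a = 0 by rewrite innerC.
have cb : inner g p c b = 0 by rewrite innerC.
apply: (@orthonormal_unitmx R 3 M g p E).
  by do 2!(case; case=> [|[|[|//]]] ?); rewrite /E /tnth /=.
by case; case=> [|[|[|//]]] ?; rewrite /E /tnth /=.
Qed.

(** * Primitives of continuous functions on the whole line *)

Section Primitive.
Variables (R : realType) (f : R -> R).
Hypothesis cf : continuous f.
Let mu := @lebesgue_measure R.
Let I a x : R := (\int[mu]_(t in `[a, x]) f t)%R.

Let integrable_itv a b : mu.-integrable `[a, b] (EFin \o f).
Proof.
apply: continuous_compact_integrable; first exact: segment_compact.
by apply: continuous_subspaceT.
Qed.

Let I_split a b x : a <= b -> b <= x -> I a x = I a b + I b x.
Proof.
move=> ab bx; have := @Rintegral_itvB R f (BLeft a) (BRight x) b (integrable_itv a x).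
rewrite !bnd_simp => /(_ ab bx) H.
have E : (\int[mu]_(t in `]b, x]) f t)%R = I b x.
  apply: Rintegral_itv_obnd_cbnd.
  apply: integrableS (integrable_itv b x) => //.
  by apply: subset_itv; rewrite bnd_simp.
by rewrite -E -H /I addrC subrK.
Qed.

(** The base point lies to the left of both [x] and 0, so that only increasing intervals of
    integration occur; by additivity any base point further left gives the same value. *)
Let T x := I (- (`|x| + 1)) x - I (- (`|x| + 1)) 0.

Let TE a x : a <= - (`|x| + 1) -> T x = I a x - I a 0.
Proof.
move=> ax; have bx : - (`|x| + 1) <= x by have := ler_normr x (- x); case: (ger0P x) => *; lra.
have b0 : - (`|x| + 1) <= 0 by have := normr_ge0 x; lra.
rewrite (I_split ax bx) (I_split ax b0) /T; lra.
Qed.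

Lemma continuous_primitive : exists T : R -> R,
  (forall x : R, is_derive x 1 T (f x)) /\
  forall a b, a <= b -> (\int[mu]_(t in `[a, b]) f t)%R = T b - T a.
Proof.
exists T; split=> [x|a b ab].
  (* This base point serves all [y] at distance less than 1 from [x], so near [x] the primitive is a
     single integral up to a constant. *)
  pose a := - (`|x| + 2); pose u := x + 1.
  have xu : x < u by rewrite /u ltrDl.
  have ax : a < x by rewrite /a; case: (ger0P x) => *; lra.
  have [dI EI] := continuous_FTC1_closed xu (integrable_itv a u) ax (cf (x := x)).
  have dI' : is_derive x 1 (I a) (f x).
    exact: (DeriveDef dI (etrans (esym (derive1E _ _)) EI)).
  have dT : is_derive x 1 (fun y => I a y - I a 0) (f x).
    by rewrite -[f x]subr0; exact: (is_deriveB dI' (is_derive_cst (I a 0) x 1)).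
  apply: near_eq_is_derive dT.
  have : \forall y \near x, `|x - y| < 1.
    by apply/nbhs_normP; exists 1 => //=.
  apply: filterS => y xy; apply/esym/TE; rewrite /a.
  by move: xy; rewrite ltr_distl; case: (ger0P x); case: (ger0P y) => *; lra.
pose c := - (`|a| + `|b| + 1).
have ca : c <= - (`|a| + 1) by rewrite /c; have := normr_ge0 b; lra.
have cb : c <= - (`|b| + 1) by rewrite /c; have := normr_ge0 a; lra.
have ca' : c <= a by rewrite /c; have := normr_ge0 b; case: (ger0P a) => *; lra.
rewrite (TE ca) (TE cb) (I_split ca' ab) -/(I a b); lra.
Qed.

End Primitive.

(** * Periodic functions and rotations of the plane *)

Section Rotation.
Variable R : realType.

(** The values lie in an arbitrary type because membership in a periodic set, with values in [Prop],
    is also treated this way. *)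
Lemma periodic_int (T : Type) (f : R -> T) (p : R) : (forall x, f (x + p) = f x) ->
  forall (k : int) x, f (x + k%:~R * p) = f x.
Proof.
move=> fp; have fn (k : nat) x : f (x + k%:R * p) = f x.
  elim: k x => [|k IH] x; first by rewrite mul0r addr0.
  by rewrite -natr1 mulrDl mul1r addrA fp IH.
case=> k x; first by rewrite -[RHS](fn k).
by rewrite NegzE mulrNz mulNr -(fn k.+1) subrK.
Qed.

Lemma mod_period (p x : R) : 0 < p -> exists k : int, 0 <= x - k%:~R * p < p.
Proof.
move=> p0; exists (Num.floor (x / p)); apply/andP; split.
  by rewrite subr_ge0 -ler_pdivlMr // floor_le.
rewrite ltrBlDr -[X in X + _]mul1r -mulrDl -ltr_pdivrMr // addrC.
by have := floorD1_gt (x / p); rewrite intrD.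
Qed.

Lemma cosDint x (k : int) : cos (x + k%:~R * (2 * pi)) = cos x :> R.
Proof.
by apply: periodic_int => y; rewrite -[RHS]cosD2pi mulr_natl.
Qed.

Lemma sinDint x (k : int) : sin (x + k%:~R * (2 * pi)) = sin x :> R.
Proof.
by apply: periodic_int => y; rewrite -[RHS]sinD2pi mulr_natl.
Qed.

Lemma cos_eq1 (D : R) : cos D = 1 -> exists k : int, D = k%:~R * (2 * pi).
Proof.
move=> cD; have pi0 := pi_gt0 R; have p2 : 0 < 2 * pi :> R by rewrite mulr_gt0.
have [k /andP[r0 r2]] := mod_period D p2; exists k.
set r := D - _ in r0 r2.
have cr : cos r = 1 by rewrite -(cosDint r k) /r subrK.
have c0 : (0 : R) \in `[0, pi] by rewrite in_itv /= lexx ltW.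
suff : r = 0 by rewrite /r => /eqP; rewrite subr_eq0 => /eqP.
case: (leP r pi) => rpi.
  by apply: cos_inj; rewrite ?in_itv /= ?r0 ?rpi ?lexx ?(ltW pi0) // cos0.
suff : 2 * pi - r = 0 by move=> H; exfalso; move: r2; rewrite -subr_gt0 H ltxx.
apply: cos_inj; rewrite ?in_itv /= ?lexx ?(ltW pi0) //.
  by apply/andP; split; lra.
rewrite cos0 -[RHS]cr -[RHS]cosN -[RHS](cosDint (- r) 1).
by congr cos; rewrite mulr1z mul1r addrC.
Qed.

(** In complex notation the pair [X], [Y] of the proof is [exp (- i th) (x + i y)]; the differential
    equations say that its derivative is 0. *)
Lemma rotation_const (x y th tau : R -> R) :
  (forall t : R, is_derive t 1 x (- tau t * y t)) ->
  (forall t : R, is_derive t 1 y (tau t * x t)) ->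
  (forall t : R, is_derive t 1 th (tau t)) -> forall a b,
  x b = cos (th b - th a) * x a - sin (th b - th a) * y a /\
  y b = sin (th b - th a) * x a + cos (th b - th a) * y a.
Proof.
move=> dx dy dth a b.
pose X t := cos (th t) * x t + sin (th t) * y t.
pose Y t := cos (th t) * y t - sin (th t) * x t.
have dc (t : R) : is_derive t 1 (cos \o th) (- sin (th t) * tau t).
  exact: is_derive1_comp (is_derive_cos (th t)) (dth t).
have ds (t : R) : is_derive t 1 (sin \o th) (cos (th t) * tau t).
  exact: is_derive1_comp (is_derive_sin (th t)) (dth t).
have dX (t : R) : is_derive t 1 X 0.
  apply: is_derive_eq (is_deriveD (is_deriveM (dc t) (dx t)) (is_deriveM (ds t) (dy t))) _.
  by rewrite /GRing.scale /=; ring.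
have dY (t : R) : is_derive t 1 Y 0.
  apply: is_derive_eq (is_deriveB (is_deriveM (dc t) (dy t)) (is_deriveM (ds t) (dx t))) _.
  by rewrite /GRing.scale /=; ring.
have EX : X b = X a by apply: is_derive_0_is_cst.
have EY : Y b = Y a by apply: is_derive_0_is_cst.
have csb := cos2Dsin2 (th b).
rewrite cosB sinB; split.
  transitivity (cos (th b) * X b - sin (th b) * Y b); last first.
    by rewrite EX EY /X /Y; ring.
  by rewrite -[LHS]mul1r -csb /X /Y; ring.
transitivity (sin (th b) * X b + cos (th b) * Y b); last first.
  by rewrite EX EY /X /Y; ring.
by rewrite -[LHS]mul1r -csb /X /Y; ring.
Qed.

(* If [D = 2 k pi] with [k <> 0], the rotation angle passes through [pi] or
   [- pi], where [x] would be the opposite of its initial value. *)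
Lemma rotation_total_angle (x y th tau : R -> R) (l : R) : 0 < l ->
  (forall t : R, is_derive t 1 x (- tau t * y t)) ->
  (forall t : R, is_derive t 1 y (tau t * x t)) ->
  (forall t : R, is_derive t 1 th (tau t)) ->
  x 0 ^+ 2 + y 0 ^+ 2 = 1 -> x l = x 0 -> y l = y 0 ->
  (exists k : int, th l - th 0 = k%:~R * (2 * pi)) /\
  ((forall t, 0 < x t) -> th l - th 0 = 0).
Proof.
move=> l0 dx dy dth xy1 xl yl.
have rot := rotation_const dx dy dth 0.
have [k Ek] : exists k : int, th l - th 0 = k%:~R * (2 * pi).
  apply: cos_eq1; have [Hx Hy] := rot l; rewrite xl in Hx; rewrite yl in Hy.
  set c := cos _ in Hx Hy *; set s := sin _ in Hx Hy.
  (* [c] is the inner product of the unit vector [(x 0, y 0)] with its image under the rotation; by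
     periodicity that image is the vector itself. *)
  transitivity (c * (x 0 ^+ 2 + y 0 ^+ 2)); first by rewrite xy1 mulr1.
  transitivity (x 0 * (c * x 0 - s * y 0) + y 0 * (s * x 0 + c * y 0)).
    by ring.
  by rewrite -Hx -Hy -!expr2.
split=> [|xpos]; first by exists k.
have pi0 := pi_gt0 R.
suff k0 : k = 0 by rewrite Ek k0 mul0r.
apply: contrapT => /eqP k0.
have cth : {within `[0, l], continuous th}.
  apply: derivable_within_continuous => t _.
  by have [] := dth t.
have [v [vE vin]] : exists v, (v = pi \/ v = - pi) /\
    Num.min (th 0) (th l) <= th 0 + v <= Num.max (th 0) (th l).
  have El : th l = th 0 + k%:~R * (2 * pi) by rewrite -Ek addrC subrK.
  case: (ltgtP k 0) k0 => // k0 _.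
    exists (- pi); split; [by right|].
    have : k%:~R <= -1 :> R by rewrite -[-1]/((-1)%:~R) ler_int; lia.
    rewrite El => k1; have := ler_wpM2r (ltW pi0) k1.
    by rewrite ge_min le_max => H; apply/andP; split; apply/orP; [right|left]; lra.
  exists pi; split; [by left|].
  have : 1 <= k%:~R :> R by rewrite -[1]/(1%:~R) ler_int; lia.
  rewrite El => k1; have := ler_wpM2r (ltW pi0) k1.
  by rewrite ge_min le_max => H; apply/andP; split; apply/orP; [left|right]; lra.
have [t _ Et] := IVT (ltW l0) cth vin.
have [Hx _] := rot t; have x0 := xpos 0; have xt := xpos t.
move: Hx; rewrite Et addrAC subrr add0r.
by case: vE => ->; rewrite ?cosN ?sinN cospi sinpi; lra.
Qed.

End Rotation.

(** * Curves and frames *)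

Section FrenetCurve.
Variables (R : realType) (M : manifold R 3) (g : metric M).
Variables (l : R) (gamma : R -> M) (W : R -> 'rV[R]_3).
Hypotheses (gamma_closed : closed_curve l gamma)
  (gamma_unit : unit_speed g gamma) (gamma_frenet : frenet g gamma l W).

Local Notation T := (velocity gamma).
Local Notation A := (acceleration g gamma).
Local Notation P := (principal_normal g gamma).
Local Notation D := (Dt g gamma).
Local Notation "<< u , v >>_ t" := (inner g (gamma t) u v)
  (at level 0, t at level 0, format "<< u ,  v >>_ t").
Local Notation along := (smooth_along gamma setT).
Local Notation tau := (torsion g gamma W).

Let oT : open [set: R] := openT.
Let sg : smooth_into gamma setT := gamma_closed.1.
Let gp : forall t, gamma (t + l) = gamma t := gamma_closed.2.

Lemma smooth_along_velocity : along T.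
Proof. exact: smooth_along_push. Qed.

Lemma smooth_along_Dt Y : along Y -> along (D Y).
Proof. exact: smooth_along_covd. Qed.

Lemma smooth_along_acceleration : along A.
Proof. exact: smooth_along_Dt smooth_along_velocity. Qed.

Lemma curvature_gt0 t : 0 < curvature g gamma t.
Proof.
by rewrite /curvature /Defs.gnorm sqrtr_gt0; apply: inner_gt0; exact: gamma_frenet.1.
Qed.

Lemma smooth_along_principal_normal : along P.
Proof.
apply: smooth_alongZ => //; last exact: smooth_along_acceleration.
apply: smooth_onV => // [t _|]; first by rewrite gt_eqF // curvature_gt0.
apply: smooth_on_sqrt_comp => // [t _|]; first by apply: inner_gt0; exact: gamma_frenet.1.
by apply: smooth_on_inner => //; exact: smooth_along_acceleration.
Qed.

Lemma smooth_along_binormal : along W.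
Proof. exact: gamma_frenet.2.1. Qed.

Let sT := smooth_along_velocity.
Let sP := smooth_along_principal_normal.
Let sW := smooth_along_binormal.

Lemma is_derive_inner Y Z (t : R) : along Y -> along Z ->
  is_derive t 1 (fun s => << Y s, Z s >>_ s)
    (<< D Y t, Z t >>_ t + << Y t, D Z t >>_ t).
Proof.
move=> sY sZ; apply: DeriveDef.
  exact: smooth_on_derivable (smooth_on_inner g oT sg sY sZ) _.
exact: (derive_inner g oT sg 1 sY sZ).
Qed.

Lemma inner_cst Y Z (a : R) (t : R) : along Y -> along Z ->
  (forall s, << Y s, Z s >>_ s = a) ->
  << D Y t, Z t >>_ t + << Y t, D Z t >>_ t = 0.
Proof.
move=> sY sZ YZ; have [_ <-] := is_derive_inner t sY sZ.
have -> : (fun s => << Y s, Z s >>_ s) = cst a by apply/funext.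
exact: derive_cst.
Qed.

Lemma inner_cst_self Y (a : R) (t : R) : along Y ->
  (forall s, << Y s, Y s >>_ s = a) -> << D Y t, Y t >>_ t = 0.
Proof.
move=> sY YY; have := inner_cst t sY sY YY.
by rewrite [X in _ + X]innerC; lra.
Qed.

Lemma innerTT t : << T t, T t >>_ t = 1.
Proof. by apply/gnorm1P; exact: gamma_unit. Qed.

Lemma innerWW t : << W t, W t >>_ t = 1.
Proof. by apply/gnorm1P; exact: gamma_frenet.2.2.2.1. Qed.

Lemma innerWT t : << W t, T t >>_ t = 0.
Proof. exact: gamma_frenet.2.2.2.2.1. Qed.

Lemma innerWP t : << W t, P t >>_ t = 0.
Proof. exact: gamma_frenet.2.2.2.2.2.1. Qed.

Lemma innerAT t : << A t, T t >>_ t = 0.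
Proof. exact: inner_cst_self sT innerTT. Qed.

Lemma innerPT t : << P t, T t >>_ t = 0.
Proof. by rewrite innerZl innerAT mulr0. Qed.

Lemma innerPP t : << P t, P t >>_ t = 1.
Proof.
rewrite innerZl innerZr mulrA -invfM -expr2.
rewrite /curvature gnorm_sqr mulVf // gt_eqF //.
by apply: inner_gt0; exact: gamma_frenet.1.
Qed.

Lemma acceleration_principal_normal t : A t = curvature g gamma t *: P t.
Proof. by rewrite scalerA divff ?scale1r // gt_eqF // curvature_gt0. Qed.

(** [projH] removes components along [gamma'] and the principal normal, both orthogonal to [W]. Thus
    [D P] has [W] component [- tau], the sign that fixes in which direction normals turn. *)
Lemma torsionE t : tau t = - << D P t, W t >>_ t.
Proof.
rewrite /torsion /torsion_vector /projH -addrA -opprD innerNl innerDl innerNl.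
rewrite inner_lin2 [<< T t, _ >>_ t]innerC innerWT.
by rewrite [<< P t, _ >>_ t]innerC innerWP !mulr0 addr0 subr0.
Qed.

Lemma smooth_on_torsion : smooth_on setT tau.
Proof.
have E : tau = (fun t => - << D P t, W t >>_ t) by apply/funext => t; exact: torsionE.
rewrite E.
exact: (smooth_onN oT (smooth_on_inner g oT sg (smooth_along_Dt sP) sW)).
Qed.

Lemma inner_DPW t : << D P t, W t >>_ t = - tau t.
Proof. by rewrite torsionE opprK. Qed.

Lemma inner_DWP t : << D W t, P t >>_ t = tau t.
Proof.
have := inner_cst t sW sP innerWP.
by rewrite [X in _ + X]innerC inner_DPW => /eqP; rewrite subr_eq0 => /eqP.
Qed.

Lemma inner_DPP t : << D P t, P t >>_ t = 0.
Proof. exact: inner_cst_self sP innerPP. Qed.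

Lemma inner_DWW t : << D W t, W t >>_ t = 0.
Proof. exact: inner_cst_self sW innerWW. Qed.

Lemma frame_eq0 t z : << z, T t >>_ t = 0 -> << z, P t >>_ t = 0 ->
  << z, W t >>_ t = 0 -> z = 0.
Proof.
apply: (orthonormal3_eq0 (innerTT t) (innerPP t) (innerWW t)).
- by rewrite innerC innerPT.
- by rewrite innerC innerWT.
- by rewrite innerC innerWP.
Qed.

Lemma acceleration_periodic t : A (t + l) = A t.
Proof. exact: (Dt_periodic g gp t (velocity_periodic gp)). Qed.

Lemma principal_normal_periodic t : P (t + l) = P t.
Proof. by rewrite /principal_normal /curvature acceleration_periodic gp. Qed.

Lemma binormal_periodic t : W (t + l) = W t.
Proof. exact: gamma_frenet.2.2.1. Qed.

Lemma torsion_periodic t : tau (t + l) = tau t.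
Proof.
have E : D P (t + l) = D P t := Dt_periodic g gp t principal_normal_periodic.
by rewrite (torsionE (t + l)) (torsionE t) gp binormal_periodic E.
Qed.

Lemma torsion_primitive : exists th : R -> R,
  (forall t : R, is_derive t 1 th (tau t)) /\
  (forall a b, a <= b ->
     \int[lebesgue_measure]_(t in `[a, b]) tau t = th b - th a).
Proof.
apply: continuous_primitive => t.
exact: smooth_on_cont smooth_on_torsion _.
Qed.

Section NormalField.
Variable N : R -> 'rV[R]_3.
Hypotheses (sN : along N) (NN : forall t, << N t, N t >>_ t = 1)
  (NT : forall t, << N t, T t >>_ t = 0)
  (DN : forall t, exists a : R, D N t = a *: T t).

Let x t := << N t, P t >>_ t.
Let y t := << N t, W t >>_ t.

Lemma normal_expand t : N t = x t *: P t + y t *: W t.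
Proof.
apply/eqP; rewrite -subr_eq0; apply/eqP; apply: (@frame_eq0 t).
- by rewrite innerDl innerNl inner_lin2 NT innerPT innerWT; lra.
- by rewrite innerDl innerNl inner_lin2 innerPP innerWP /x; lra.
- rewrite innerDl innerNl inner_lin2 innerWW.
  by rewrite [<< P t, W t >>_ t]innerC innerWP /y; lra.
Qed.

Lemma normal_rotation :
  [/\ (forall t : R, is_derive t 1 x (- tau t * y t)),
      (forall t : R, is_derive t 1 y (tau t * x t)) &
      forall t, x t ^+ 2 + y t ^+ 2 = 1].
Proof.
split=> t.
- apply: is_derive_eq (is_derive_inner t sN sP) _; have [a ->] := DN t.
  rewrite innerZl [<< T t, _ >>_ t]innerC innerPT mulr0 add0r.
  rewrite {1}normal_expand inner_lin2 innerC inner_DPP innerC inner_DPW.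
  by ring.
- apply: is_derive_eq (is_derive_inner t sN sW) _; have [a ->] := DN t.
  rewrite innerZl [<< T t, _ >>_ t]innerC innerWT mulr0 add0r.
  rewrite {1}normal_expand inner_lin2 innerC inner_DWP.
  by rewrite [<< W t, _ >>_ t]innerC inner_DWW; ring.
- rewrite -(NN t) {1}normal_expand inner_lin2.
  by rewrite [<< P t, _ >>_ t]innerC [<< W t, _ >>_ t]innerC !expr2.
Qed.

End NormalField.

End FrenetCurve.

(** * Curves on surfaces *)

Section ExtMap.
Variables (R : realType) (n : nat) (M : manifold R n) (g : metric M).
Variables (V : normedModType R).

Lemma smooth_along_ext_map (U : set V) (F G : V -> M) (Y Z : V -> 'rV[R]_n) :
  open U -> smooth_into F U -> (forall x, U x -> F x = G x) ->
  (forall x, U x -> Y x = Z x) -> smooth_along F U Y -> smooth_along G U Z.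
Proof.
move=> oU sF FG YZ sY c ac.
have E : U `&` F @^-1` cdom c = U `&` G @^-1` cdom c.
  by apply/seteqP; split=> x [Ux]; rewrite /preimage /= FG.
rewrite -E; apply: smooth_on_ext (open_chart_dom oU sF c) _ (sY c ac) => x [Ux _].
by rewrite (FG _ Ux) (YZ _ Ux).
Qed.

Lemma smooth_along_local (U : set V) (F : V -> M) (Y : V -> 'rV[R]_n) :
  (forall x, U x -> exists2 U' : set V, U' x & smooth_along F U' Y) ->
  smooth_along F U Y.
Proof.
move=> H c ac; apply: smooth_on_local => x [Ux cx].
have [U' U'x sY] := H x Ux.
by exists (U' `&` F @^-1` cdom c); [split|exact: sY].
Qed.

Lemma covd_ext_map (U : set V) (F G : V -> M) (Y Z : V -> 'rV[R]_n) x v :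
  open U -> U x -> (forall x, U x -> F x = G x) ->
  (forall x, U x -> Y x = Z x) -> covd g F Y x v = covd g G Z x v.
Proof.
move=> oU Ux FG YZ; have E2 := push_ext oU v Ux FG.
rewrite /covd -(FG x Ux) -(YZ x Ux) -E2; pose c := chart_at (F x).
have E1 : 'D_v (fun y => in_chart c (F y) (Y y)) x =
    'D_v (fun y => in_chart c (G y) (Z y)) x.
  by apply: (derive_ext_open _ oU Ux) => y Uy; rewrite (FG y Uy) (YZ y Uy).
exact: (congr1 (fun t => t + chr g c (cmap c (F x)) (push F x v) (Y x)) E1).
Qed.

End ExtMap.

Section SurfaceCurve.
Variables (R : realType) (M : manifold R 3) (g : metric M).
Variables (l : R) (W : R -> 'rV[R]_3).
Variables (S : manifold R 2) (f : S -> M) (N : S -> 'rV[R]_3) (c : R -> S).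
Hypotheses (fi : immersion f) (fN : unit_normal g f N) (cc : closed_curve l c).
Local Notation gamma := (f \o c).
Hypotheses (gamma_closed : closed_curve l gamma)
  (gamma_unit : unit_speed g gamma) (gamma_frenet : frenet g gamma l W)
  (gamma_line : line_of_curvature g f N c).

Let oT : open [set: R] := openT.

Section At.
Variable t : R.
Let d := chart_at (c t).
Let F := f \o cinv d.
Let u := cmap d \o c.
Let U' := [set: R] `&` c @^-1` cdom d.
Let ad : atlas S d := chart_at_atlas _.
Let oU : open (ccod d) := @ccod_open _ _ _ d.
Let dct : cdom d (c t) := chart_at_dom _.
Let oU' : open U' := open_chart_dom oT cc.1 d.
Let su : smooth_on U' u := cc.1.2 d ad.
Let sF : smooth_into F (ccod d) := fi.1 d ad.
Let uU s : U' s -> ccod d (u s).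
Proof. by move=> [_ ds]; exact: cmap_cod. Qed.
Let U't : U' t := conj Logic.I dct.
Let Fu s : U' s -> (F \o u) s = gamma s.
Proof. by move=> [_ ds]; rewrite /F /u /= cmapK. Qed.
Let Nu s : U' s -> ((N \o cinv d) \o u) s = N (c s).
Proof. by move=> [_ ds]; rewrite /u /= cmapK. Qed.
Let sN : smooth_along F (ccod d) (N \o cinv d) := fN.1 d ad.

Lemma smooth_along_normal_at : smooth_along gamma U' (N \o c).
Proof.
apply: (smooth_along_ext_map oU' (smooth_into_comp oU sF oU' su uU) Fu Nu).
exact: (smooth_along_comp oU sF oU' su uU sN).
Qed.

Let v := 'D_1 u t.
Let du : derivable u t 1 := smooth_on_derivable su U't.

Let TE : velocity gamma t = push F (u t) v.
Proof.
rewrite /velocity -(push_ext oU' _ U't Fu).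
exact: (push_comp oU sF du (uU U't)).
Qed.

Let DNE : Dt g gamma (N \o c) t = covd g F (N \o cinv d) (u t) v.
Proof.
rewrite /Dt -(covd_ext_map g (1 : R) oU' U't Fu Nu).
exact: (covd_comp g oU sF sN du (uU U't)).
Qed.

Lemma normal_velocity : inner g (gamma t) (N (c t)) (velocity gamma t) = 0.
Proof. by rewrite TE; exact: (fN.2.2 (c t) v). Qed.

(** Convexity is tested on fields, so the velocity of [c] at [t] is extended off the curve by the
    field with constant components in the chart [d]. *)
Let X (q : S) : 'rV[R]_2 := of_chart d (cmap d q) v.

Let XE : X (c t) = v.
Proof. by rewrite -[LHS](in_chart_at (c t)) /X (of_chartK v ad dct). Qed.

Let smooth_X : smooth_field_near (c t) X.
Proof.
exists (cdom d); first by split=> //; exact: cdom_open.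
move=> c' ac' e ae.
set D := (X in smooth_on X).
have DE y : D y -> [/\ ccod c' y, cdom d (cinv c' y) & cdom e (cinv c' y)].
  by move=> [[]].
have oD : open D.
  have o1 : open (tdom c' d) by exact: open_tdom.
  apply: (open_setI_preimage o1 (@cdom_open _ _ _ e)) => y [cy _].
  exact: cinv_cont.
have oE : open (tdom d e) by exact: open_tdom.
have s1 : smooth_on D (trans c' d).
  apply: smooth_on_subset (smooth_trans ac' ad) => y /DE[? ? ?].
  by split.
have s2 : smooth_on (tdom d e) (fun z => v *m jac (trans d e) z).
  exact: (smooth_on_mulmx oE (smooth_on_cst _ v) (smooth_on_jac oE (smooth_trans ad ae))).
have DtE y : D y -> tdom d e (trans c' d y).
  by move=> /DE[? ? ?]; exact: tdom_cmap.
apply: smooth_on_ext oD _ (smooth_on_comp oD oE DtE s1 s2) => y /DE[? dy ey].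
rewrite (in_chart_trans _ ad ae dy ey) /X /=.
by rewrite (of_chartK v ad dy).
Qed.

(** [differential] refers to the preferred chart of each point; since [X] has constant components in
    [d], the image field is nevertheless the directional derivative of the single map [F]. *)
Let YE y : ccod d y -> push F y v = differential f (cinv d y) (X (cinv d y)).
Proof.
move=> dy; pose q := cinv d y; pose e := chart_at q.
have ae : atlas S e := chart_at_atlas _.
have eq : cdom e q := chart_at_dom _.
have tde : tdom d e y by split.
have oE : open (tdom d e) by exact: open_tdom.
have E1 : push F y v = push ((f \o cinv e) \o trans d e) y v.
  apply: (push_ext oE v tde) => z [dz ez].
  by rewrite /F /trans /= cmapK.
have dt : derivable (trans d e) y v.
  exact: smooth_on_derivable (smooth_trans ad ae) tde.
have E2 := push_comp (@ccod_open _ _ _ e) (fi.1 e ae) dt (cmap_cod eq).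
have RE : differential f q (X q) = push (f \o cinv e) (trans d e y) ('D_v (trans d e) y).
  rewrite /X /q (cinvK dy).
  exact (erefl (push (f \o cinv e) (trans d e y) ('D_v (trans d e) y))).
exact: (etrans E1 (etrans E2 (esym RE))).
Qed.

(** Differentiating [<Y, N> = 0] on the surface in the direction [v] moves the derivative from the
    tangent field to the normal, and the derivative of [N] in this direction is the one along the
    curve. *)
Let second_formE : second_form g f N X (c t) =
  - inner g (gamma t) (velocity gamma t) (Dt g gamma (N \o c) t).
Proof.
pose Y y := differential f (cinv d y) (X (cinv d y)).
have ut : ccod d (u t) := uU U't.
have sY : smooth_along F (ccod d) Y.
  have sp := smooth_along_push oU sF v.
  exact: (smooth_along_ext oU sF (Z := Y) YE sp).
have E := derive_inner g oU sF v sY sN ut.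
have Z : 'D_v (fun y => inner g (F y) (Y y) ((N \o cinv d) y)) (u t) = 0.
  rewrite -[RHS](derive_cst (0 : R) (u t) v).
  apply: (derive_ext_open _ oU ut) => y dy.
  by rewrite innerC; exact: fN.2.2.
have FE : F (u t) = gamma t := Fu U't.
have NE : (N \o cinv d) (u t) = N (c t) := Nu U't.
have YE' : Y (u t) = velocity gamma t by rewrite TE; exact: esym (YE ut).
rewrite Z FE NE YE' -DNE in E.
have SE : second_form g f N X (c t) = inner g (gamma t) (covd g F Y (u t) v) (N (c t)).
  exact: (congr1 (fun w => inner g (gamma t) (covd g F Y (u t) w) (N (c t))) XE).
rewrite SE; apply/eqP; rewrite -addr_eq0 eq_sym; apply/eqP; exact: E.
Qed.

Lemma convex_line : convex g f N ->
  inner g (gamma t) (velocity gamma t) (Dt g gamma (N \o c) t) < 0.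
Proof.
move=> cvx; rewrite -oppr_gt0 -second_formE; apply: cvx; first exact: smooth_X.
rewrite XE => v0; have := innerTT gamma_unit t.
rewrite TE v0 /push derive0 inner0l => /eqP.
by rewrite eq_sym oner_eq0.
Qed.

End At.

Let sN : smooth_along gamma setT (N \o c).
Proof.
apply: smooth_along_local => s _.
exists ([set: R] `&` c @^-1` cdom (chart_at (c s))).
  by split=> //; exact: chart_at_dom.
exact: smooth_along_normal_at.
Qed.

Let NN t : inner g (gamma t) (N (c t)) (N (c t)) = 1.
Proof. by apply/gnorm1P; exact: fN.2.1. Qed.

(** Differentiating [<N, gamma'> = 0] along the curve gives [<N, D gamma'> = - <D N, gamma'>],
    positive by convexity, and [D gamma'] is a positive multiple of the principal normal. *)
Lemma convex_inner_principal_normal t : convex g f N ->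
  0 < inner g (gamma t) (N (c t)) (principal_normal g gamma t).
Proof.
move=> cvx; have H := convex_line t cvx.
have sT : smooth_along gamma setT (velocity gamma).
  exact: smooth_along_velocity gamma_closed.
have := inner_cst gamma_closed t sN sT normal_velocity.
rewrite innerC -/(acceleration g gamma) => E.
have A0 : 0 < inner g (gamma t) (N (c t)) (acceleration g gamma t) by move: E H => /=; lra.
rewrite (acceleration_principal_normal gamma_frenet) innerZr in A0.
by move: A0; rewrite pmulr_rgt0 // (curvature_gt0 gamma_frenet).
Qed.

Lemma total_torsion_line_of_curvature : 0 < l ->
  (exists k : int,
     \int[lebesgue_measure]_(t in `[0, l]) torsion g gamma W t
       = k%:~R * (2 * pi)) /\
  (convex g f N ->
     \int[lebesgue_measure]_(t in `[0, l]) torsion g gamma W t = 0).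
Proof.
move=> l0.
have [th [dth Eth]] := torsion_primitive gamma_closed gamma_frenet.
have [dx dy xy] := normal_rotation gamma_closed gamma_unit gamma_frenet
  sN NN normal_velocity gamma_line.
have cl : c l = c 0 by rewrite -[in LHS](add0r l) cc.2.
have EP := principal_normal_periodic g gamma_closed 0; rewrite add0r in EP.
have EW := binormal_periodic gamma_frenet 0; rewrite add0r in EW.
have xl : inner g (gamma l) (N (c l)) (principal_normal g gamma l) =
  inner g (gamma 0) (N (c 0)) (principal_normal g gamma 0) by rewrite EP /= cl.
have yl : inner g (gamma l) (N (c l)) (W l) = inner g (gamma 0) (N (c 0)) (W 0).
  by rewrite EW /= cl.
have [H1 H2] := rotation_total_angle l0 dx dy dth (xy 0) xl yl.
have E := Eth 0 l (ltW l0); split.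
  by have [k Ek] := H1; exists k; exact: (etrans E Ek).
move=> cvx; apply: (etrans E).
exact: (H2 (fun t => convex_inner_principal_normal t cvx)).
Qed.

End SurfaceCurve.

(** * Periodic bump functions *)

Section FlatFunctions.
Variable R : realType.
Implicit Types (p : {poly R}) (x u : R).

(** Each power satisfies [u ^ i <= i! exp u] for [u >= 0], by the exponential series; the constant
    weights the coefficients with these factorials. *)
Lemma horner_le_expR p : exists C : R, forall u, 0 <= u -> `|p.[u]| <= C * expR u.
Proof.
exists (\sum_(i < size p) `|p`_i| * (i`!)%:R) => u u0.
rewrite horner_coef (le_trans (ler_norm_sum _ _ _)) // mulr_suml.
apply: ler_sum => i _; rewrite normrM -mulrA ler_wpM2l //.
rewrite ger0_norm ?exprn_ge0 //; case: (nat_of_ord i) => [|j].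
  by rewrite expr0 mul1r (le_trans _ (expR_ge1Dx u)) // lerDl.
rewrite -ler_pdivrMl ?ltr0n ?fact_gt0 // mulrC.
by apply: le_trans (expR_ge1Dxn j u0); rewrite lerDr.
Qed.

(* These functions are closed under derivation, hence smooth. *)
Definition flat p x : R := if 0 < x then p.[x^-1] * expR (- x^-1) else 0.

(** The exponent 2 makes the difference quotient of [flat p] at 0 tend to 0; it comes from applying
    the exponential bound to ['X^2 * p]. *)
Lemma flat_le p : exists C : R, forall x, `|flat p x| <= C * x ^+ 2.
Proof.
have [C HC] := horner_le_expR ('X^2 * p); exists `|C| => x.
rewrite /flat; case: ifP => [x0|_]; last by rewrite normr0 mulr_ge0 // sqr_ge0.
have u0 : 0 <= x^-1 by rewrite invr_ge0 ltW.
have := HC _ u0; rewrite hornerM hornerXn normrM [`|x^-1 ^+ 2|]ger0_norm ?exprn_ge0 // => H.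
rewrite normrM [`|expR _|]ger0_norm ?expR_ge0 // expRN ler_pdivrMr ?expR_gt0 //.
have {}H : `|p.[x^-1]| <= C * expR x^-1 * x ^+ 2.
  by rewrite -ler_pdivrMr ?exprn_gt0 // mulrC -exprVn.
apply: (le_trans H); rewrite -mulrA [X in _ * X]mulrC mulrA ler_wpM2r ?expR_ge0 //.
by rewrite ler_wpM2r ?sqr_ge0 // ler_norm.
Qed.

(** With [u = 1 / x], the derivative of [p(u) exp(-u)] with respect to [x] is
    [u^2 (p(u) - p'(u)) exp(-u)]. At 0 the quadratic bound takes over. *)
Lemma is_derive_flat p x :
  is_derive x (1 : R) (flat p) (flat ('X^2 * (p - p^`())) x).
Proof.
have [x0|x0|->] := ltgtP x 0.
- have E : flat ('X^2 * (p - p^`())) x = 0 by rewrite /flat ltNge ltW.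
  rewrite E; apply: near_eq_is_derive (is_derive_cst (0 : R) x 1).
  have : \forall y \near x, y < 0 by apply: open_near => //; exact: open_lt.
  by apply: filterS => y y0; rewrite /flat ltNge ltW.
- have xn0 : x != 0 by rewrite gt_eqF.
  have E : flat ('X^2 * (p - p^`())) x =
     (x^-1) ^+ 2 * (p.[x^-1] - p^`().[x^-1]) * expR (- x^-1).
    by rewrite /flat x0 hornerM hornerXn !hornerE.
  rewrite E.
  have dV : is_derive x (1 : R) (fun y : R => y^-1) (- (x^-1) ^+ 2).
    apply: DeriveDef; first by apply: derivableV => //; exact: derivable_id.
    apply: (etrans (deriveV (f := @id R) xn0 (@derivable_id _ _ x (1 : R)))).
    by rewrite derive_id exprVn; exact: mulr1.
  have dVN : is_derive x (1 : R) (fun y : R => - y^-1) ((x^-1) ^+ 2).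
    by rewrite -[X in is_derive _ _ _ X]opprK; exact: is_deriveN dV.
  have dp : is_derive (x^-1) (1 : R) (horner p) (p^`().[x^-1]).
    apply: DeriveDef; first exact: derivable_horner.
    by rewrite -derive1E -derivE.
  have d1 := is_derive1_comp dp dV.
  have d2 := @is_derive1_comp R (@expR R) (fun y : R => - y^-1) x _ _ (is_derive_expR (- x^-1)) dVN.
  have d := is_deriveM d1 d2.
  apply: near_eq_is_derive (is_derive_eq d _).
    have : \forall y \near x, 0 < y by apply: open_near => //; exact: open_gt.
    by apply: filterS => y y0; rewrite /flat y0.
  by rewrite /GRing.scale /=; ring.
- have E : flat ('X^2 * (p - p^`())) 0 = 0 by rewrite /flat ltxx.
  rewrite E; have [C HC] := flat_le p.
  have f0 : flat p 0 = 0 by rewrite /flat ltxx.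
  have L : (fun h : R => h^-1 *: ((flat p \o shift 0) (h *: 1) - flat p 0)) h
      @[h --> 0^'] --> (0 : R).
    apply/cvgr0Pnorm_le => e e0.
    near=> h; have h0 : h != 0 by near: h; exact: nbhs_dnbhs_neq.
    rewrite /= addr0 f0 subr0 [h *: 1]mulr1 normrM.
    apply: (@le_trans _ _ (`|h^-1| * (`|C| * h ^+ 2))).
      by rewrite ler_wpM2l // (le_trans (HC h)) // ler_wpM2r ?sqr_ge0 // ler_norm.
    have hC : `|h| <= e / (`|C| + 1).
      by near: h; apply: dnbhs0_le; rewrite divr_gt0 // ltr_wpDl.
    rewrite -[h ^+ 2]ger0_norm ?sqr_ge0 // normrX expr2 normfV mulrCA mulKf ?normr_eq0 //.
    have C1 : 0 < `|C| + 1 by rewrite ltr_wpDl.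
    move: hC; rewrite ler_pdivlMr // => hC; apply: le_trans hC.
    by rewrite mulrC ler_wpM2l // lerDl.
  apply: DeriveDef; first by apply/cvg_ex; exists 0; exact: L.
  exact: (cvg_lim _ L).
Unshelve. all: by end_near. Qed.

Lemma smooth_on_flat p : smooth_on setT (flat p).
Proof.
move=> k; elim: k p => [|k IH] p.
  split=> // x _; apply/differentiable_continuous/derivable1_diffP.
  by have [] := is_derive_flat p x.
apply: (Ck_on_primitive openT _ (IH ('X^2 * (p - p^`())))) => x _.
exact: is_derive_flat.
Qed.

Lemma flat1_gt0 x : 0 < x -> 0 < flat 1 x.
Proof. by move=> x0; rewrite /flat x0 hornerC mul1r expR_gt0. Qed.

Lemma flat_eq0 p x : x <= 0 -> flat p x = 0.
Proof. by rewrite /flat ltNge => ->. Qed.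

Lemma flat1_ge0 x : 0 <= flat 1 x.
Proof. by have [/flat_eq0->//|/flat1_gt0/ltW] := leP x 0. Qed.

End FlatFunctions.

Section PeriodicBump.
Variables (R : realType) (l : R).
Hypothesis l0 : 0 < l.

Definition freq : R := 2 * pi / l.

Lemma freq_gt0 : 0 < freq.
Proof. by rewrite divr_gt0 // mulr_gt0 // pi_gt0. Qed.

Lemma freqM : freq * l = 2 * pi.
Proof. by rewrite /freq divfK // gt_eqF. Qed.

Lemma cos_freqD x : cos (freq * (x + l)) = cos (freq * x).
Proof. by rewrite mulrDr freqM -[RHS](cosDint _ 1) mulr1z mul1r. Qed.

Lemma sin_freqD x : sin (freq * (x + l)) = sin (freq * x).
Proof. by rewrite mulrDr freqM -[RHS](sinDint _ 1) mulr1z mul1r. Qed.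

Lemma cos_freqB x : cos (freq * (l - x)) = cos (freq * x).
Proof. by rewrite addrC cos_freqD mulrN cosN. Qed.

Lemma cos_freq_le (a b : R) : 0 <= a <= l / 2 -> 0 <= b <= l / 2 ->
  cos (freq * b) <= cos (freq * a) -> a <= b.
Proof.
have w0 := freq_gt0; have wl : freq * (l / 2) = pi.
  by rewrite mulrA freqM mulrAC divff // mul1r.
have H (x : R) : 0 <= x <= l / 2 -> freq * x \in `[0, pi].
  move=> /andP[x0 xl]; rewrite in_itv /= mulr_ge0 ?(ltW w0) //=.
  by rewrite -wl ler_wpM2l // ltW.
move=> /H Ha /H Hb; rewrite leNgt => ba; rewrite leNgt; apply/negP => ab.
move: ba; rewrite ltr_cos //.
by rewrite ltr_pM2l // ab.
Qed.

(** [cos (freq * t)] is a smooth substitute for the distance on the circle of length [l]: values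
    close to the maximum 1 confine [t] to a neighbourhood of the multiples of [l]. *)
Lemma cos_freq_near (d : R) : 0 < d -> exists2 eta : R, eta < 1 &
  forall t, eta <= cos (freq * t) -> exists k : int, `|t - k%:~R * l| < d.
Proof.
move=> d0; have l2 : 0 < l / 2 by rewrite divr_gt0.
(* [d / 2] makes the final inequality strict; [l / 2] ends the interval on which the cosine
   decreases. *)
pose e := Num.min (d / 2) (l / 2).
have e0 : 0 < e by rewrite /e lt_min divr_gt0.
have el : e <= l / 2 by rewrite /e ge_min lexx orbT.
have ed : e < d.
  by rewrite /e; apply: (@le_lt_trans _ _ (d / 2)); [rewrite ge_min lexx|lra].
have eI : 0 <= e <= l / 2 by rewrite (ltW e0).
exists (cos (freq * e)).
  rewrite lt_neqAle cos_le1 andbT; apply/eqP => ce.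
  have : e <= 0.
    by apply: cos_freq_le => //; rewrite ?lexx ?(ltW l2) // ce mulr0 cos0.
  by rewrite leNgt e0.
move=> t ht; have [k /andP[r0 rl]] := mod_period t l0.
pose r := t - k%:~R * l.
have cr : cos (freq * r) = cos (freq * t).
  have P := @periodic_int R R (fun x => cos (freq * x)) l cos_freqD.
  by rewrite -[RHS](P (- k)) /r mulrNz mulNr.
case: (leP r (l / 2)) => rl2.
  exists k; rewrite -/r ger0_norm //.
  apply: le_lt_trans ed; apply: cos_freq_le => //; last by rewrite cr.
  by rewrite r0.
exists (k + 1); rewrite intrD mulrDl mul1r opprD addrA -/r distrC.
have lr : 0 <= l - r by rewrite subr_ge0 ltW.
rewrite ger0_norm //; apply: le_lt_trans ed; apply: cos_freq_le => //.
  by apply/andP; split=> //; lra.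
by rewrite cos_freqB cr.
Qed.

(** Passing through the cosine makes the bump smooth and [l]-periodic on the whole line at once,
    with no translates to glue. *)
Definition cos_bump (t0 eta t : R) : R := flat 1 (cos (freq * (t - t0)) - eta).

Lemma bump_ge0 t0 eta t : 0 <= cos_bump t0 eta t.
Proof. exact: flat1_ge0. Qed.

Lemma bump_gt0 t0 eta t : eta < cos (freq * (t - t0)) -> 0 < cos_bump t0 eta t.
Proof. by move=> H; apply: flat1_gt0; rewrite subr_gt0. Qed.

Lemma bump_eq0 t0 eta t : cos (freq * (t - t0)) <= eta -> cos_bump t0 eta t = 0.
Proof. by move=> H; apply: flat_eq0; rewrite subr_le0. Qed.

Lemma bumpD t0 eta t : cos_bump t0 eta (t + l) = cos_bump t0 eta t.
Proof. by rewrite /cos_bump addrAC cos_freqD. Qed.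

Lemma smooth_cos_freq (V : normedModType R) (U : set V) (f : V -> R) t0 :
  open U -> smooth_on U f -> smooth_on U (fun x => cos (freq * (f x - t0))).
Proof.
move=> oU sf; apply: smooth_on_cos => //; apply: smooth_onZ => //.
by apply: smooth_onB => //; exact: smooth_on_cst.
Qed.

Lemma smooth_bump (V : normedModType R) (U : set V) (f : V -> R) t0 eta :
  open U -> smooth_on U f -> smooth_on U (fun x => cos_bump t0 eta (f x)).
Proof.
move=> oU sf.
have s1 : smooth_on U (fun x => cos (freq * (f x - t0)) - eta).
  by apply: smooth_onB => //; [exact: smooth_cos_freq|exact: smooth_on_cst].
exact: (smooth_on_comp_realR oU openT (fun _ _ => Logic.I) s1 (smooth_on_flat 1)).
Qed.

End PeriodicBump.

Section Cover.
Variables (R : realType) (l : R) (n : nat) (M : manifold R n) (gamma : R -> M).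
Hypotheses (l0 : 0 < l) (cg : continuous gamma)
  (gp : forall t, gamma (t + l) = gamma t).

Lemma chart_threshold t0 : exists2 eta : R, eta < 1 &
  forall t, eta <= cos (freq l * (t - t0)) ->
    cdom (chart_at (gamma t0)) (gamma t).
Proof.
have : \forall t \near t0, cdom (chart_at (gamma t0)) (gamma t).
  apply: cg; apply: open_near; first exact: cdom_open.
  exact: chart_at_dom.
move=> /near_ballP[d d0 Hd]; have [eta e1 He] := cos_freq_near l0 d0.
exists eta => // t /He[k hk].
have := Hd _ hk; congr cdom.
rewrite -(periodic_int gp k); congr gamma.
by rewrite addrAC subrK subrK.
Qed.

(** Compactness of one period. The first inequality is not strict: the times at which [gamma] is
    required to be in the chart form a closed set, and the bump vanishes on its open complement. The
    second is strict: at every [t] some bump is positive. *)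
Lemma chart_cover : exists (s : seq R) (eta : R -> R),
  (forall t0 t, eta t0 <= cos (freq l * (t - t0)) ->
    cdom (chart_at (gamma t0)) (gamma t)) /\
  forall t, exists2 t0, t0 \in s & eta t0 < cos (freq l * (t - t0)).
Proof.
pose eta t0 := projT1 (cid2 (chart_threshold t0)).
have eta1 t0 : eta t0 < 1 by rewrite /eta; case: (cid2 _).
have Heta t0 t : eta t0 <= cos (freq l * (t - t0)) ->
    cdom (chart_at (gamma t0)) (gamma t).
  by rewrite /eta; case: (cid2 _) => /= e _; apply.
pose O t0 : set R := [set t | eta t0 < cos (freq l * (t - t0))].
have oO t0 : [set: R] t0 -> open (O t0).
  move=> _; have -> : O t0 = [set: R] `&`
      (fun t => cos (freq l * (t - t0))) @^-1` [set x | eta t0 < x].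
    by rewrite setTI.
  apply: open_setI_preimage; [exact: openT|exact: open_gt|move=> t _].
  exact: smooth_on_cont (smooth_cos_freq l t0 openT (smooth_on_id _)) _.
have := @segment_compact R 0 l; rewrite compact_cover.
move=> /(_ R [set: R] O oO)[|D _ HD].
  by move=> t _; exists t => //; rewrite /O /= subrr mulr0 cos0.
exists (finmap.enum_fset D), eta; split=> // t.
have [k /andP[r0 rl]] := mod_period t l0.
have [|t0 Dt0 Ot0] := HD (t - k%:~R * l); first by rewrite /= in_itv /= r0 ltW.
exists t0 => //; move: Ot0; rewrite /O /= addrAC.
have P := @periodic_int R R (fun x => cos (freq l * x)) l (cos_freqD l0).
by rewrite -mulNr -mulrNz P.
Qed.

End Cover.

(** * Tubular maps *)

Lemma smooth_into_cinv (R : realType) n (M : manifold R n) (V : normedModType R)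
    (U : set V) (H : V -> 'rV[R]_n) (c : chart R n M) : open U -> atlas M c ->
  (forall x, U x -> ccod c (H x)) -> smooth_on U H ->
  smooth_into (cinv c \o H : V -> M) U.
Proof.
move=> oU ac HU sH.
have cH x : U x -> {for x, continuous (cinv c \o H)}.
  move=> Ux; apply: continuous_comp; first exact: smooth_on_cont sH Ux.
  exact: cinv_cont (HU _ Ux).
split=> // d ad.
have oD : open (U `&` (cinv c \o H) @^-1` cdom d).
  exact: open_setI_preimage oU (@cdom_open _ _ _ d) cH.
have oT : open (tdom c d) by exact: open_tdom.
apply: (smooth_on_comp oD oT _ _ (smooth_trans ac ad)).
  by move=> x [Ux dx]; split=> //; exact: HU.
exact: smooth_on_subset (@subIsetl _ _ _) sH.
Qed.

Lemma derive_scale_line (R : realType) (W : normedModType R) (w : W) (t : R) :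
  is_derive t (1 : R) (fun h : R => h *: w) w.
Proof.
have d : differentiable (fun h : R => h *: w) t.
  apply: differentiableZl; apply/derivable1_diffP; exact: derivable_id.
apply: DeriveDef; first exact: diff_derivable.
rewrite (deriveE _ d).
have [_ ->] := is_diff_scalel t w.
by rewrite scale1r.
Qed.

Lemma derive_cst_line (R : realType) (V W : normedModType R) (f : V -> W) x v :
  (forall h : R, f (h *: v + x) = f x) -> 'D_v f x = 0.
Proof.
move=> fx; rewrite /derive.
have -> : (fun h : R => h^-1 *: ((f \o shift x) (h *: v) - f x)) = cst 0.
  by apply/funext => h /=; rewrite fx subrr scaler0.
exact: (cvg_lim (@norm_hausdorff _ _) (cvg_cst 0)).
Qed.

Section Tubular.
Variables (R : realType) (n k : nat) (M : manifold R n) (l : R) (gamma : R -> M).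
Hypotheses (l0 : 0 < l) (sg : smooth_into gamma setT)
  (gp : forall t, gamma (t + l) = gamma t).
Variable B : 'I_k -> R -> 'rV[R]_n.
Hypotheses (sB : forall j, smooth_along gamma setT (B j))
  (Bp : forall j t, B j (t + l) = B j t).

Local Notation V := ('rV[R]_k.+1).
Local Notation e0 := (delta_mx ord0 ord0 : V).
Local Notation ej j := (delta_mx ord0 (lift ord0 j) : V).

(** Coordinate 0 is the parameter of the curve, the others are transverse. Only [mu >= 0] is asked
    because the induction starts from a map constant in the transverse directions, with [mu = 0];
    each step adds a bump to [mu]. *)
Definition tubular (G : V -> M) (Om : set V) (mu : R -> R) : Prop :=
  [/\ open Om, forall x, Om (x + l *: e0) = Om x, forall t, Om (t *: e0)
    & smooth_into G Om] /\
  [/\ forall x, G (x + l *: e0) = G x, forall t, G (t *: e0) = gamma t,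
      forall t, 0 <= mu t &
      forall j t, push G (t *: e0) (ej j) = mu t *: B j t].

Let shift0 (x : V) : (x + l *: e0) ord0 ord0 = x ord0 ord0 + l.
Proof. by rewrite !mxE eqxx mulr1. Qed.

Let shiftj (x : V) j : (x + l *: e0) ord0 (lift ord0 j) = x ord0 (lift ord0 j).
Proof. by rewrite !mxE /= mulr0 addr0. Qed.

Let axis0 t : (t *: e0) ord0 ord0 = t.
Proof. by rewrite !mxE eqxx mulr1. Qed.

Let axisj t j : (t *: e0) ord0 (lift ord0 j) = 0.
Proof. by rewrite !mxE /= mulr0. Qed.

Let smooth_coord (U : set V) i : open U -> smooth_on U (fun x : V => x ord0 i).
Proof. by move=> oU; exact: (smooth_on_entry oU ord0 i (smooth_on_id _)). Qed.

Let oT : open [set: R] := openT.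

Lemma tubular_init :
  tubular (fun x => gamma (x ord0 ord0)) setT (fun=> 0).
Proof.
have oV : open [set: V] := openT.
split; split=> //.
- split=> [x _|c ac].
    apply: continuous_comp; first exact: coord_continuous.
    exact: sg.1.
  have oc := open_chart_dom oT sg c.
  have oc' : open ([set: V] `&` (fun x : V => gamma (x ord0 ord0)) @^-1` cdom c).
    apply: open_setI_preimage oV (@cdom_open _ _ _ c) _ => x _.
    apply: continuous_comp; first exact: coord_continuous.
    exact: sg.1.
  apply: (smooth_on_comp_real oc' oc _ (smooth_coord ord0 oc') (sg.2 c ac)).
  by move=> x [_].
- by move=> x; rewrite shift0.
- by move=> t; rewrite axis0.
move=> j t; rewrite scale0r /push.
apply: derive_cst_line => h /=.
by rewrite !mxE /= mulr0 add0r.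
Qed.

Section Step.
Variables (G : V -> M) (Om : set V) (mu : R -> R).
Hypothesis tG : tubular G Om mu.
Variables (c : chart R n M) (t0 eta : R).
Hypotheses (ac : atlas M c)
  (Hc : forall t, eta <= cos (freq l * (t - t0)) -> cdom c (gamma t)).

Let oOm : open Om. Proof. by case: tG => -[]. Qed.
Let Omp x : Om (x + l *: e0) = Om x. Proof. by case: tG => -[]. Qed.
Let Om0 t : Om (t *: e0). Proof. by case: tG => -[]. Qed.
Let sG : smooth_into G Om. Proof. by case: tG => -[]. Qed.
Let Gp x : G (x + l *: e0) = G x. Proof. by case: tG => _ []. Qed.
Let G0 t : G (t *: e0) = gamma t. Proof. by case: tG => _ []. Qed.
Let mu0 t : 0 <= mu t. Proof. by case: tG => _ []. Qed.
Let pG j t : push G (t *: e0) (ej j) = mu t *: B j t.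
Proof. by case: tG => _ []. Qed.

Let phi t := cos_bump l t0 eta t.
Let b j t := in_chart c (gamma t) (B j t).
Let E (x : V) := \sum_j x ord0 (lift ord0 j) *: b j (x ord0 ord0).
(** [E] vanishes on the axis, so the push does not move the curve. *)
Let H (x : V) := cmap c (G x) + phi (x ord0 ord0) *: E x.
Let I := [set: R] `&` gamma @^-1` cdom c.
Let O := (Om `&` G @^-1` cdom c) `&` (fun x : V => x ord0 ord0) @^-1` I.
Let Om2 := O `&` H @^-1` ccod c.
Let Om1 := Om `&` (fun x : V => cos (freq l * (x ord0 ord0 - t0))) @^-1` [set z | z < eta].
(** The bump vanishes on the open set [Om1]; on [Om2] the pushed point is still in the range of the
    chart. Where the bump vanishes on [Om2], the chart formula gives [G x] again, so the map is
    smooth on the union, which contains the axis. *)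
Let G' (x : V) := if phi (x ord0 ord0) == 0 then G x else cinv c (H x).

Let oI : open I. Proof. exact: open_chart_dom oT sg c. Qed.

Let oO : open O.
Proof.
apply: (open_setI_preimage (f := fun x : V => x ord0 ord0)
  (open_chart_dom oOm sG c) oI) => x _.
exact: coord_continuous.
Qed.

Let sH : smooth_on O H.
Proof.
apply: smooth_onD => //.
  by apply: smooth_on_subset (sG.2 c ac) => x [].
apply: smooth_on_scale => //.
  exact: (smooth_bump l t0 eta oO (smooth_coord ord0 oO)).
apply: smooth_on_sum => // j.
apply: smooth_on_scale => //; first exact: smooth_coord.
have OI x : O x -> I (x ord0 ord0) by move=> [].
exact: (smooth_on_comp_real oO oI OI (smooth_coord ord0 oO) (sB j ac)).
Qed.

Let oOm2 : open Om2.
Proof.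
apply: (open_setI_preimage (f := H) oO (@ccod_open _ _ _ c)) => x Ox.
exact: smooth_on_cont sH Ox.
Qed.

Let oOm1 : open Om1.
Proof.
apply: (open_setI_preimage (f := fun x : V => cos (freq l * (x ord0 ord0 - t0)))
  oOm (@open_lt _ eta)) => x _.
have sc := smooth_cos_freq l t0 openT (smooth_coord ord0 openT).
exact: smooth_on_cont sc _.
Qed.

Let G'1 x : Om1 x -> G' x = G x.
Proof. by move=> [_ xe]; rewrite /G' /phi bump_eq0 ?eqxx // ltW. Qed.

Let G'2 x : Om2 x -> G' x = cinv c (H x).
Proof.
move=> [[[_ Gx] _] _]; rewrite /G'; case: eqP => // p0.
by rewrite /H p0 scale0r addr0 cmapK.
Qed.

Let sG' : smooth_into G' (Om1 `|` Om2).
Proof.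
apply: smooth_into_local => x [x1|x2].
  exists Om1; first by [].
  have s1 : smooth_into G Om1 by apply: smooth_into_subset sG => y [].
  exact: (smooth_into_ext oOm1 (fun y y1 => esym (G'1 y1)) s1).
exists Om2; first by [].
have sH2 : smooth_on Om2 H by apply: smooth_on_subset sH => y [].
have s2 := smooth_into_cinv oOm2 ac (fun y (y2 : Om2 y) => y2.2) sH2.
exact: (smooth_into_ext oOm2 (fun y y2 => esym (G'2 y2)) s2).
Qed.

Let E0 t : E (t *: e0) = 0.
Proof. by rewrite /E big1 // => j _; rewrite axisj scale0r. Qed.

Let Om12 t : Om1 (t *: e0) \/ Om2 (t *: e0).
Proof.
have [ct|ct] := ltP (cos (freq l * (t - t0))) eta.
  by left; split=> //; rewrite /preimage /= axis0.
right; have gc := Hc ct.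
have Ot : O (t *: e0).
  by split; [split=> //; rewrite /preimage /= G0|rewrite /I /preimage /= axis0].
split=> //; rewrite /preimage /H /= E0 scaler0 addr0 G0.
exact: cmap_cod.
Qed.

Let push1 j t : Om1 (t *: e0) ->
  push G' (t *: e0) (ej j) = (mu t + phi t) *: B j t.
Proof.
move=> t1; have [_] := t1; rewrite /preimage /= axis0 => /ltW ct.
rewrite (push_ext oOm1 (ej j) t1 G'1) pG.
by rewrite /phi bump_eq0 // addr0.
Qed.

Let push2 j t : Om2 (t *: e0) ->
  push G' (t *: e0) (ej j) = (mu t + phi t) *: B j t.
Proof.
move=> t2; have [[[Omt Gt] It] _] := t2.
have G't : G' (t *: e0) = gamma t by rewrite G'2 // /H E0 scaler0 addr0 cmapK.
have ct : cdom c (gamma t) by rewrite -G0.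
have oU : open (Om1 `|` Om2) by exact: openU.
have Ut : (Om1 `|` Om2) (t *: e0) by right.
have cGt : cdom c (G' (t *: e0)) by rewrite G't.
have HP := in_chart_push oU sG' (ej j) ac Ut cGt; rewrite G't in HP.
apply: (in_chart_inj ac ct); rewrite HP (in_chartZ _ _ ac ct) scalerDl.
have HL : 'D_(ej j) (cmap c \o G') (t *: e0) = 'D_(ej j) H (t *: e0).
  apply: (derive_ext_open _ oOm2 t2) => x x2 /=.
  by rewrite G'2 // cinvK //; exact: x2.2.
rewrite HL.
have dH : derivable H (t *: e0) (ej j).
  by apply: smooth_on_derivable sH _; split.
have dG : derivable (cmap c \o G) (t *: e0) (ej j).
  by apply: smooth_on_derivable (sG.2 c ac) _; split.
rewrite (derive_line dH).
(* Moving along [ej j] keeps coordinate 0 equal to [t], so the bump and the vectors [b] do not vary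
   and the pushed term is exactly linear in [h]. *)
have -> : (fun h : R => H (h *: ej j + t *: e0)) =
    (fun h : R => (cmap c \o G) (h *: ej j + t *: e0) + h *: (phi t *: b j t)).
  apply/funext => h; rewrite /H /=; congr (_ + _).
  have -> : (h *: ej j + t *: e0) ord0 ord0 = t by rewrite !mxE /= mulr0 add0r mulr1.
  rewrite /E (bigD1 j) //= big1 ?addr0 => [|i ij].
    have -> : (h *: ej j + t *: e0) ord0 ord0 = t by rewrite !mxE /= mulr0 add0r mulr1.
    have -> : (h *: ej j + t *: e0) ord0 (lift ord0 j) = h.
      by rewrite !mxE !eqxx /= mulr0 addr0 mulr1.
    by rewrite scalerA mulrC -scalerA.
  have -> : (h *: ej j + t *: e0) ord0 (lift ord0 i) = 0.
    by rewrite !mxE /= (inj_eq lift_inj) (negbTE ij) !mulr0 addr0.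
  by rewrite scale0r.
have dl : is_derive (0 : R) 1 (fun h : R => (cmap c \o G) (h *: ej j + t *: e0))
    ('D_(ej j) (cmap c \o G) (t *: e0)).
  have [|d1 d2] := @derivable_line R V 'rV[R]_n (cmap c \o G) (t *: e0) (ej j) 0.
    by rewrite scale0r add0r.
  by apply: (DeriveDef d1); rewrite d2 scale0r add0r.
have [_ ->] := is_deriveD dl (derive_scale_line (phi t *: b j t) 0).
have Gt' : cdom c (G (t *: e0)) by [].
have := in_chart_push oOm sG (ej j) ac Omt Gt'.
rewrite G0 pG (in_chartZ _ _ ac ct) => <-.
by rewrite /b.
Qed.

Lemma tubular_step : exists (G1 : V -> M) (Om' : set V),
  tubular G1 Om' (fun t => mu t + cos_bump l t0 eta t).
Proof.
exists G', (Om1 `|` Om2).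
have phip t : phi (t + l) = phi t := bumpD l0 t0 eta t.
have Ep x : E (x + l *: e0) = E x.
  rewrite /E; apply: eq_bigr => j _; rewrite shiftj shift0.
  by rewrite /b gp Bp.
have Hp x : H (x + l *: e0) = H x by rewrite /H Gp Ep shift0 phip.
split; split.
- exact: openU.
- move=> x; rewrite /Om1 /Om2 /O /I /setU /setI /preimage /mkset.
  by rewrite Omp Gp Hp shift0 gp addrAC (cos_freqD l0).
- exact: Om12.
- exact: sG'.
- by move=> x; rewrite /G' shift0 phip Gp Hp.
- move=> t; case: (Om12 t) => [t1|t2]; first by rewrite G'1.
  rewrite G'2 // /H E0 scaler0 addr0 cmapK //.
  by have [[[]]] := t2.
- by move=> t; rewrite addr_ge0 // bump_ge0.
- by move=> j t; case: (Om12 t) => [/push1|/push2].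
Qed.

End Step.

(** Induction on the centres of the bumps. The weight only increases, so positivity obtained in one
    step survives the following ones. *)
Lemma tubular_exists : exists (G : V -> M) (Om : set V) (mu : R -> R),
  tubular G Om mu /\ forall t, 0 < mu t.
Proof.
have cg : continuous gamma by move=> t; exact: sg.1.
have [s [eta [Heta Hs]]] := chart_cover l0 cg gp.
suff [G [Om [mu [tG Hmu]]]] : exists G Om mu, tubular G Om mu /\
    forall t t0, t0 \in s -> eta t0 < cos (freq l * (t - t0)) -> 0 < mu t.
  exists G, Om, mu; split=> // t; have [t0 t0s ht] := Hs t.
  exact: Hmu t0s ht.
elim: s {Hs} => [|t0 s [G [Om [mu [tG Hmu]]]]].
  by exists (fun x => gamma (x ord0 ord0)), setT, (fun=> 0); split; [exact: tubular_init|].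
have [G' [Om' tG']] := tubular_step tG (chart_at_atlas (gamma t0)) (Heta t0).
exists G', Om', (fun t => mu t + cos_bump l t0 (eta t0) t); split=> // t t1.
rewrite inE => /predU1P[->|t1s] ht.
  rewrite ltr_wpDl ?bump_gt0 //.
  by case: tG => _ [].
by rewrite ltr_wpDr ?bump_ge0 // (Hmu t t1).
Qed.

End Tubular.

(** * The cylinder *)

Section Subspaces.

Lemma continuous_set_type (X T : topologicalType) (A : set T)
    (h : X -> set_type A) x :
  {for x, continuous (set_val \o h)} -> {for x, continuous h}.
Proof.
move=> ch U [_ /= [[B oB <-] /= Bx BU]].
have : nbhs x ((set_val \o h) @^-1` B) by apply: ch; exact: open_near.
by rewrite /nbhs /=; apply: filterS => y; exact: BU.
Qed.

Lemma second_countable_set_type (T : topologicalType) (A : set T) :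
  @second_countable T -> @second_countable (set_type A).
Proof.
move=> [B cB [oB nB]]; exists ((fun U => set_val @^-1` U : set (set_type A)) @` B).
  exact: (card_le_trans (card_image_le _ _)).
split=> [_ [U BU <-]|x V [_ /= [[U oU <-] /= Ux UV]]].
  by exists U => //; exact: oB.
have := nB (set_val x) _ (open_near oU Ux) => -[W /= [BW Wx] WU].
exists (set_val @^-1` W); first by split=> //; exists W.
by move=> y Wy; apply: UV; exact: WU.
Qed.

Lemma hausdorff_set_type (T : topologicalType) (A : set T) :
  hausdorff_space T -> hausdorff_space (set_type A).
Proof.
rewrite !open_hausdorff => hT x y xy.
have vxy : set_val x != set_val y.
  by apply: contra xy => /eqP; rewrite set_valE => /val_inj ->.
have [[U V] /= [Ux Vy] [oU oV UV]] := hT _ _ vxy.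
exists (set_val @^-1` U, set_val @^-1` V) => /=.
  by split; rewrite inE; move: Ux Vy; rewrite !inE.
split; [by exists U|by exists V|].
apply/eqP/seteqP; split=> // z [Uz Vz]; move/eqP/seteqP: UV => [+ _].
by apply; split; [exact: Uz|exact: Vz].
Qed.

(** Balls with rational centres and radii [1 / (k + 1)]. The cylinder is a subset of this space and
    inherits the property. *)
Lemma second_countable_space3 (R : realType) :
  @second_countable (R * R * R)%type.
Proof.
have del (k : nat) : (0 : R) < k.+1%:R^-1 by rewrite invr_gt0.
pose q3 (q : rat * rat * rat) : R * R * R := (ratr q.1.1, ratr q.1.2, ratr q.2).
pose D (qk : rat * rat * rat * nat) : set (R * R * R) :=
  ball (q3 qk.1) (qk.2.+1%:R^-1).
exists (range D).
  apply: (card_le_trans (card_image_le _ _)).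
  exact: countableP.
split=> [_ [qk _ <-]|x V /nbhs_ballP[e /= e0 eV]].
  exact: ball_open.
have [k ke] : exists k : nat, k.+1%:R^-1 < e / 2.
  have e2 : 0 < e / 2 by rewrite divr_gt0.
  have [N _ HN] := near_infty_natSinv_lt (PosNum e2).
  by exists N; apply: (HN N) => /=.
have approx (z : R) : exists q : rat, `|ratr q - z| < k.+1%:R^-1.
  have [|q] := @rat_in_itvoo R (z - k.+1%:R^-1) (z + k.+1%:R^-1).
    by rewrite ltrD2l gtrN // del.
  by rewrite in_itv /= => H; exists q; rewrite ltr_distl.
have [q1 h1] := approx x.1.1; have [q2 h2] := approx x.1.2.
have [q3' h3] := approx x.2.
have Dx : ball (q3 (q1, q2, q3')) k.+1%:R^-1 x by split; [split|].
exists (D (q1, q2, q3', k)); first by split=> //; exists (q1, q2, q3', k).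
move=> y /= Dy; apply: eV; rewrite [e]splitr.
apply: (ball_triangle (y := q3 (q1, q2, q3'))).
  by apply: ball_sym; apply: le_ball Dx; exact: ltW.
by apply: le_ball Dy; exact: ltW.
Qed.

End Subspaces.

Section Angle.
Variables (R : realType) (l : R).
Hypothesis l0 : 0 < l.
Local Notation w := (freq l).

Let w0 : 0 < w := freq_gt0 l0.
Let wl : w * l = 2 * pi := freqM l0.
Let pi0 : 0 < pi :> R := pi_gt0 R.

Lemma cos_freqDint x (k : int) : cos (w * (x + k%:~R * l)) = cos (w * x).
Proof. exact: (@periodic_int R R (fun x => cos (w * x)) l (cos_freqD l0)). Qed.

Lemma sin_freqDint x (k : int) : sin (w * (x + k%:~R * l)) = sin (w * x).
Proof. exact: (@periodic_int R R (fun x => sin (w * x)) l (sin_freqD l0)). Qed.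

Let quarter b : `|b| < l / 4 -> - (pi / 2) < w * b < pi / 2.
Proof.
have E : w * (l / 4) = pi / 2.
  by rewrite mulrA wl; field.
by rewrite ltr_norml -E -[- (w * _)]mulrN !(ltr_pM2l w0).
Qed.

Lemma cos_freq_gt0 b : `|b| < l / 4 -> 0 < cos (w * b).
Proof. by move=> /quarter; exact: cos_gt0_pihalf. Qed.

Lemma asin_freq b : `|b| < l / 4 -> asin (sin (w * b)) / w = b.
Proof.
move=> /quarter /andP[b1 b2]; rewrite sinK; last by rewrite in_itv /= !ltW.
by rewrite mulrC mulKf // gt_eqF.
Qed.

(** After reduction to [0 <= r < l], the cosine is positive only in the first and the last quarter
    of the period, and the last one is brought near 0 by one more translation. *)
Lemma cos_freq_gt0P a : 0 < cos (w * a) -> exists k : int, `|a + k%:~R * l| < l / 4.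
Proof.
move=> ca; have [k /andP[r0 rl]] := mod_period a l0.
set r := a - _ in r0 rl.
have cr : 0 < cos (w * r).
  by rewrite /r -mulNr -mulrNz cos_freqDint.
have [r1|r1] := ltP r (l / 4).
  by exists (- k); rewrite mulrNz mulNr -/r ger0_norm.
have [r2|r2] := ltP (3 * (l / 4)) r.
  exists (- (k + 1)); rewrite mulrNz mulNr intrD mulrDl mul1r opprD addrA -/r.
  by rewrite distrC ger0_norm; lra.
exfalso; move: cr; rewrite ltNge => /negP; apply.
have E : w * r = w * (r - l / 2) + pi.
  have Hl : w * (l / 2) = pi by rewrite mulrA wl; field.
  by rewrite [w * (r - _)]mulrBr Hl subrK.
rewrite E cosDpi oppr_le0 cos_ge0_pihalf //.
have H (x : R) : w * (x * (l / 4)) = x * (pi / 2).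
  have Hl : w * (l / 4) = pi / 2 by rewrite mulrA wl; field.
  by rewrite mulrCA Hl.
have E2 : - (pi / 2) = w * (- 1 * (l / 4)) by rewrite H; lra.
have E3 : pi / 2 = w * (1 * (l / 4)) by rewrite H; lra.
rewrite E2 E3 !(ler_pM2l w0).
by apply/andP; split; lra.
Qed.

End Angle.

Section Cylinder.
Variables (R : realType) (l : R) (Om : set 'rV[R]_2).
Local Notation V := 'rV[R]_2.
Local Notation e0 := (delta_mx ord0 ord0 : V).
Local Notation i1 := (lift ord0 ord0 : 'I_2).
Local Notation e1 := (delta_mx ord0 i1 : V).
Local Notation w := (freq l).
Hypotheses (l0 : 0 < l) (oOm : open Om)
  (Omp : forall y, Om (y + l *: e0) = Om y) (Om0 : Om 0).

(** The quotient by [y |-> y + l *: e0] is realised in space as a subset of a circle times a line,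
    so that the Hausdorff property and second countability are inherited. *)
Definition cyl (y : V) : R * R * R :=
  (cos (w * y ord0 ord0), sin (w * y ord0 ord0), y ord0 i1).

Let Q := [set q | exists2 y, Om y & cyl y = q].
Let C := set_type Q.

Let memQ y : Om y -> cyl y \in Q.
Proof. by move=> Oy; rewrite inE; exists y. Qed.

(** Outside [Om] the value is a default, the image of 0, which lies in [Om]. *)
Definition cyl_proj (y : V) : C :=
  match pselect (Om y) with
  | left Oy => exist _ (cyl y) (memQ Oy)
  | right _ => exist _ (cyl 0) (memQ Om0)
  end.
Local Notation pr := cyl_proj.

Let val_pr y : Om y -> set_val (pr y) = cyl y.
Proof. by move=> Oy; rewrite /cyl_proj; case: pselect. Qed.

Let pr_surj p : exists2 y, Om y & pr y = p.
Proof.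
have [y Oy yp] := set_mem (valP p); exists y => //.
by apply: val_inj; rewrite -set_valE val_pr.
Qed.

Let coord0 (y : V) a : (y + a *: e0) ord0 ord0 = y ord0 ord0 + a.
Proof. by rewrite !mxE eqxx mulr1. Qed.

Let coord1 (y : V) a : (y + a *: e0) ord0 i1 = y ord0 i1.
Proof. by rewrite !mxE /= mulr0 addr0. Qed.

Let Ompk y (k : int) : Om (y + (k%:~R * l) *: e0) = Om y.
Proof.
have P := @periodic_int R Prop (fun t => Om (y + t *: e0)) l.
rewrite -[k%:~R * l]add0r P ?scale0r ?addr0 // => t.
by rewrite scalerDl addrA Omp.
Qed.

Let cylk y (k : int) : cyl (y + (k%:~R * l) *: e0) = cyl y.
Proof. by rewrite /cyl coord0 coord1 (cos_freqDint l0) (sin_freqDint l0). Qed.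

Let prk y (k : int) : Om y -> pr (y + (k%:~R * l) *: e0) = pr y.
Proof.
by move=> Oy; apply: val_inj; rewrite -!set_valE !val_pr ?Ompk ?cylk.
Qed.

Let pr_eq y y' : Om y -> Om y' -> pr y = pr y' ->
  exists k : int, y' = y + (k%:~R * l) *: e0.
Proof.
move=> Oy Oy' E; have : cyl y' = cyl y by rewrite -!val_pr // E.
case=> Ec Es E1.
have : cos (w * y' ord0 ord0 - w * y ord0 ord0) = 1.
  by rewrite cosB Ec Es -!expr2 cos2Dsin2.
move=> /cos_eq1[k Ek]; exists k.
have Ey : y' ord0 ord0 = y ord0 ord0 + k%:~R * l.
  have wn0 : w != 0 by rewrite gt_eqF // freq_gt0.
  apply: (mulfI wn0); rewrite mulrDr [w * (_ * l)]mulrCA freqM // -Ek.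
  by rewrite addrC subrK.
apply/rowP => i; case: (unliftP ord0 i) => [j ->|->]; last by rewrite coord0.
by rewrite ord1 coord1.
Qed.

Section ChartAt.
Variable t0 : R.

(** [X] and [Y] are the cosine and the sine of the angle measured from [t0]. On the half cylinder
    [X > 0] this angle is less than a quarter turn, so the arcsine of [Y] recovers it. *)
Let X (p : C) := (set_val p).1.1 * cos (w * t0) + (set_val p).1.2 * sin (w * t0).
Let Y (p : C) := (set_val p).1.2 * cos (w * t0) - (set_val p).1.1 * sin (w * t0).
Let dom : set C := [set p | 0 < X p].
Let cod : set V := Om `&` [set y : V | `|y ord0 ord0 - t0| < l / 4].
Let mp (p : C) : V := (t0 + asin (Y p) / w) *: e0 + (set_val p).2 *: e1.

Let X_pr y : Om y -> X (pr y) = cos (w * (y ord0 ord0 - t0)).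
Proof. by move=> Oy; rewrite /X val_pr //= mulrBr cosB. Qed.

Let Y_pr y : Om y -> Y (pr y) = sin (w * (y ord0 ord0 - t0)).
Proof. by move=> Oy; rewrite /Y val_pr //= mulrBr sinB. Qed.

Let cod_proj y : cod y -> dom (pr y).
Proof. by move=> [Oy yt]; rewrite /dom /= X_pr // cos_freq_gt0. Qed.

(** Read in the plane, the chart is a translation by the multiple of [l] that brings [y] within a
    quarter period of [t0]; hence changes of charts are locally translations. *)
Lemma cyl_map_proj y (k : int) : Om y ->
  `|y ord0 ord0 - t0 + k%:~R * l| < l / 4 -> mp (pr y) = y + (k%:~R * l) *: e0.
Proof.
move=> Oy yt; rewrite /mp Y_pr // -(sin_freqDint l0 _ k) asin_freq // val_pr //=.
apply/rowP => i; case: (unliftP ord0 i) => [j ->|->].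
  have -> : j = ord0 by exact: ord1.
  by rewrite coord1 !mxE !eqxx /= mulr0 add0r mulr1.
by rewrite coord0 !mxE !eqxx /= mulr0 mulr1; ring.
Qed.

Let mapK p : dom p -> exists y k, [/\ Om y, pr y = p, cod (y + (k%:~R * l) *: e0)
  & mp p = y + ((k : int)%:~R * l) *: e0].
Proof.
have [y Oy <-] := pr_surj p; rewrite /dom /= X_pr // => /(cos_freq_gt0P l0)[k yk].
exists y, k; split=> //; last exact: cyl_map_proj.
by split; [rewrite Ompk|rewrite /= coord0 addrAC].
Qed.

Let cont_val p : {for p, continuous (set_val : C -> R * R * R)}.
Proof. exact: initial_continuous. Qed.

Let cont1 p : {for p, continuous (fun p : C => (set_val p).1.1)}.
Proof.
apply: continuous_comp; last exact: cvg_fst.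
by apply: continuous_comp; [exact: cont_val|exact: cvg_fst].
Qed.

Let cont2 p : {for p, continuous (fun p : C => (set_val p).1.2)}.
Proof.
apply: (@continuous_comp _ _ _ (fun p : C => (set_val p).1) snd); last exact: cvg_snd.
by apply: continuous_comp; [exact: cont_val|exact: cvg_fst].
Qed.

Let cont3 p : {for p, continuous (fun p : C => (set_val p).2)}.
Proof.
by apply: continuous_comp; [exact: cont_val|exact: cvg_snd].
Qed.

Let contX p : {for p, continuous X}.
Proof.
apply: continuousD; apply: continuousM; by [exact: cont1|exact: cont2|exact: cst_continuous].
Qed.

Let contY p : {for p, continuous Y}.
Proof.
apply: continuousB; apply: continuousM; by [exact: cont1|exact: cont2|exact: cst_continuous].
Qed.

Let Yrange p : dom p -> -1 < Y p < 1.
Proof.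
have [y Oy <-] := pr_surj p; rewrite /dom /= X_pr // Y_pr // => c0.
have := cos2Dsin2 (w * (y ord0 ord0 - t0)); set s := sin _; set c := cos _ in c0 *.
move=> H; have c2 : 0 < c ^+ 2 by rewrite exprn_gt0.
by apply/andP; split; nra.
Qed.

(** All charts share the inverse [cyl_proj]. The definition is transparent because later proofs
    compute its fields. *)
Definition cyl_chart : chart R 2 C.
Proof.
refine (@Chart R 2 C dom cod mp pr _ _ _ _ _ _ _ _).
- have -> : dom = setT `&` X @^-1` [set x | 0 < x] by rewrite setTI.
  by apply: open_setI_preimage; [exact: openT|exact: open_gt|move=> p _].
- apply: (@open_setI_preimage _ _ Om (fun y : V => `|y ord0 ord0 - t0|)
    [set x | x < l / 4] oOm (@open_lt R (l / 4))) => y _.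
  apply: (@continuous_comp _ _ _ (fun y : V => y ord0 ord0 - t0) Num.norm).
    by apply: continuousB; [exact: coord_continuous|exact: cst_continuous].
  exact: norm_continuous.
- by move=> p /mapK[y [k [_ _ yk ->]]].
- exact: cod_proj.
- by move=> p /mapK[y [k [Oy <- _ ->]]]; rewrite prk.
- move=> y [Oy yt]; rewrite (cyl_map_proj (k := 0) Oy) ?mul0r ?scale0r ?addr0 //.
- move=> p dp; apply/continuous_mxP => i j; rewrite ord1.
  have cA : {for p, continuous (fun p : C => t0 + asin (Y p) / w)}.
    apply: continuousD; first exact: cst_continuous.
    apply: continuousM; last exact: cst_continuous.
    apply: continuous_comp; first exact: contY.
    exact: continuous_asin (Yrange dp).
  case: (unliftP ord0 j) => [j' ->|->].
    have -> : j' = ord0 by exact: ord1.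
    rewrite (_ : (fun y => _) = (fun p : C => (set_val p).2)); first exact: cont3.
    by apply/funext => q; rewrite !mxE !eqxx /= mulr0 add0r mulr1.
  rewrite (_ : (fun y => _) = (fun p : C => t0 + asin (Y p) / w)); first exact: cA.
  by apply/funext => q; rewrite !mxE !eqxx /= mulr0 addr0 mulr1.
- move=> y [Oy _]; apply: continuous_set_type.
  have near_cyl : \forall z \near y, cyl z = (set_val \o pr) z.
    by apply: filterS (open_near oOm Oy) => z Oz; rewrite /= val_pr.
  apply: continuous_near_eq near_cyl _.
  have c0 : {for y, continuous (fun z : V => w * z ord0 ord0)}.
    by apply: continuousM; [exact: cst_continuous|exact: coord_continuous].
  have c1 : {for y, continuous (fun z : V => cos (w * z ord0 ord0))}.
    exact: (@continuous_comp _ _ _ (fun z : V => w * z ord0 ord0) cos _ c0 (@continuous_cos R _)).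
  have c2 : {for y, continuous (fun z : V => sin (w * z ord0 ord0))}.
    exact: (@continuous_comp _ _ _ (fun z : V => w * z ord0 ord0) sin _ c0 (@continuous_sin R _)).
  have c3 : {for y, continuous (fun z : V => z ord0 i1)} by exact: coord_continuous.
  exact: (cvg_pair (cvg_pair c1 c2) c3).
Defined.

Lemma smooth_cyl_chart :
  smooth_on (Om `&` pr @^-1` cdom cyl_chart) (cmap cyl_chart \o pr).
Proof.
apply: smooth_on_local => y [Oy]; rewrite /preimage /= /dom /= X_pr //.
move=> /(cos_freq_gt0P l0)[k yk].
pose f (y : V) := y ord0 ord0 - t0 + k%:~R * l.
pose U := Om `&` (fun y => `|f y|) @^-1` [set x | x < l / 4].
have oU : open U.
  apply: (open_setI_preimage (f := fun y => `|f y|) oOm (@open_lt R (l / 4))) => z _.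
  apply: (@continuous_comp _ _ _ f Num.norm); last exact: norm_continuous.
  apply: continuousD; last exact: cst_continuous.
  by apply: continuousB; [exact: coord_continuous|exact: cst_continuous].
exists U; first by split.
have s1 := smooth_onD oU (smooth_on_id U) (smooth_on_cst U ((k%:~R * l) *: e0)).
by apply: smooth_on_ext oU _ s1 => z [Oz zk]; exact: esym (cyl_map_proj Oz zk).
Qed.

Lemma cyl_chart_dom y : Om y -> y ord0 ord0 = t0 -> cdom cyl_chart (pr y).
Proof. by move=> Oy yt; rewrite /= /dom /= X_pr // yt subrr mulr0 cos0. Qed.

Lemma cyl_chart_cod y : Om y -> y ord0 ord0 = t0 -> ccod cyl_chart y.
Proof. by move=> Oy yt; split=> //=; rewrite yt subrr normr0 divr_gt0. Qed.

End ChartAt.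

(** An interface that hides the embedding in space: charts are local inverses of [p], and two points
    of [Om] have the same image exactly when they differ by a multiple of the period. *)
Lemma cylinder_manifold : exists (S : manifold R 2) (p : V -> S),
  [/\ forall c y, atlas S c -> ccod c y -> Om y /\ cinv c y = p y,
      forall q, exists2 y, Om y & p y = q,
      forall y y', Om y -> Om y' -> p y = p y' ->
        exists k : int, y' = y + (k%:~R * l) *: e0,
      forall y (k : int), Om y -> p (y + (k%:~R * l) *: e0) = p y
    & smooth_into p Om].
Proof.
pose rep (q : C) : V := projT1 (cid2 (pr_surj q)).
have repP q : Om (rep q) /\ pr (rep q) = q.
  by rewrite /rep; case: (cid2 _).
have hausC : hausdorff_space C by apply: hausdorff_set_type; exact: norm_hausdorff.
have scC : @second_countable C.
  by apply: second_countable_set_type; exact: second_countable_space3.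
have compat c d : range cyl_chart c -> range cyl_chart d ->
    smooth_on (ccod c `&` cinv c @^-1` cdom d) (cmap d \o cinv c).
  move=> [t0 _ <-] [t1 _ <-]; apply: smooth_on_subset (@smooth_cyl_chart t1).
  by move=> y [[Oy _] dy]; split.
have domP q : cdom (cyl_chart (rep q ord0 ord0)) q.
  have [Oq Eq] := repP q; rewrite -[X in cdom _ X]Eq.
  exact: cyl_chart_dom.
pose S := @Manifold R 2 C hausC scC (range cyl_chart) compat
  (fun q => cyl_chart (rep q ord0 ord0)) (fun q => imageT _ _) domP.
exists S, (pr : V -> S); split.
- by move=> c y [t0 _ <-] [Oy _].
- exact: pr_surj.
- exact: pr_eq.
- exact: prk.
split=> [y Oy|c [t0 _ <-]]; last exact: smooth_cyl_chart.
by apply: (@cinv_cont _ _ _ (cyl_chart (y ord0 ord0))); exact: cyl_chart_cod.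
Qed.

End Cylinder.

(** * The surface through the curve *)

Section RotatedFrame.
Variables (R : realType) (M : manifold R 3) (g : metric M).
Variables (l : R) (gamma : R -> M) (W : R -> 'rV[R]_3).
Hypotheses (gamma_closed : closed_curve l gamma)
  (gamma_unit : unit_speed g gamma) (gamma_frenet : frenet g gamma l W).

Local Notation T := (velocity gamma).
Local Notation P := (principal_normal g gamma).
Local Notation D := (Dt g gamma).
Local Notation "<< u , v >>_ t" := (inner g (gamma t) u v)
  (at level 0, t at level 0, format "<< u ,  v >>_ t").
Local Notation along := (smooth_along gamma setT).
Local Notation tau := (torsion g gamma W).

Variables (th : R -> R) (k : int).
Hypotheses (dth : forall t : R, is_derive t 1 th (tau t))
  (thl : th l - th 0 = k%:~R * (2 * pi)).

Let oT : open [set: R] := openT.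
Let sg : smooth_into gamma setT := gamma_closed.1.

(** [a = 0] gives the normal of the future strip and [a = pi / 2] its tangent field across the
    curve; one family covers both. *)
Definition rotP (a : R) (t : R) : 'rV[R]_3 :=
  cos (th t + a) *: P t + sin (th t + a) *: W t.

Let sP : along P := smooth_along_principal_normal gamma_closed gamma_frenet.
Let sW : along W := smooth_along_binormal gamma_frenet.

Let sth : smooth_on setT th.
Proof.
exact: (smooth_on_primitive oT (fun t _ => dth t)
  (smooth_on_torsion gamma_closed gamma_frenet)).
Qed.

Let stha a : smooth_on setT (fun t => th t + a).
Proof. exact: (smooth_onD oT sth (smooth_on_cst _ a)). Qed.

Lemma smooth_along_rotP a : along (rotP a).
Proof.
apply: (smooth_alongD oT sg).
  exact: (smooth_alongZ oT sg (smooth_on_cos oT (stha a)) sP).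
exact: (smooth_alongZ oT sg (smooth_on_sin oT (stha a)) sW).
Qed.

(** The hypothesis gives the increment over a period only from 0; since the torsion is periodic,
    [th (s + l) - th s] has derivative 0. *)
Let th_shift t : th (t + l) = th t + k%:~R * (2 * pi).
Proof.
pose h s := th (s + l) - th s.
have dh (s : R) : is_derive s 1 h 0.
  have ds : is_derive s (1 : R) (fun s : R => s + l) 1.
    apply: (is_derive_eq (is_deriveD (is_derive_id s (1 : R)) (is_derive_cst l s 1))).
    by rewrite addr0.
  have d1 := @is_derive1_comp R th (fun s : R => s + l) s _ _ (dth (s + l)) ds.
  apply: (is_derive_eq (is_deriveB d1 (dth s))).
  by rewrite mulr1 (torsion_periodic gamma_closed gamma_frenet) subrr.
have : h t = h 0 by apply: is_derive_0_is_cst.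
by rewrite /h add0r thl => <-; rewrite [RHS]addrC subrK.
Qed.

Lemma rotP_periodic a t : rotP a (t + l) = rotP a t.
Proof.
rewrite /rotP th_shift addrAC cosDint sinDint.
by rewrite (principal_normal_periodic g gamma_closed) (binormal_periodic gamma_frenet).
Qed.

Lemma inner_rotP_P a t : << rotP a t, P t >>_ t = cos (th t + a).
Proof.
by rewrite inner_lin2 (innerPP gamma_frenet) (innerWP gamma_frenet); ring.
Qed.

Lemma inner_rotP_W a t : << rotP a t, W t >>_ t = sin (th t + a).
Proof.
rewrite inner_lin2 (innerWW gamma_frenet) [<< P t, _ >>_ t]innerC.
by rewrite (innerWP gamma_frenet); ring.
Qed.

Lemma inner_rotP_T a t : << rotP a t, T t >>_ t = 0.
Proof.
by rewrite inner_lin2 (innerPT gamma_closed gamma_unit) (innerWT gamma_frenet); ring.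
Qed.

Lemma inner_rotP a b t : << rotP a t, rotP b t >>_ t = cos (a - b).
Proof.
rewrite {1}/rotP inner_lin2 [<< P t, _ >>_ t]innerC [<< W t, _ >>_ t]innerC.
rewrite inner_rotP_P inner_rotP_W -cosB.
by congr cos; ring.
Qed.

Let dtha a (t : R) : is_derive t 1 (fun s => th s + a) (tau t).
Proof.
apply: (is_derive_eq (is_deriveD (dth t) (is_derive_cst a t (1 : R)))).
by rewrite addr0.
Qed.

(** The products with [P] and [W] are the cosine and the sine of [th + a]; their derivatives are
    entirely accounted for by the turning of [P] and [W], so [D (rotP a)] has no component in these
    directions. *)
Lemma Dt_rotP a t : exists b : R, D (rotP a) t = b *: T t.
Proof.
exists << D (rotP a) t, T t >>_ t.
have sN := smooth_along_rotP a.
have HP : << D (rotP a) t, P t >>_ t = 0.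
  have [_ E] := is_derive_inner g gamma_closed t sN sP.
  have d := @is_derive1_comp R cos (fun s => th s + a) t _ _ (is_derive_cos _) (dtha a t).
  have E1 : (fun s => << rotP a s, P s >>_ s) = cos \o (fun s => th s + a).
    by apply/funext => s; exact: inner_rotP_P.
  rewrite E1 in E; have {}E := etrans (esym (derive_val (is_derive := d))) E.
  have F : << rotP a t, D P t >>_ t = - (sin (th t + a) * tau t).
    rewrite inner_lin2 [<< P t, _ >>_ t]innerC [<< W t, _ >>_ t]innerC.
    rewrite (inner_DPP gamma_closed gamma_frenet) (inner_DPW gamma_frenet).
    by ring.
  by move: E; rewrite F; lra.
have HW : << D (rotP a) t, W t >>_ t = 0.
  have [_ E] := is_derive_inner g gamma_closed t sN sW.
  have d := @is_derive1_comp R sin (fun s => th s + a) t _ _ (is_derive_sin _) (dtha a t).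
  have E1 : (fun s => << rotP a s, W s >>_ s) = sin \o (fun s => th s + a).
    by apply/funext => s; exact: inner_rotP_W.
  rewrite E1 in E; have {}E := etrans (esym (derive_val (is_derive := d))) E.
  have F : << rotP a t, D W t >>_ t = cos (th t + a) * tau t.
    rewrite inner_lin2 [<< P t, _ >>_ t]innerC [<< W t, _ >>_ t]innerC.
    rewrite (inner_DWW gamma_closed gamma_frenet) (inner_DWP gamma_closed gamma_frenet).
    by ring.
  by move: E; rewrite F; lra.
apply/eqP; rewrite -subr_eq0; apply/eqP.
set b := << _, _ >>_ t.
apply: (@frame_eq0 _ _ g l gamma W gamma_closed gamma_unit gamma_frenet t).
- by rewrite innerDl innerNl innerZl (innerTT gamma_unit) mulr1 subrr.
- rewrite innerDl innerNl innerZl HP innerC (innerPT gamma_closed gamma_unit).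
  by ring.
- rewrite innerDl innerNl innerZl HW innerC (innerWT gamma_frenet).
  by ring.
Qed.

End RotatedFrame.

Lemma push_sum (R : realType) n m (M : manifold R n) (F : 'rV[R]_m -> M)
    (U : set 'rV[R]_m) x v : open U -> smooth_into F U -> U x ->
  push F x v = \sum_i v ord0 i *: push F x (delta_mx ord0 i).
Proof.
move=> oU sF Ux; have ac := chart_at_atlas (F x).
apply: derive_rowE.
apply: (smooth_differentiable (open_chart_dom oU sF (chart_at (F x))) _ (sF.2 _ ac)).
by split=> //; exact: chart_at_dom.
Qed.

Lemma push_periodic (R : realType) n (M : manifold R n) (V : normedModType R)
    (F : V -> M) (e x v : V) : (forall y, F (y + e) = F y) ->
  push F (x + e) v = push F x v.
Proof.
move=> Fe; rewrite /push Fe /derive; set f := cmap _ \o F.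
have -> : (fun h : R => h^-1 *: ((f \o shift (x + e)) (h *: v) - f (x + e))) =
    (fun h : R => h^-1 *: ((f \o shift x) (h *: v) - f x)) => //.
by apply/funext => h; rewrite /f /= addrA !Fe.
Qed.

(* The last vector of the basis dual to [push Phi x e_i], computed from the
   Gram matrix [gramV]: it is orthogonal to the image of the other ones. *)
Section DualNormal.
Variables (R : realType) (n m : nat) (M : manifold R n) (g : metric M).
Variables (Phi : 'rV[R]_m -> M) (Om : set 'rV[R]_m) (last : 'I_m).
Hypotheses (oOm : open Om) (sPhi : smooth_into Phi Om).
Local Notation V := 'rV[R]_m.
Local Notation e i := (delta_mx ord0 i : V).

Definition gramV (x : V) : 'M[R]_m :=
  \matrix_(i, j) inner g (Phi x) (push Phi x (e i)) (push Phi x (e j)).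

Lemma smooth_on_gramV : smooth_on Om gramV.
Proof.
apply/(smooth_on_mxP _ oOm) => i j.
have s := smooth_on_inner g oOm sPhi (smooth_along_push oOm sPhi (e i))
  (smooth_along_push oOm sPhi (e j)).
by apply: smooth_on_ext oOm _ s => x _; rewrite mxE.
Qed.

(** Gram determinants are nonnegative, so positivity expresses the linear independence of the
    vectors [push Phi x (e i)], as an open condition. *)
Definition regular : set V := Om `&` (fun x => \det (gramV x)) @^-1` [set d | 0 < d].

Lemma open_regular : open regular.
Proof.
apply: (open_setI_preimage (f := fun x => \det (gramV x)) oOm (@open_gt R 0)) => x Ox.
exact: smooth_on_cont (smooth_on_det oOm smooth_on_gramV) Ox.
Qed.

Let sPhi' : smooth_into Phi regular.
Proof. by apply: smooth_into_subset sPhi => x []. Qed.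

Let unit_gramV x : regular x -> gramV x \in unitmx.
Proof. by move=> [_ d0]; rewrite unitmxE unitfE gt_eqF. Qed.

Definition dual_normal (x : V) : 'rV[R]_n :=
  \sum_j invmx (gramV x) last j *: push Phi x (e j).

Lemma inner_suml p (I : finType) (a : I -> R) (u : I -> 'rV[R]_n) v :
  inner g p (\sum_i a i *: u i) v = \sum_i a i * inner g p (u i) v.
Proof.
elim/big_rec2: _ => [|i y1 y2 _ <-]; first by rewrite inner0l.
by rewrite innerDl innerZl.
Qed.

Lemma inner_dual_normal x i : regular x ->
  inner g (Phi x) (dual_normal x) (push Phi x (e i)) = (last == i)%:R.
Proof.
move=> rx; rewrite inner_suml.
transitivity ((invmx (gramV x) *m gramV x) last i).
  by rewrite [RHS]mxE; apply: eq_bigr => j _; rewrite [gramV x j i]mxE.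
by rewrite mulVmx ?unit_gramV // mxE.
Qed.

Lemma smooth_along_sum (I : finType) (Y : I -> V -> 'rV[R]_n) :
  (forall i, smooth_along Phi regular (Y i)) ->
  smooth_along Phi regular (fun x => \sum_i Y i x).
Proof.
move=> sY c ac; have oc := open_chart_dom open_regular sPhi' c.
have s := smooth_on_sum (index_enum I) xpredT oc (fun i => sY i c ac).
apply: smooth_on_ext oc _ s => x [_ cx].
elim/big_rec2: _ => [|i y1 y2 _ ->]; first by rewrite in_chart0.
by rewrite in_chartD.
Qed.

Lemma smooth_along_dual_normal : smooth_along Phi regular dual_normal.
Proof.
apply: smooth_along_sum => j.
apply: (smooth_alongZ open_regular sPhi'); last first.
  exact: smooth_along_push open_regular sPhi' (e j).
have sG : smooth_on regular gramV by apply: smooth_on_subset smooth_on_gramV => x [].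
exact: (smooth_on_entry open_regular last j (smooth_on_invmx open_regular unit_gramV sG)).
Qed.

Definition unit_dual_normal (x : V) : 'rV[R]_n :=
  (Num.sqrt (inner g (Phi x) (dual_normal x) (dual_normal x)))^-1 *: dual_normal x.

Lemma dual_normal_neq0 x : regular x -> dual_normal x <> 0.
Proof.
move=> rx n0; have := inner_dual_normal last rx.
by rewrite n0 inner0l eqxx => /eqP; rewrite eq_sym oner_eq0.
Qed.

Lemma smooth_along_unit_dual_normal : smooth_along Phi regular unit_dual_normal.
Proof.
have oR := open_regular; have sN := smooth_along_dual_normal.
apply: (smooth_alongZ oR sPhi' _ sN).
apply: (smooth_onV oR) => [x rx|].
  by rewrite gt_eqF // sqrtr_gt0 inner_gt0 //; exact: dual_normal_neq0.
apply: (smooth_on_sqrt_comp oR) => [x rx|].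
  by apply: inner_gt0; exact: dual_normal_neq0.
exact: (smooth_on_inner g oR sPhi' sN sN).
Qed.

Lemma inner_unit_dual_normal x : regular x ->
  inner g (Phi x) (unit_dual_normal x) (unit_dual_normal x) = 1.
Proof.
move=> rx; have n0 := inner_gt0 g (Phi x) (dual_normal_neq0 rx).
rewrite innerZl innerZr mulrA -invfM -expr2 sqr_sqrtr ?ltW //.
by rewrite mulVf // gt_eqF.
Qed.

Lemma unit_dual_normal_push (x v : V) : regular x -> v ord0 last = 0 ->
  inner g (Phi x) (unit_dual_normal x) (push Phi x v) = 0.
Proof.
move=> rx vl.
have E : inner g (Phi x) (push Phi x v) (dual_normal x) = 0.
  rewrite (push_sum v oOm sPhi rx.1) inner_suml big1 // => i _.
  rewrite innerC inner_dual_normal //.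
  by case: eqP => [<-|_]; rewrite ?vl ?mul0r // mulr0.
by rewrite innerZl [X in _ * X]innerC E mulr0.
Qed.

Lemma push_regular_inj (x v : V) : regular x -> push Phi x v = 0 -> v = 0.
Proof.
move=> rx pv; apply: (can_inj (mulmxK (unit_gramV rx))); rewrite mul0mx.
apply/rowP => j; rewrite [RHS]mxE [LHS]mxE.
rewrite -[RHS](inner0l g (Phi x) (push Phi x (e j))) -pv (push_sum v oOm sPhi rx.1).
by rewrite inner_suml; apply: eq_bigr => i _; rewrite [gramV x i j]mxE.
Qed.

End DualNormal.

(** The Gram matrix is diagonal here and the dual basis is the rescaled frame; positivity of
    [a last] selects [F last] rather than its opposite. *)
Lemma unit_dual_normal_orthogonal (R : realType) m (M : manifold R m)
    (g : metric M) (Phi : 'rV[R]_m -> M) (Om : set 'rV[R]_m) (last : 'I_m)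
    (F : 'I_m -> 'rV[R]_m) (a : 'I_m -> R) x :
  Om x -> (forall i, 0 < a i) ->
  (forall i, push Phi x (delta_mx ord0 i) = a i *: F i) ->
  (forall i j, inner g (Phi x) (F i) (F j) = (i == j)%:R) ->
  regular g Phi Om x /\ unit_dual_normal g Phi last x = F last.
Proof.
move=> Ox a0 pF FF.
have rx : regular g Phi Om x.
  split=> //=.
  have -> : gramV g Phi x = diag_mx (\row_i (a i * a i)).
    apply/matrixP => i j; rewrite !mxE !pF innerZl innerZr FF mulrA.
    by case: eqP => [->|_]; rewrite ?mulr1 // !mulr0.
  by rewrite det_diag prodr_gt0 // => i _; rewrite mxE mulr_gt0.
split=> //.
have E : dual_normal g Phi last x = (a last)^-1 *: F last.
  apply/eqP; rewrite -subr_eq0; apply/eqP.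
  apply: (orthonormal_unitmx FF) => i.
  have ai0 : a i != 0 by rewrite gt_eqF.
  apply: (mulfI ai0); rewrite mulr0 -innerZr innerDl -pF (inner_dual_normal last i rx).
  rewrite innerNl innerZl pF innerZr FF.
  case: eqP => [->|_]; last by rewrite !mulr0 subr0.
  by rewrite mulr1 mulVf // subrr.
have al0 : 0 < (a last)^-1 by rewrite invr_gt0.
rewrite /unit_dual_normal E innerZl innerZr FF eqxx mulr1 -expr2 sqrtr_sqr.
by rewrite gtr0_norm // scalerA mulVf ?scale1r // gt_eqF.
Qed.

Section SurfaceThroughCurve.
Variables (R : realType) (M : manifold R 3) (g : metric M).
Variables (l : R) (gamma : R -> M) (W : R -> 'rV[R]_3).
Hypotheses (l0 : 0 < l) (gamma_closed : closed_curve l gamma)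
  (gamma_unit : unit_speed g gamma) (gamma_frenet : frenet g gamma l W).
Variables (th : R -> R) (k : int).
Hypotheses (dth : forall t : R, is_derive t 1 th (torsion g gamma W t))
  (thl : th l - th 0 = k%:~R * (2 * pi)).

Local Notation V2 := 'rV[R]_2.
Local Notation V3 := 'rV[R]_3.
Local Notation e0 := (delta_mx ord0 ord0).
Local Notation i1 := (lift ord0 ord0 : 'I_2).
Local Notation i2 := (lift ord0 i1 : 'I_3).
Local Notation N := (rotP g gamma W th 0).
Local Notation T := (velocity gamma).

Let sg : smooth_into gamma setT := gamma_closed.1.
Let gp : forall t, gamma (t + l) = gamma t := gamma_closed.2.

(** [N] comes last because the strip is obtained by setting the last coordinate to 0. *)
Let B (j : 'I_2) : R -> V3 :=
  if j == ord0 then rotP g gamma W th (pi / 2) else N.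

Let sB j : smooth_along gamma setT (B j).
Proof.
by rewrite /B; case: ifP => _; exact: (smooth_along_rotP gamma_closed gamma_frenet dth).
Qed.

Let Bp j t : B j (t + l) = B j t.
Proof.
by rewrite /B; case: ifP => _; exact: (rotP_periodic gamma_closed gamma_frenet dth thl).
Qed.

Let frame (t : R) (i : 'I_3) : V3 :=
  if unlift ord0 i is Some j then B j t else T t.

Let inner_BB t i j : inner g (gamma t) (B i t) (B j t) = (i == j)%:R.
Proof.
have ab a b := inner_rotP gamma_frenet th a b t.
have c0 : cos (pi / 2) = 0 :> R := cos_pihalf R.
have cases (s : 'I_2) : s = ord0 \/ s = i1.
  case: (unliftP ord0 s) => [j' ->|->]; last by left.
  by right; congr (lift ord0 _); exact: ord1.
rewrite /B; case: (cases i) => ->; case: (cases j) => -> /=; rewrite ab.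
- by rewrite subrr cos0.
- by rewrite subr0 c0.
- by rewrite sub0r cosN c0.
- by rewrite subrr cos0.
Qed.

Let inner_BT t i : inner g (gamma t) (B i t) (T t) = 0.
Proof.
by rewrite /B; case: ifP => _; exact: (inner_rotP_T gamma_closed gamma_unit gamma_frenet).
Qed.

Let frameP t i j : inner g (gamma t) (frame t i) (frame t j) = (i == j)%:R.
Proof.
rewrite /frame; case: (unliftP ord0 i) => [i' ->|->]; case: (unliftP ord0 j) => [j' ->|->].
- by rewrite inner_BB (inj_eq lift_inj).
- by rewrite inner_BT.
- by rewrite innerC inner_BT.
- by rewrite (innerTT gamma_unit) eqxx.
Qed.

Let J : 'M[R]_(2, 3) := \matrix_(i, j) (i == j :> nat)%:R.
Let iota (y : V2) : V3 := y *m J.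

Let mulJ0 (v : V2) : (v *m J) ord0 ord0 = v ord0 ord0.
Proof. by rewrite mxE !big_ord_recl big_ord0 !mxE /= mulr1 mulr0 !addr0. Qed.

Let mulJ1 (v : V2) : (v *m J) ord0 (lift ord0 ord0) = v ord0 i1.
Proof. by rewrite mxE !big_ord_recl big_ord0 !mxE /= mulr1 mulr0 add0r addr0. Qed.

Let mulJ2 (v : V2) : (v *m J) ord0 i2 = 0.
Proof. by rewrite mxE !big_ord_recl big_ord0 !mxE /= !mulr0 !addr0. Qed.

Let mulJ_inj (v : V2) : v *m J = 0 -> v = 0.
Proof.
move=> vJ; apply/rowP => i; rewrite [RHS]mxE.
case: (unliftP ord0 i) => [j ->|->].
  have -> : j = ord0 by exact: ord1.
  by rewrite -mulJ1 vJ mxE.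
by rewrite -mulJ0 vJ mxE.
Qed.

Let iota_axis (a : R) : iota (a *: e0) = a *: e0.
Proof.
rewrite /iota -scalemxAl -rowE; congr (_ *: _).
by apply/rowP => j; rewrite !mxE /= eq_sym.
Qed.

Let oT2 : open [set: V2] := openT.

Let smooth_iota (U : set V2) : open U -> smooth_on U iota.
Proof.
by move=> oU; exact: (smooth_on_mulmx oU (smooth_on_id U) (smooth_on_cst U J)).
Qed.

Let derivable_iota y v : derivable iota y v.
Proof. exact: smooth_on_derivable (smooth_iota oT2) _. Qed.

Let derive_iota y v : 'D_v iota y = v *m J.
Proof.
have di : derivable (@id V2) y v by exact: derivable_id.
have [_ E] := is_derive_mulmx di (derivable_cst J y v).
by apply: (etrans E); rewrite derive_id derive_cst mulmx0 addr0.
Qed.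

Lemma line_of_curvature_surface :
  exists (S : manifold R 2) (f : S -> M) (N : S -> 'rV[R]_3) (c : R -> S),
     immersion f /\ unit_normal g f N /\
     closed_curve l c /\ (forall t, f (c t) = gamma t) /\
     line_of_curvature g f N c.
Proof.
have [Phi [Om [mu [[[oOm Omp Om0 sPhi] [Phip Phi0 _ pPhi]] mu0]]]] :=
  tubular_exists l0 sg gp sB Bp.
pose reg := regular g Phi Om; pose nu := unit_dual_normal g Phi i2.
have oreg : open reg := open_regular oOm sPhi.
have sPhir : smooth_into Phi reg by apply: smooth_into_subset sPhi => x [].
have snu : smooth_along Phi reg nu := smooth_along_unit_dual_normal g i2 oOm sPhi.
(* Differentiate [Phi] along the axis, where it is the curve itself. *)
have pT t : push Phi (t *: e0) e0 = T t.
  have -> : T t = push (Phi \o (fun s : R => s *: (e0 : V3))) t 1.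
    by rewrite /velocity; congr (push _ t 1); apply/funext => s; rewrite /= Phi0.
  have [d1 d2] := derive_scale_line (e0 : V3) t.
  by rewrite (push_comp oOm sPhi d1 (Om0 t)) d2.
have axis t : reg (t *: e0) /\ nu (t *: e0) = N t.
  pose a (i : 'I_3) := if unlift ord0 i is Some j then mu t else 1.
  have [||||r E] := @unit_dual_normal_orthogonal R 3 M g Phi Om i2 (frame t) a (t *: e0).
  - exact: Om0.
  - by move=> i; rewrite /a; case: (unlift ord0 i).
  - move=> i; rewrite /a /frame; case: (unliftP ord0 i) => [j ->|->].
      by rewrite pPhi.
    by rewrite pT scale1r.
  - by move=> i j; rewrite Phi0 frameP.
  by split=> //; rewrite /nu E /frame liftK.
have pushp x v : push Phi (x + l *: e0) v = push Phi x v := push_periodic x v Phip.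
have gramp x : gramV g Phi (x + l *: e0) = gramV g Phi x.
  apply/matrixP => i j; rewrite [LHS]mxE [RHS]mxE Phip.
  by rewrite (pushp x (delta_mx ord0 i)) (pushp x (delta_mx ord0 j)).
have nup x : nu (x + l *: e0) = nu x.
  have E : dual_normal g Phi i2 (x + l *: e0) = dual_normal g Phi i2 x.
    by rewrite /dual_normal gramp; apply: eq_bigr => j _; rewrite pushp.
  by rewrite /nu /unit_dual_normal E Phip.
have regp x : reg (x + l *: e0) = reg x.
  by rewrite /reg /regular /setI /preimage /mkset Omp gramp.
pose F := Phi \o iota; pose Ny := nu \o iota.
pose U := [set: V2] `&` iota @^-1` reg.
have oU : open U.
  apply: open_setI_preimage oT2 oreg _ => y _.
  exact: smooth_on_cont (smooth_iota oT2) _.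
have iotap y : iota (y + l *: e0) = iota y + l *: e0.
  by rewrite /iota mulmxDl -/(iota (l *: e0)) iota_axis.
have Up y : U (y + l *: e0) = U y.
  by rewrite /U /setI /preimage /mkset iotap regp.
have Uax t : U (t *: e0) by split=> //; rewrite /preimage /= iota_axis; exact: (axis t).1.
have U0 : U 0 by have := Uax 0; rewrite scale0r.
have Ureg y : U y -> reg (iota y) by move=> [].
have sF : smooth_into F U := smooth_into_comp oreg sPhir oU (smooth_iota oU) Ureg.
have sNy : smooth_along F U Ny :=
  smooth_along_comp oreg sPhir oU (smooth_iota oU) Ureg snu.
have [S [p [chS surj peq pk sp]]] := cylinder_manifold l0 oU Up U0.
(* [rep] chooses an arbitrary preimage in the plane; periodic functions do not depend on the choice,
   which is how the map and its normal descend to the cylinder. *)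
pose rep q := projT1 (cid2 (surj q)).
have repP q : U (rep q) /\ p (rep q) = q by rewrite /rep; case: (cid2 _).
have perk (Z : Type) (h : V2 -> Z) (hp : forall y, h (y + l *: e0) = h y) y (m : int) :
    h (y + (m%:~R * l) *: e0) = h y.
  have P := @periodic_int R Z (fun t => h (y + t *: e0)) l.
  rewrite -[m%:~R * l]add0r P ?scale0r ?addr0 // => t.
  by rewrite scalerDl addrA hp.
have repE (Z : Type) (h : V2 -> Z) (hp : forall y, h (y + l *: e0) = h y) y :
    U y -> h (rep (p y)) = h y.
  move=> Uy; have [Ur Er] := repP (p y).
  have [m Em] := peq _ _ Ur Uy Er.
  by rewrite [in RHS]Em perk.
have Fp y : F (y + l *: e0) = F y by rewrite /F /= iotap Phip.
have Nyp y : Ny (y + l *: e0) = Ny y by rewrite /Ny /= iotap nup.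
pose f q := F (rep q); pose NS q := Ny (rep q).
have fE y : U y -> f (p y) = F y := repE _ F Fp y.
have NE y : U y -> NS (p y) = Ny y := repE _ Ny Nyp y.
have fc (c : chart R 2 S) y : atlas S c -> ccod c y -> F y = (f \o cinv c) y.
  by move=> ac cy; have [Uy E] := chS c y ac cy; rewrite /= E fE.
have Nc (c : chart R 2 S) y : atlas S c -> ccod c y -> Ny y = (NS \o cinv c) y.
  by move=> ac cy; have [Uy E] := chS c y ac cy; rewrite /= E NE.
have cU (c : chart R 2 S) : atlas S c -> ccod c `<=` U.
  by move=> ac y cy; have [] := chS c y ac cy.
have diffE q v : exists y, [/\ U y, f q = F y, NS q = Ny y &
    differential f q v = push Phi (iota y) (v *m J)].
  pose d := chart_at q; have ad : atlas S d := chart_at_atlas _.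
  have dq : cdom d q := chart_at_dom _.
  have cy := cmap_cod dq; have Uy := cU d ad _ cy.
  exists (cmap d q); split; first exact: Uy.
  - by rewrite (fc d _ ad cy) /= cmapK.
  - by rewrite (Nc d _ ad cy) /= cmapK.
  have E1 : differential f q v = push F (cmap d q) v.
    by apply: (push_ext (@ccod_open _ _ _ d) v cy) => z zc; rewrite (fc d z ad zc).
  have E2 := push_comp oreg sPhir (@derivable_iota (cmap d q) v) (Ureg _ Uy).
  rewrite derive_iota in E2; exact: (etrans E1 E2).
exists S, f, NS, (fun t => p (t *: e0)).
have fgamma : f \o (fun t => p (t *: e0)) = gamma.
  apply/funext => t; rewrite /= (fE _ (Uax t)) /F /= iota_axis.
  exact: Phi0.
have NSN : NS \o (fun t => p (t *: e0)) = N.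
  apply/funext => t; rewrite /= (NE _ (Uax t)) /Ny /= iota_axis.
  exact: (axis t).2.
split; [|split; [|split; [|split]]].
- split=> [c ac|q v].
    apply: (smooth_into_ext (@ccod_open _ _ _ c) (fun y => fc c y ac)).
    exact: smooth_into_subset (cU c ac) sF.
  have [y [Uy _ _ ->]] := diffE q v.
  by move=> /(push_regular_inj oOm sPhi (Ureg y Uy)) /mulJ_inj.
- split=> [c ac|].
    apply: (smooth_along_ext_map (@ccod_open _ _ _ c) (smooth_into_subset (cU c ac) sF)
      (fun y => fc c y ac) (fun y => Nc c y ac)).
    exact: smooth_along_subset (cU c ac) sNy.
  split=> [q|q v].
    have [y [Uy -> -> _]] := diffE q 0.
    by apply/gnorm1P; exact: inner_unit_dual_normal (Ureg y Uy).
  have [y [Uy -> -> ->]] := diffE q v.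
  exact: (unit_dual_normal_push oOm sPhi (Ureg y Uy) (mulJ2 v)).
- split.
    have sax : smooth_on setT (fun t : R => t *: (e0 : V2)).
      exact: (smooth_on_scale openT (smooth_on_id _) (smooth_on_cst _ e0)).
    exact: (smooth_into_comp oU sp openT sax (fun t _ => Uax t)).
  move=> t; have E := pk (t *: e0) 1 (Uax t); rewrite mulr1z mul1r in E.
  by rewrite scalerDl; exact: E.
- by move=> t; rewrite -[in RHS]fgamma.
- move=> t; rewrite fgamma NSN.
  exact: (Dt_rotP gamma_closed gamma_unit gamma_frenet dth 0 t).
Qed.

End SurfaceThroughCurve.

Theorem corollary1p4 (R : realType) (M : manifold R 3) (g : metric M)
    (l : R) (gamma : R -> M) (W : R -> 'rV[R]_3)
    (l_gt0 : 0 < l)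
    (gamma_closed : closed_curve l gamma)
    (gamma_unit : unit_speed g gamma)
    (gamma_frenet : frenet g gamma l W) :
  (forall (S : manifold R 2) (f : S -> M) (N : S -> 'rV[R]_3) (c : R -> S),
     immersion f -> unit_normal g f N ->
     closed_curve l c -> (forall t, f (c t) = gamma t) ->
     line_of_curvature g f N c ->
     (exists k : int,
        \int[lebesgue_measure]_(t in `[0, l]) torsion g gamma W t
          = k%:~R * (2 * pi)) /\
     (convex g f N ->
        \int[lebesgue_measure]_(t in `[0, l]) torsion g gamma W t = 0)) /\
  ((exists k : int,
      \int[lebesgue_measure]_(t in `[0, l]) torsion g gamma W t
        = k%:~R * (2 * pi)) ->
   exists (S : manifold R 2) (f : S -> M) (N : S -> 'rV[R]_3) (c : R -> S),
     immersion f /\ unit_normal g f N /\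
     closed_curve l c /\ (forall t, f (c t) = gamma t) /\
     line_of_curvature g f N c).
Proof.
split=> [S f N c fi fN cc fc line|[k Ek]].
  have E : f \o c = gamma by apply/funext.
  (* The result on surface curves is stated for [f \o c], so the curve is replaced by this
     composite. *)
  subst gamma.
  exact: (total_torsion_line_of_curvature fi fN cc gamma_closed gamma_unit
    gamma_frenet line l_gt0).
have [th [dth Eth]] := torsion_primitive gamma_closed gamma_frenet.
apply: (line_of_curvature_surface l_gt0 gamma_closed gamma_unit gamma_frenet dth).
exact: (etrans (esym (Eth 0 l (ltW l_gt0))) Ek).
Qed.
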